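(* Let $w$ be a valuation-transcendental extension of $v$ to $K(x)$, and $f,g\in\mathrm{KP}(w)$ such that $f=f^h$. Then $$d(K(\theta)|K)=d(K(\eta)|K)$$ for every root $\theta\in\overline K$ of $f$ and every root $\eta\in\overline K$ of $g$.
   Context: $(K,v)$ is a valued field of arbitrary rank, $\overline K$ a fixed algebraic closure, $\bar v$ a fixed extension of $v$ to $\overline K$, $K^h\subseteq\overline K$ the Henselization of $K$ with respect to $\bar v$, $v^h=\bar v|_{K^h}$, $\Gamma$ an ordered abelian group containing the value group of $\bar v$. An extension $w$ of $v$ to $K(x)$ (with values in $\Gamma$) is valuation-transcendental if $\Gamma_w/\Gamma_v$ has rational rank $1$, or $k_w|k_v$ has transcendence degree $1$. Key polynomials: $f\sim_w g$ means $w(f-g)>w(f)=w(g)$; $f\mid_w g$ means $g\sim_w fh$ for some polynomial $h$. A monic polynomial $f$ is a key polynomial for $w$ if $f\mid_w gh$ implies $f\mid_w g$ or $f\mid_w h$, and for every nonzero $g$, $f\mid_w g$ implies $\deg g\ge\deg f$. $\mathrm{KP}(w)$ is the set of key polynomials for $w$. There is a unique common extension $w^h$ of $w$ and $v^h$ to $K^h[x]$. For $f\in\mathrm{KP}(w)$, $f^h$ denotes the unique monic irreducible factor of $f$ in $K^h[x]$ such that $f^h\in\mathrm{KP}(w^h)$ and there is $g\in K^h[x]$ with $w^h\big((f/f^h)g-1\big)>0$. Thus $f=f^h$ means that $f$ is irreducible over $K^h$. Defect: for a finite unibranched extension $L|K$ (i.e. $v$ has a unique extension $v_L$ to $L$),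 $d(L|K)=[L^h:K^h]/(ef)$, where $e$, $f$ are the ramification index and inertia degree of $v_L|v$ and $L^h,K^h$ the Henselizations with respect to the extension of $v_L$ to $\overline K$. (Under the hypothesis $f=f^h$, both $K(\theta)|K$ and $K(\eta)|K$ are unibranched.) *)

(* Defs.v *)
(* MathComp, with mathcomp-classical for Prop-valued sets and choice. *)
From HB Require Import structures.
From mathcomp Require Import all_boot all_order all_algebra.
From mathcomp Require Import ring_quotient fraction mxpoly.
From mathcomp Require Import boolp classical_sets.

Set Implicit Arguments.
Unset Strict Implicit.
Unset Printing Implicit Defensive.

Import Order.TTheory GRing.Theory Num.Theory.
Local Open Scope classical_set_scope.
Local Open Scope ring_scope.
Local Open Scope quotient_scope.

HB.mixin Record isOrderedAbGroup G of Num.POrderedZmodule G := {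
  oag_total : total (<=%R : rel G);
  oag_leD2l : forall z x y : G, x <= y -> z + x <= z + y
}.

#[short(type="oagType")]
HB.structure Definition OrderedAbGroup :=
  { G of isOrderedAbGroup G & Num.POrderedZmodule G }.

(* Values live in [option G], with [None] standing for infinity. *)
Section ValueMonoid.
Variable G : oagType.
Implicit Types a b c : option G.

Definition vle a b : bool :=
  match a, b with
  | _, None => true
  | None, Some _ => false
  | Some x, Some y => x <= y
  end.

Definition vlt a b : bool := ~~ vle b a.

Definition vadd a b : option G :=
  match a, b with
  | Some x, Some y => Some (x + y)
  | _, _ => None
  end.

Lemma vle_refl a : vle a a.
Proof. by case: a => //= x. Qed.

Lemma vle_total a b : vle a b || vle b a.
Proof. by case: a b => [x|] [y|] //=; exact: oag_total. Qed.

Lemma vle_trans b a c : vle a b -> vle b c -> vle a c.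
Proof. by case: a b c => [x|] [y|] [z|] //=; exact: le_trans. Qed.

Lemma vltW a b : vlt a b -> vle a b.
Proof. by rewrite /vlt => /negbTE ba; have := vle_total a b; rewrite ba orbF. Qed.

Lemma vlt_le_trans b a c : vlt a b -> vle b c -> vlt a c.
Proof. by move=> ab bc; apply: contra ab => /(vle_trans bc). Qed.

Lemma vadd_ge0 a b : vle (Some 0) a -> vle (Some 0) b -> vle (Some 0) (vadd a b).
Proof.
case: a b => [x|] [y|] //= x0 y0; apply: le_trans x0 _.
by rewrite -{1}[x]addr0; exact: oag_leD2l.
Qed.

Lemma vadd_gt0 a b : vle (Some 0) a -> vlt (Some 0) b -> vlt (Some 0) (vadd a b).
Proof.
case: a b => [x|] [y|] //=; rewrite /vlt /= => x0; apply: contra => xy0.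
apply: le_trans xy0; rewrite -{1}[y]add0r ![_ + y]addrC; exact: oag_leD2l.
Qed.

End ValueMonoid.

Record valuation (R : idomainType) (G : oagType) := Valuation {
  valuation_fun :> R -> option G;
  valuation_eqN : forall x, (valuation_fun x == None) = (x == 0);
  valuationM : forall x y,
    valuation_fun (x * y) = vadd (valuation_fun x) (valuation_fun y);
  (* v (x + y) >= min (v x) (v y) *)
  valuationD : forall x y,
    vle (valuation_fun x) (valuation_fun (x + y)) ||
    vle (valuation_fun y) (valuation_fun (x + y))
}.

Section ValuationTheory.
Variables (R : idomainType) (G : oagType) (v : valuation R G).

Lemma valuation0 : v 0 = None.
Proof. by apply/eqP; rewrite valuation_eqN. Qed.

Lemma valuation_sqr1 x : x * x = 1 -> v x = Some 0.
Proof.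
have v1 : v 1 = Some 0.
  have := valuationM v 1 1; rewrite mulr1.
  have := oner_eq0 R; rewrite -(valuation_eqN v); case: (v 1) => //= a _ [].
  by rewrite -{1}[a]addr0 => /addrI <-.
move=> /(congr1 v); rewrite v1 valuationM; case: (v x) => //= a [aa0].
have le0 (c : G) : 0 <= c -> c + c = 0 -> c = 0.
  move=> c0 cc0; apply/eqP; rewrite eq_le c0 andbT -cc0 -{1}[c]addr0.
  exact: oag_leD2l.
have [a0|a0] := orP (oag_total 0 a); first by rewrite (le0 a).
congr Some; apply: oppr_inj; rewrite oppr0; apply: le0.
  by have := oag_leD2l (- a) _ _ a0; rewrite addNr addr0.
by rewrite -opprD aa0 oppr0.
Qed.

Lemma valuation1 : v 1 = Some 0.
Proof. by apply: valuation_sqr1; rewrite mulr1. Qed.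

Lemma valuationN x : v (- x) = v x.
Proof.
rewrite -mulN1r valuationM valuation_sqr1 ?mulrNN ?mulr1 //.
by case: (v x) => //= a; rewrite add0r.
Qed.

Lemma valuationB_ge c x y : vle c (v x) -> vle c (v y) -> vle c (v (x - y)).
Proof.
move=> cx cy; have /orP[] := valuationD v x (- y); first exact: vle_trans.
by rewrite valuationN; exact: vle_trans.
Qed.

Lemma valuationD_gt c x y : vlt c (v x) -> vlt c (v y) -> vlt c (v (x + y)).
Proof. by move=> cx cy; have /orP[] := valuationD v x y; exact: vlt_le_trans. Qed.

End ValuationTheory.

Section ResidueField.
Variables (E : fieldType) (G : oagType) (v : valuation E G).

Definition vring_pred : {pred E} := fun x => vle (Some 0) (v x).

Record vring := VRing { vring_val : E; vring_valP : vring_val \in vring_pred }.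

HB.instance Definition _ := [isSub for vring_val].
HB.instance Definition _ := [Choice of vring by <:].

Lemma vring_subring_closed : subring_closed vring_pred.
Proof.
split=> [|x y x0 y0|x y x0 y0]; rewrite unfold_in.
- by rewrite valuation1 vle_refl.
- exact: valuationB_ge.
- by rewrite valuationM vadd_ge0.
Qed.

HB.instance Definition _ :=
  GRing.SubChoice_isSubComNzRing.Build E vring_pred vring vring_subring_closed.

Definition vmax : {pred vring} := fun x => vlt (Some 0) (v (val x)).

Lemma vmax_idealr_closed : idealr_closed vmax.
Proof.
split=> [||a x y x0 y0]; rewrite unfold_in.
- by rewrite valuation0.
- by rewrite valuation1 /vlt vle_refl.
- by apply: valuationD_gt => //; rewrite valuationM vadd_gt0 //; exact: valP a.
Qed.

HB.instance Definition _ := isIdealr.Build vring vmax vmax_idealr_closed.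

Definition residue_field := {ideal_quot (vmax : idealr vring)}.

HB.instance Definition _ := GRing.ComNzRing.on residue_field.

(* The residue of [x]; meaningful when [v x >= 0], and [0] otherwise. *)
Definition residue (x : E) : residue_field :=
  \pi_residue_field (insubd (0 : vring) x).

Definition residue_inv (a : residue_field) : residue_field :=
  residue (val (repr a))^-1.

Lemma residue_eq0 (x : vring) :
  (\pi_residue_field x == 0 :> residue_field) = (x \in vmax).
Proof. by rewrite piE Quotient.equivE subr0. Qed.

Lemma residue_mulVf a : a != 0 -> residue_inv a * a = 1.
Proof.
rewrite -{1 3}[a]reprK residue_eq0 /residue_inv; set x := repr a.
rewrite unfold_in negbK => vx_le0.
have x_neq0 : val x != 0 by apply: contraTneq vx_le0 => ->; rewrite valuation0.
have xVx : (val x)^-1 * val x = 1 by rewrite mulVf.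
have Vx_ge0 : (val x)^-1 \in vring_pred.
  have := congr1 v xVx; rewrite valuationM valuation1 unfold_in.
  case: (v (val x)) vx_le0 => //= b b_le0; case: (v _^-1) => //= c [cb0].
  by have := oag_leD2l c _ _ b_le0; rewrite cb0 addr0.
rewrite /residue -rmorphM -(rmorph1 \pi_residue_field); congr (\pi_residue_field _).
by apply: val_inj; rewrite rmorphM rmorph1 /= insubdK.
Qed.

Lemma residue_inv0 : residue_inv 0 = 0.
Proof.
rewrite /residue_inv; set x := repr 0.
have : x \in vmax by rewrite -residue_eq0 reprK.
rewrite unfold_in => vx_gt0; rewrite /residue.
have [Vx_ge0|Vx_lt0] := boolP ((val x)^-1 \in vring_pred); last first.
  by rewrite /insubd insubN //= rmorph0.
apply/eqP; rewrite residue_eq0 unfold_in insubdK //.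
have [x0|x_neq0] := eqVneq (val x) 0; first by rewrite x0 invr0 valuation0.
have := vadd_gt0 Vx_ge0 vx_gt0.
by rewrite -valuationM mulVf // valuation1 /vlt vle_refl.
Qed.

HB.instance Definition _ :=
  GRing.ComNzRing_isField.Build residue_field residue_mulVf residue_inv0.

End ResidueField.

Section Subfields.
Variable E : fieldType.
Implicit Types A B S : set E.

Definition is_subfield S : Prop :=
  [/\ S 1, forall a b, S a -> S b -> S (a - b)
     & forall a b, S a -> S b -> S (a / b)].

Definition subfield_generated S : set E :=
  [set a | forall F, is_subfield F -> S `<=` F -> F a].

Definition adjoin B (t : E) : set E := subfield_generated (B `|` [set t]).

Definition algebraic_over B (a : E) : Prop :=
  exists p : {poly E}, [/\ forall i, B p`_i, p != 0 & root p a].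

(* A | B has a transcendence basis with exactly one element. *)
Definition has_trdeg1 A B : Prop :=
  exists t, [/\ A t, ~ algebraic_over B t & A `<=` algebraic_over (adjoin B t)].

Definition is_lin_basis A B n (b : 'I_n -> E) : Prop :=
  [/\ forall i, A (b i),
      forall a, A a -> exists2 c : 'I_n -> E,
        forall i, B (c i) & a = \sum_i c i * b i
    & forall c : 'I_n -> E, (forall i, B (c i)) ->
        \sum_i c i * b i = 0 -> forall i, c i = 0].

(* The degree [A : B], and 0 if it is infinite. *)
Definition ext_degree A B : nat :=
  xget 0%N [set n | exists b : 'I_n -> E, is_lin_basis A B b].

End Subfields.

Section Subgroups.
Variable G : zmodType.
Implicit Types A B : set G.

(* The index (A : B) of a subgroup B of A, and 0 if it is infinite. *)
Definition subgroup_index A B : nat :=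
  xget 0%N [set n | exists r : 'I_n -> G,
    (forall i, A (r i)) /\ (forall a, A a -> exists! i, B (a - r i))].

Definition indep_modulo B n (r : 'I_n -> G) : Prop :=
  forall c : 'I_n -> int, B (\sum_i r i *~ c i) -> forall i, c i = 0.

(* The rational rank of A / B, that is dim_Q (Q (x) A / B), is n. *)
Definition has_rational_rank A B (n : nat) : Prop :=
  (exists2 r : 'I_n -> G, forall i, A (r i) & indep_modulo B r) /\
  (forall r : 'I_n.+1 -> G, (forall i, A (r i)) -> ~ indep_modulo B r).

End Subgroups.

Section ValuedSubfields.
Variables (E : fieldType) (G : oagType) (v : valuation E G).
Implicit Types F L : set E.

Definition value_group F : set G :=
  [set g | exists2 a, F a & v a = Some g].

Definition residue_subfield F : set (residue_field v) :=
  [set residue v a | a in [set a | F a /\ vle (Some 0) (v a)]].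

(* When E is an algebraic closure of F. All extensions to E of the restriction
   of v to F embed over it into any ordered group containing the divisible
   hull of its value group, hence G-valued extensions suffice, and equivalent
   extensions are then equal. *)
Definition henselian F : Prop :=
  forall u : valuation E G, (forall a, F a -> u a = v a) -> u =1 v.

(* The least Henselian subfield of (E, v) that contains F. *)
Definition henselization F : set E :=
  [set a | forall L, is_subfield L -> F `<=` L -> henselian L -> L a].

Lemma sub_henselization F : F `<=` henselization F.
Proof. by move=> a Fa L _ FL _; exact: FL. Qed.

Lemma henselization_divring F : divring_closed (mem (henselization F)).
Proof.
split; first by rewrite inE => L [].
- move=> a b /set_mem Ha /set_mem Hb; apply/mem_set => L Lfield FL Lh.
  by case: (Lfield) => _ + _; apply; [exact: Ha | exact: Hb].
- move=> a b /set_mem Ha /set_mem Hb; apply/mem_set => L Lfield FL Lh.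
  by case: (Lfield) => _ _; apply; [exact: Ha | exact: Hb].
Qed.

Record henselization_type F := Henselization {
  henselization_val : E;
  henselization_valP : henselization_val \in (mem (henselization F) : {pred E})
}.

HB.instance Definition _ F := [isSub for @henselization_val F].
HB.instance Definition _ F := [Choice of henselization_type F by <:].
HB.instance Definition _ F :=
  GRing.SubChoice_isSubIntegralDomain.Build E _ (henselization_type F)
    (henselization_divring F).
HB.instance Definition _ F :=
  [SubIntegralDomain_isSubField of henselization_type F by <:].

(* The defect of a finite unibranched extension L | F inside an algebraic
   closure (E, v) of F; the unique extension to L of the restriction of v to F
   is then the restriction of v to L. *)
Definition defect F L : rat :=
  (ext_degree (henselization L) (henselization F))%:R /
  (subgroup_index (value_group L) (value_group F) *
   ext_degree (residue_subfield L) (residue_subfield F))%:R.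

End ValuedSubfields.

Arguments residue_subfield {E G} v F _.

Section HenselizationEmbedding.
Variables (K E : fieldType) (iota : {rmorphism K -> E}).
Variables (G : oagType) (v : valuation E G).

Local Notation Kh := (henselization_type v (range iota)).

Lemma henselization_embed_subproof (a : K) :
  iota a \in (mem (henselization v (range iota)) : {pred E}).
Proof. by apply/mem_set; apply: sub_henselization; exists a. Qed.

Definition henselization_embed (a : K) : Kh :=
  Henselization (henselization_embed_subproof a).

Lemma henselization_embed_zmod : zmod_morphism henselization_embed.
Proof. by move=> a b; apply: val_inj; rewrite rmorphB /= rmorphB. Qed.

Lemma henselization_embed_monoid : monoid_morphism henselization_embed.
Proof.
split=> [|a b]; apply: val_inj; first by rewrite rmorph1 /= rmorph1.
by rewrite rmorphM /= rmorphM.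
Qed.

HB.instance Definition _ :=
  GRing.isZmodMorphism.Build K Kh henselization_embed henselization_embed_zmod.
HB.instance Definition _ :=
  GRing.isMonoidMorphism.Build K Kh henselization_embed
    henselization_embed_monoid.

End HenselizationEmbedding.

Section KeyPolynomials.
Variables (F : fieldType) (G : oagType) (w : {poly F} -> option G).
Implicit Types f g h : {poly F}.

Definition w_equiv f g : Prop := vlt (w f) (w (f - g)) /\ w f = w g.

Definition w_divides f g : Prop := exists h, w_equiv g (f * h).

Definition key_polynomial f : Prop :=
  [/\ f \is monic,
      forall g h, w_divides f (g * h) -> w_divides f g \/ w_divides f h
    & forall g, g != 0 -> w_divides f g -> (size f <= size g)%N].

End KeyPolynomials.

Section RationalFunctions.
Variables (K : fieldType) (G : oagType).

Definition ratfunC (a : K) : {fraction {poly K}} := @tofrac {poly K} a%:P.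

Variable w : valuation {fraction {poly K}} G.

Definition restrict_poly (p : {poly K}) : option G := w (tofrac p).

Definition valuation_transcendental : Prop :=
  has_rational_rank (value_group w setT) (value_group w (range ratfunC)) 1 \/
  has_trdeg1 (residue_subfield w setT) (residue_subfield w (range ratfunC)).

Variables (E : fieldType) (iota : {rmorphism K -> E}) (vbar : valuation E G).

Local Notation Kh := (henselization_type vbar (range iota)).
Local Notation embed := (henselization_embed iota vbar).

Definition is_common_extension (wh : valuation {poly Kh} G) : Prop :=
  (forall p : {poly K}, wh (map_poly embed p) = restrict_poly p) /\
  (forall c : Kh, wh c%:P = vbar (val c)).

(* q is the factor f^h of f over K^h. *)
Definition is_henselian_factor (wh : valuation {poly Kh} G)
    (f : {poly K}) (q : {poly Kh}) : Prop :=
  [/\ q \is monic /\ irreducible_poly q,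
      q %| map_poly embed f,
      key_polynomial wh q
    & exists g : {poly Kh}, vlt (Some 0) (wh ((map_poly embed f %/ q) * g - 1))].

End RationalFunctions.

(* Main.v *)
(* Two invariants of a key polynomial are compared. Call polynomials of degree
   less than n a graded basis if their initial forms are a basis of the graded
   module of all polynomials of degree less than n, and let N(n) be its size.
   If f is a key polynomial and is irreducible over K^h, then evaluation at a
   root theta preserves values in degree less than deg f, because the Newton
   polygon of an irreducible polynomial over a Henselian field is one segment;
   so e * f of K(theta)|K is N(deg f), and the defect is deg f / N(deg f).
   Let phi be a monic polynomial of minimal degree m whose initial form is not a
   unit. Every key polynomial has degree s * m, and phi-expansions turn a graded
   basis in degree less than m into one in degree less than s * m, so that
   N(s * m) = s * N(m): the ratio does not depend on the key polynomial.
   It remains to see that g is irreducible over K^h. As f is a key polynomial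
   for both w and w^h and K^h(theta)|K(theta) is immediate, f-expansions show
   that K[x] and K^h[x] have the same graded ring. In it g is associated to a
   key polynomial q of w^h, and comparing the ratios for f, g and q over K and
   over K^h gives deg q = deg g, so that g is itself a key polynomial of w^h. *)

Require Import Defs.
From HB Require Import structures.
From mathcomp Require Import all_boot all_order all_algebra.
From mathcomp Require Import fraction mxpoly zify ring.
From mathcomp Require Import boolp classical_sets.

Set Implicit Arguments.
Unset Strict Implicit.
Unset Printing Implicit Defensive.

Import Order.TTheory GRing.Theory Num.Theory.
Local Open Scope classical_set_scope.
Local Open Scope ring_scope.

(** * Values and valuations *)

(** The Henselization is given as an intersection of Henselian subfields, and Henselian means
    uniqueness of the extended valuation, a property with no evident reason to survive
    intersections. It is traded for a condition on roots: a root whose value exceeds those of all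
    the other roots lies in the field. This condition passes to intersections. Moreover such a root
    can be approximated in the Newton manner, so that a maximal immediate extension satisfies the
    condition; hence the Henselization is immediate.

    That m divides the degree of every key polynomial rests on products. For a and b of degree less
    than m, the term q * phi in a * b = q * phi + r must have value strictly above that of a * b,
    since otherwise reduction modulo phi would change initial forms. The strictness comes from the
    fact that phi + c is again a nonunit as soon as c has at least the value of phi.

    The key polynomial q over K^h is tied to g by reduction: a graded basis below deg g, taken
    modulo q, is a graded basis over K^h below deg q. *)

Section Values.
Variable G : oagType.
Implicit Types (a b c d : option G) (x y z : G).

Lemma oag_le_add2l z x y : (z + x <= z + y) = (x <= y).
Proof.
apply/idP/idP; last exact: oag_leD2l.
by move=> /(oag_leD2l (- z)); rewrite !addKr.
Qed.

Lemma vleN a : vle a None. Proof. by case: a. Qed.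

Lemma vltxx a : vlt a a = false. Proof. by rewrite /vlt vle_refl. Qed.

Lemma vltNx a : vlt None a = false. Proof. by rewrite /vlt vleN. Qed.

Lemma vltxN a : vlt a None = (a != None). Proof. by case: a. Qed.

Lemma vleNvlt a b : vle a b = ~~ vlt b a. Proof. by rewrite /vlt negbK. Qed.

Lemma vle_lt_trans b a c : vle a b -> vlt b c -> vlt a c.
Proof. by move=> ab; apply: contra => ca; apply: vle_trans ca ab. Qed.

Lemma vlt_trans b a c : vlt a b -> vlt b c -> vlt a c.
Proof. by move=> ab /vltW; apply: vlt_le_trans. Qed.

Lemma vle_anti a b : vle a b -> vle b a -> a = b.
Proof.
by case: a b => [x|] [y|] //= xy yx; congr Some; apply/eqP; rewrite eq_le xy.
Qed.

Lemma vle_eqVlt a b : vle a b -> a = b \/ vlt a b.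
Proof.
by move=> ab; case: (boolP (vle b a)) => [/(vle_anti ab)|]; [left|right].
Qed.

Lemma vlt_neqN a b : vlt a b -> a != None.
Proof. by case: a => //; rewrite vltNx. Qed.

Lemma vaddC : commutative (@vadd G).
Proof. by case=> [x|] [y|] //=; rewrite addrC. Qed.

Lemma vadd0 a : vadd (Some 0) a = a. Proof. by case: a => //= x; rewrite add0r. Qed.

Lemma vaddr0 a : vadd a (Some 0) = a. Proof. by rewrite vaddC vadd0. Qed.

Lemma vle_add2l c a b : vle a b -> vle (vadd c a) (vadd c b).
Proof. by case: a b c => [x|] [y|] [z|] //=; rewrite oag_le_add2l. Qed.

Lemma vlt_add2l c a b : c != None -> vlt a b -> vlt (vadd c a) (vadd c b).
Proof.
by case: a b c => [x|] [y|] [z|] //= _; rewrite /vlt /= oag_le_add2l.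
Qed.

Lemma vle_add a b c d : vle a b -> vle c d -> vle (vadd a c) (vadd b d).
Proof.
move=> ab cd; apply: vle_trans (vle_add2l a cd) _.
by rewrite vaddC [X in vle _ X]vaddC vle_add2l.
Qed.

Lemma vlt_add a b c d : c != None ->
  vlt a b -> vle c d -> vlt (vadd a c) (vadd b d).
Proof.
move=> cN ab cd; apply: (@vlt_le_trans _ (vadd b c)).
  by rewrite vaddC [X in vlt _ X]vaddC vlt_add2l.
exact: vle_add2l.
Qed.

Lemma vaddI c a b : c != None -> vadd c a = vadd c b -> a = b.
Proof. by case: a b c => [x|] [y|] [z|] //= _ [] /addrI ->. Qed.

Lemma oag_ltMn x y k : vlt (Some x) (Some y) -> (0 < k)%N ->
  vlt (Some (x *+ k)) (Some (y *+ k)).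
Proof.
move=> xy; elim: k => [//|[|k] IH] _; first by [].
rewrite mulrS [y *+ _]mulrS -![Some (_ + _)]/(vadd (Some _) (Some _)).
by apply: vlt_add => //; apply/vltW/IH.
Qed.

End Values.

Section ValuationFacts.
Variables (R : idomainType) (G : oagType) (v : valuation R G).
Implicit Types (x y z : R) (c : option G).

Lemma valuation_neqN x : (v x != None) = (x != 0).
Proof. by rewrite valuation_eqN. Qed.

Lemma valuation_Some x : x != 0 -> exists g, v x = Some g.
Proof. by rewrite -valuation_neqN; case: (v x) => // g _; exists g. Qed.

Lemma valuationX x g n : v x = Some g -> v (x ^+ n) = Some (g *+ n).
Proof.
move=> vx; elim: n => [|n IH]; first by rewrite expr0 valuation1 mulr0n.
by rewrite exprS valuationM vx IH /= mulrS.
Qed.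

Lemma valuationBC x y : v (x - y) = v (y - x).
Proof. by rewrite -valuationN opprB. Qed.

Lemma valuationD_ge c x y : vle c (v x) -> vle c (v y) -> vle c (v (x + y)).
Proof. by move=> cx cy; rewrite -[y]opprK valuationB_ge // valuationN. Qed.

Lemma valuationB_gt c x y : vlt c (v x) -> vlt c (v y) -> vlt c (v (x - y)).
Proof. by move=> cx cy; rewrite valuationD_gt // valuationN. Qed.

Lemma valuation_sum_ge (I : Type) (s : seq I) (P : pred I) (F : I -> R) c :
  (forall i, P i -> vle c (v (F i))) -> vle c (v (\sum_(i <- s | P i) F i)).
Proof.
move=> cF; apply: (big_ind (fun y => vle c (v y))) => //.
- by rewrite valuation0 vleN.
- by move=> x y; apply: valuationD_ge.
Qed.

Lemma valuation_sum_gt (I : Type) (s : seq I) (P : pred I) (F : I -> R) c :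
  c != None ->
  (forall i, P i -> vlt c (v (F i))) -> vlt c (v (\sum_(i <- s | P i) F i)).
Proof.
move=> cN cF; apply: (big_ind (fun y => vlt c (v y))) => //.
- by rewrite valuation0 vltxN.
- by move=> x y; apply: valuationD_gt.
Qed.

Lemma valuationM_lt x y z :
  x != 0 -> vlt (v y) (v z) -> vlt (v (x * y)) (v (x * z)).
Proof. by move=> x0 yz; rewrite !valuationM vlt_add2l // valuation_neqN. Qed.

Lemma valuationDl x y : vlt (v x) (v y) -> v (x + y) = v x.
Proof.
move=> xy; apply: vle_anti; last first.
  by apply: valuationD_ge; rewrite ?vle_refl //; apply: vltW.
rewrite vleNvlt; apply/negP => xxy.
by have := valuationB_gt xxy xy; rewrite addrK vltxx.
Qed.

(** Equality of initial forms. This is the first half of [w_equiv]; it implies the equality of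
    values and forces both elements to be nonzero. *)
Definition vsim x y := vlt (v x) (v (x - y)).

Lemma vsim_val x y : vsim x y -> v y = v x.
Proof.
rewrite /vsim valuationBC => xy.
by rewrite -[y](subrK x) addrC (valuationDl xy).
Qed.

Lemma vsim_refl x : x != 0 -> vsim x x.
Proof. by move=> x0; rewrite /vsim subrr valuation0 vltxN valuation_neqN. Qed.

Lemma vsim_neq0 x y : vsim x y -> x != 0.
Proof. by move=> /vlt_neqN; rewrite valuation_neqN. Qed.

Lemma vsim_sym x y : vsim x y -> vsim y x.
Proof. by move=> xy; rewrite /vsim (vsim_val xy) valuationBC. Qed.

Lemma vsim_neq0r x y : vsim x y -> y != 0.
Proof. by move=> /vsim_sym/vsim_neq0. Qed.

Lemma vsim_trans y x z : vsim x y -> vsim y z -> vsim x z.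
Proof.
move=> xy yz; rewrite /vsim -[x - z](subrKA y) valuationD_gt //.
by rewrite -(vsim_val xy).
Qed.

Lemma vsimMl z x y : z != 0 -> vsim x y -> vsim (z * x) (z * y).
Proof. by move=> z0 xy; rewrite /vsim -mulrBr valuationM_lt. Qed.

Lemma vsimMr z x y : z != 0 -> vsim x y -> vsim (x * z) (y * z).
Proof. by rewrite ![_ * z]mulrC; apply: vsimMl. Qed.

Lemma vsimM x y x' y' : vsim x y -> vsim x' y' -> vsim (x * x') (y * y').
Proof.
move=> xy xy'; apply: (@vsim_trans (y * x')).
  by apply: vsimMr => //; apply: vsim_neq0 xy'.
by apply: vsimMl => //; apply: vsim_neq0r xy.
Qed.

Lemma vsimMIl z x y : vsim (z * x) (z * y) -> vsim x y.
Proof.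
rewrite /vsim => zxy; have z0 : z != 0.
  by apply: contraTneq zxy => ->; rewrite !mul0r subrr vltxx.
rewrite /vlt; apply/negP => xy; move: zxy; rewrite -mulrBr !valuationM.
by apply/negP; rewrite -vleNvlt vle_add2l.
Qed.

Lemma vsimD x y : vlt (v x) (v y) -> vsim x (x + y).
Proof. by move=> xy; rewrite /vsim opprD addNKr valuationN. Qed.

Lemma vsimB x y : vlt (v x) (v y) -> vsim x (x - y).
Proof. by move=> xy; apply: vsimD; rewrite valuationN. Qed.

Lemma valuation_dominant (I : finType) (F : I -> R) (j : I) :
  F j != 0 -> (forall i, i != j -> vlt (v (F j)) (v (F i))) -> \sum_i F i != 0.
Proof.
move=> Fj0 lt_j; rewrite (bigD1 j) //= -valuation_neqN.
rewrite valuationDl ?valuation_neqN //.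
by apply: valuation_sum_gt; rewrite ?valuation_neqN.
Qed.

(* The Newton polygon of the polynomial with coefficients C is one segment of
   slope g, which forces the value t of a root. *)
Lemma newton_slope (d : nat) (C y : 'I_d.+1 -> R) (t g : G) : (0 < d)%N ->
  (forall i : 'I_d.+1, v (y i) = Some (t *+ i)) ->
  (forall i : 'I_d.+1, vle (Some (g *+ (d - i))) (v (C i))) ->
  v (C ord_max) = Some 0 -> v (C ord0) = Some (g *+ d) ->
  \sum_i C i * y i = 0 -> t = g.
Proof.
move=> d0 vy vC Cd C0 sum0.
have [t_g|g_t|//] : [\/ vlt (Some t) (Some g), vlt (Some g) (Some t) | t = g].
  have [/vle_eqVlt[[->]|]|/vle_eqVlt[[->]|]] := orP (vle_total (Some t) (Some g));
  by [constructor 1 | constructor 2 | constructor 3].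
- suff /eqP[] : \sum_i C i * y i != 0 by [].
  apply: (@valuation_dominant _ _ ord_max) => [|i i_max].
    by rewrite -valuation_neqN valuationM Cd vy.
  rewrite !valuationM Cd !vy vadd0 /=.
  have id : (i < d)%N by rewrite ltn_neqAle -ltnS ltn_ord andbT.
  have -> : t *+ d = t *+ (d - i) + t *+ i by rewrite -mulrnDr subnK // ltnW.
  rewrite -[Some (_ + _)]/(vadd (Some _) (Some _)).
  apply: vlt_le_trans (vle_add (vC i) (vle_refl _)).
  apply: vlt_add => //; last exact: vle_refl.
  by rewrite oag_ltMn // subn_gt0.
- suff /eqP[] : \sum_i C i * y i != 0 by [].
  apply: (@valuation_dominant _ _ ord0) => [|i i_max].
    by rewrite -valuation_neqN valuationM C0 vy.
  rewrite !valuationM C0 !vy mulr0n vaddr0.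
  have i0 : (0 < i)%N by rewrite lt0n.
  have id : (i <= d)%N by rewrite -ltnS.
  have -> : g *+ d = g *+ (d - i) + g *+ i by rewrite -mulrnDr subnK.
  rewrite -[Some (_ + _)]/(vadd (Some _) (Some _)).
  apply: vlt_le_trans (vle_add (vC i) (vle_refl _)).
  rewrite vaddC [X in vlt _ X]vaddC.
  apply: vlt_add => //; last exact: vle_refl.
  by rewrite oag_ltMn.
Qed.

(** Up to sign, the coefficient is a sum of products of [size s - i] roots. *)
Lemma prodXsubC_coef_ge (g : G) (s : seq R) i :
  (forall x, x \in s -> v x = Some g) -> (i <= size s)%N ->
  vle (Some (g *+ (size s - i))) (v (\prod_(x <- s) ('X - x%:P))`_i).
Proof.
elim: s i => [|x s IH] i vs i_s.
  by rewrite leqn0 in i_s; rewrite big_nil (eqP i_s) coef1 valuation1 vle_refl.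
have {}IH k : (k <= size s)%N -> _ := IH k (fun y ys => vs y (mem_behead (s := x :: s) ys)).
have vx : v x = Some g by rewrite vs ?mem_head.
rewrite big_cons mulrBl coefB coefXM coefCM; apply: valuationB_ge.
  by case: i i_s => [|i] i_s; [rewrite valuation0 vleN|apply: IH].
rewrite valuationM vx; case: (leqP i (size s)) => i_s'.
  apply: vle_trans (vle_add2l _ (IH _ i_s')) => /=.
  by rewrite -mulrS subSn.
have -> : i = (size s).+1 by apply/eqP; rewrite eqn_leq i_s.
by rewrite nth_default ?valuation0 ?vleN // size_prod_XsubC.
Qed.

Lemma prodXsubC_coef0 (g : G) (s : seq R) : (forall x, x \in s -> v x = Some g) ->
  v (\prod_(x <- s) ('X - x%:P))`_0 = Some (g *+ size s).
Proof.
elim: s => [|x s IH] vs; first by rewrite big_nil coef1 valuation1.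
rewrite big_cons mulrBl coefB coefXM coefCM sub0r valuationN valuationM.
rewrite IH => [|y ys]; last by rewrite vs // mem_behead.
by rewrite vs ?mem_head //= mulrS.
Qed.

End ValuationFacts.

(** * Subfields and minimal polynomials *)

Section SubfieldType.
Variables (E : fieldType) (S : set E).

Lemma subfield_divring : is_subfield S -> divring_closed (mem S).
Proof.
move=> [S1 SB Sdiv]; split; first by rewrite inE.
- by move=> a b /set_mem Sa /set_mem Sb; apply/mem_set/SB.
- by move=> a b /set_mem Sa /set_mem Sb; apply/mem_set/Sdiv.
Qed.

Hypothesis Sfield : is_subfield S.

Record subfield_type := SubfieldElt {
  subfield_val : E;
  subfield_valP : subfield_val \in (mem S : {pred E})
}.

HB.instance Definition _ := [isSub for subfield_val].
HB.instance Definition _ := [Choice of subfield_type by <:].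
HB.instance Definition _ :=
  GRing.SubChoice_isSubIntegralDomain.Build E _ subfield_type
    (subfield_divring Sfield).
HB.instance Definition _ :=
  [SubIntegralDomain_isSubField of subfield_type by <:].

(** Subfields are given as sets, whereas polynomials need a field type for their coefficients; this
    is the passage between the two. *)
Lemma subfield_as_type :
  exists (F : fieldType) (iota : {rmorphism F -> E}), range iota = S.
Proof.
exists subfield_type, \val; apply/seteqP; split=> [_ [x _ <-]|x Sx].
  exact: set_mem (subfield_valP x).
by exists (SubfieldElt (mem_set Sx)).
Qed.

End SubfieldType.

Section Subfields.
Variable E : fieldType.
Implicit Types S : set E.

Lemma range_subfield (F : fieldType) (iota : {rmorphism F -> E}) :
  is_subfield (range iota).
Proof.
split; first by exists 1; rewrite ?rmorph1.
- by move=> _ _ [a _ <-] [b _ <-]; exists (a - b); rewrite ?rmorphB.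
- by move=> _ _ [a _ <-] [b _ <-]; exists (a / b); rewrite ?fmorph_div.
Qed.

Section Closure.
Variables (S : set E) (Sfield : is_subfield S).

Lemma subfield1 : S 1. Proof. by case: Sfield. Qed.

Lemma subfieldB a b : S a -> S b -> S (a - b). Proof. by case: Sfield => _ + _; apply. Qed.

Lemma subfield_div a b : S a -> S b -> S (a / b).
Proof. by case: Sfield => _ _; apply. Qed.

Lemma subfield0 : S 0.
Proof. by rewrite -(subrr 1); apply: subfieldB; apply: subfield1. Qed.

Lemma subfieldN a : S a -> S (- a).
Proof. by move=> Sa; rewrite -sub0r; apply: subfieldB => //; apply: subfield0. Qed.

Lemma subfieldD a b : S a -> S b -> S (a + b).
Proof. by move=> Sa Sb; rewrite -[b]opprK; apply/subfieldB/subfieldN. Qed.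

Lemma subfieldV a : S a -> S a^-1.
Proof. by rewrite -div1r; apply/subfield_div/subfield1. Qed.

Lemma subfieldM a b : S a -> S b -> S (a * b).
Proof. by move=> Sa Sb; rewrite -[b]invrK; apply/subfield_div/subfieldV. Qed.

Lemma subfieldX a n : S a -> S (a ^+ n).
Proof.
move=> Sa; elim: n => [|n IH]; rewrite ?expr0 ?exprS; first exact: subfield1.
exact: subfieldM.
Qed.

Lemma subfield_sum (I : Type) (s : seq I) (P : pred I) (f : I -> E) :
  (forall i, P i -> S (f i)) -> S (\sum_(i <- s | P i) f i).
Proof. by move=> Sf; elim/big_ind: _ => //; [apply: subfield0|apply: subfieldD]. Qed.

End Closure.

Lemma generated_subfield S : is_subfield (subfield_generated S).
Proof.
split=> [F [] //|a b Sa Sb F FF SF|a b Sa Sb F FF SF].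
- by case: (FF) => _ + _; apply; [apply: Sa|apply: Sb].
- by case: (FF) => _ _; apply; [apply: Sa|apply: Sb].
Qed.

Lemma adjoin_subfield S t : is_subfield (adjoin S t).
Proof. exact: generated_subfield. Qed.

Lemma sub_adjoin S t : S `<=` adjoin S t.
Proof. by move=> a Sa F _; apply; left. Qed.

Lemma mem_adjoin S t : adjoin S t t.
Proof. by move=> F _; apply; right. Qed.

Lemma adjoin_min S t (L : set E) :
  is_subfield L -> S `<=` L -> L t -> adjoin S t `<=` L.
Proof. by move=> Lf SL Lt a; apply=> // b [/SL|->]. Qed.

End Subfields.

Section MinimalPolynomial.
Variables (F E : fieldType) (iota : {rmorphism F -> E}).
Local Notation "p ^i" := (map_poly iota p) (at level 2, format "p ^i").

Lemma irreducible_root_dvd (p h : {poly F}) a :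
  irreducible_poly p -> root p^i a -> (root h^i a) = (p %| h).
Proof.
move=> p_irr pa; apply/idP/idP => [ha|/dvdpP[q ->]]; last first.
  by rewrite rmorphM rootM pa orbT.
rewrite -[_ %| _]negbK -(irreducible_poly_coprime _ p_irr); apply/negP.
move=> /Bezout_eq1_coprimepP[[u w] /= /(congr1 (fun q => q^i.[a]))].
rewrite rmorphD !rmorphM rmorph1 /= !hornerE (eqP pa) (eqP ha) !mulr0 addr0.
by move/eqP; rewrite eq_sym oner_eq0.
Qed.

Lemma min_poly_exists a : algebraicOver iota a ->
  exists p : {poly F}, [/\ p \is monic, irreducible_poly p & root p^i a].
Proof.
move=> [p0 p0_neq0 p0a].
pose P n := `[< exists p : {poly F}, [/\ p \is monic, size p = n & root p^i a] >].
have monicP (h : {poly F}) : h != 0 -> root h^i a -> P (size h).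
  move=> h0 ha; have lh0 : (lead_coef h)^-1 != 0 by rewrite invr_eq0 lead_coef_eq0.
  apply/asboolP; exists ((lead_coef h)^-1 *: h); split; last first.
  - by rewrite map_polyZ rootZ // fmorph_eq0.
  - by rewrite size_scale.
  - by rewrite monicE lead_coefZ mulVf // lead_coef_eq0.
have exP : exists n, P n by exists (size p0); apply: monicP.
case: (ex_minnP exP) => _ /asboolP[p [pm <- pa]] p_min.
have min_p h : h != 0 -> root h^i a -> (size p <= size h)%N.
  by move=> h0 ha; rewrite p_min // monicP.
exists p; split=> //; split=> [|h size_h /dvdpP[k def_p]].
  rewrite ltnNge; apply/negP => /size1_polyC def_p; move: pa (monic_neq0 pm).
  by rewrite def_p map_polyC rootC polyC_eq0 /= fmorph_eq0 => ->.
have [k_neq0 h_neq0] : k != 0 /\ h != 0.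
  by apply/andP; rewrite -negb_or -mulf_eq0 -def_p monic_neq0.
have size_p : size p = (size k + size h).-1 by rewrite def_p size_mul.
have h1 : (1 < size h)%N by rewrite ltn_neqAle eq_sym size_h size_poly_gt0.
have k1 : (0 < size k)%N by rewrite size_poly_gt0.
have := pa; rewrite {1}def_p rmorphM rootM => /orP[ka|ha].
  by have := min_p _ k_neq0 ka; lia.
rewrite -dvdp_size_eqp; last by rewrite def_p dvdp_mull.
by rewrite eqn_leq (min_p _ h_neq0 ha) size_p; case: (size k) k1 => // n _; rewrite andbT leq_addl.
Qed.

(** The values at [t] already form a field: a Bezout relation inverts the value of any polynomial
    prime to [p]. *)
Lemma adjoin_polyP (p : {poly F}) t x :
  irreducible_poly p -> root p^i t ->
  adjoin (range iota) t x <->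
  exists2 h : {poly F}, (size h < size p)%N & x = h^i.[t].
Proof.
move=> p_irr pt; have p_neq0 : p != 0 by apply: irredp_neq0.
split; last first.
  move=> [h _ ->]; have Af := adjoin_subfield (range iota) t.
  rewrite horner_coef; apply: (subfield_sum Af) => i _; apply: (subfieldM Af).
    by rewrite coef_map; apply: (@sub_adjoin _ (range iota)); exists h`_i.
  by apply: (subfieldX Af); exact: mem_adjoin.
move=> /(_ [set x | exists2 h : {poly F}, (size h < size p)%N & x = h^i.[t]]).
have red h : (h %% p)^i.[t] = h^i.[t].
  by rewrite {2}(divp_eq h p) rmorphD rmorphM /= !hornerE (eqP pt) mulr0 add0r.
have ex h : exists2 k : {poly F}, (size k < size p)%N & h^i.[t] = k^i.[t].
  by exists (h %% p); rewrite ?ltn_modp ?red.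
apply.
- split.
  + by have [h hp e] := ex 1; exists h; rewrite // -e rmorph1 hornerE.
  + move=> _ _ [h _ ->] [k _ ->]; have [l lp e] := ex (h - k).
    by exists l; rewrite // -e rmorphB hornerD hornerN.
  + move=> _ _ [h _ ->] [k _ ->]; have [pk|npk] := boolP (p %| k).
      have [l lp e] := ex 0; exists l; rewrite // -e rmorph0 horner0.
      have /eqP-> : root k^i t by rewrite (irreducible_root_dvd k p_irr).
      by rewrite invr0 mulr0.
    have /Bezout_eq1_coprimepP[[u w] /= uw] : coprimep k p.
      by rewrite coprimep_sym irreducible_poly_coprime.
    have [l lp e] := ex (h * u); exists l; rewrite // -e rmorphM /= hornerM.
    have /(congr1 (fun q => q^i.[t])) := uw.
    rewrite rmorphD !rmorphM rmorph1 /= !hornerE (eqP pt) mulr0 addr0 => uk.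
    congr (_ * _); have k0 : k^i.[t] != 0.
      by rewrite -rootE (irreducible_root_dvd _ p_irr).
    by apply: (mulIf k0); rewrite mulVf.
- move=> _ [[a _ <-]|->].
    have [l lp e] := ex a%:P; exists l; rewrite // -e map_polyC hornerC //.
  by have [l lp e] := ex 'X; exists l; rewrite // -e map_polyX hornerX.
Qed.

End MinimalPolynomial.

(** * Extension of embeddings *)

Section ExtendEmbedding.
Variable E : closedFieldType.
Implicit Types D : set (E * E).

(** A partial homomorphism, encoded by its graph so that chains have unions. Given closure under
    subtraction, the last clause says that the relation is functional. *)
Definition field_graph D : Prop :=
  [/\ D (1, 1), forall x y, D x -> D y -> D (x.1 - y.1, x.2 - y.2),
      forall x y, D x -> D y -> D (x.1 / y.1, x.2 / y.2)
    & forall b, D (0, b) -> b = 0].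

Lemma field_graph_functional D a b c :
  field_graph D -> D (a, b) -> D (a, c) -> b = c.
Proof.
move=> [_ DB _ D0] Db Dc; apply/eqP; rewrite -subr_eq0; apply/eqP/D0.
by have := DB _ _ Db Dc; rewrite /= subrr.
Qed.

Lemma graph_domain_subfield D :
  field_graph D -> is_subfield [set a | exists b, D (a, b)].
Proof.
move=> [D1 DB Ddiv D0]; split; first by exists 1.
- by move=> a b [a' Da] [b' Db]; exists (a' - b'); apply: (DB _ _ Da Db).
- by move=> a b [a' Da] [b' Db]; exists (a' / b'); apply: (Ddiv _ _ Da Db).
Qed.

Lemma graph_embeddings D : field_graph D ->
  exists (F : fieldType) (i1 i2 : {rmorphism F -> E}),
    forall a b, D (a, b) <-> exists2 x, i1 x = a & i2 x = b.
Proof.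
move=> DF; have [F [i1 ri1]] := subfield_as_type (graph_domain_subfield DF).
have ex x : exists b, D (i1 x, b).
  by have : [set a | exists b, D (a, b)] (i1 x) by rewrite -ri1; exists x.
have [f Df] := choice ex; have := DF => -[D1 DB Ddiv D0].
have fun_f a b c : D (a, b) -> D (a, c) -> b = c := field_graph_functional DF.
have fB : zmod_morphism f.
  move=> x y; apply: (fun_f (i1 (x - y))); first exact: Df.
  by rewrite rmorphB; apply: (DB _ _ (Df x) (Df y)).
have f1 : f 1 = 1 by apply: (fun_f 1) => //; rewrite -{1}(rmorph1 i1).
have fV x : f (x^-1) = (f x)^-1.
  apply: (fun_f (i1 x^-1)) => //; rewrite fmorphV.
  by have := Ddiv _ _ D1 (Df x); rewrite /= !div1r.
have fM : monoid_morphism f.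
  split=> // x y; rewrite -{1}[y]invrK -[f y]invrK -fV.
  apply: (fun_f (i1 (x / y^-1))); first exact: Df.
  by rewrite fmorph_div; apply: (Ddiv _ _ (Df x) (Df y^-1)).
pose mfB := GRing.isZmodMorphism.Build F E f fB.
pose mfM := GRing.isMonoidMorphism.Build F E f fM.
pose i2 : {rmorphism F -> E} := HB.pack f mfB mfM.
exists F, i1, i2 => a b; split=> [Dab|[x <- <-]]; last exact: Df.
have : [set a | exists b, D (a, b)] a by exists b.
rewrite -ri1 => -[x _ xa]; exists x => //.
by apply: (fun_f a) => //; rewrite -xa; apply: Df.
Qed.

(** The relation is functional because vanishing at [a] and vanishing at [b] both mean divisibility
    by [p]. *)
Lemma extend_graph (F : fieldType) (i1 i2 : {rmorphism F -> E})
    (p : {poly F}) (a b : E) :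
  irreducible_poly p -> root (map_poly i1 p) a -> root (map_poly i2 p) b ->
  field_graph [set x | exists h : {poly F},
    x = ((map_poly i1 h).[a], (map_poly i2 h).[b])].
Proof.
move=> p_irr pa pb; split.
- by exists 1; rewrite !rmorph1 !hornerE.
- by move=> _ _ [h ->] [k ->] /=; exists (h - k); rewrite !rmorphB !hornerE.
- move=> _ _ [h ->] [k ->] /=; have [pk|npk] := boolP (p %| k).
    have /eqP-> : root (map_poly i1 k) a by rewrite (irreducible_root_dvd k p_irr).
    have /eqP-> : root (map_poly i2 k) b by rewrite (irreducible_root_dvd k p_irr).
    by exists 0; rewrite !invr0 !mulr0 !rmorph0 !horner0.
  have /Bezout_eq1_coprimepP[[u w] /= uw] : coprimep k p.
    by rewrite coprimep_sym irreducible_poly_coprime.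
  have inv (i : {rmorphism F -> E}) c : root (map_poly i p) c ->
      (map_poly i k).[c]^-1 = (map_poly i u).[c].
    move=> pc; have /(congr1 (fun q => (map_poly i q).[c])) := uw.
    rewrite rmorphD !rmorphM rmorph1 /= !hornerE (eqP pc) mulr0 addr0 => uk.
    have k0 : (map_poly i k).[c] != 0.
      by rewrite -rootE (irreducible_root_dvd _ p_irr).
    by apply: (mulIf k0); rewrite mulVf.
  by exists (h * u); rewrite !inv // !rmorphM !hornerE.
- move=> d [h [/esym/eqP ha ->]]; apply/eqP; move: ha; rewrite -!/(root _ _).
  by rewrite !(irreducible_root_dvd h p_irr).
Qed.

(** An endomorphism is enough for later use: composing a valuation with it gives a valuation again,
    and injectivity makes it permute finite sets of conjugates. *)
Theorem extend_embedding (F : fieldType) (iota : {rmorphism F -> E})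
    (p : {poly F}) (a b : E) : (forall z, algebraicOver iota z) ->
  irreducible_poly p -> root (map_poly iota p) a -> root (map_poly iota p) b ->
  exists s : {rmorphism E -> E}, (forall x, s (iota x) = iota x) /\ s a = b.
Proof.
move=> Falg p_irr pa pb; pose D0 := [set x | exists h : {poly F},
  x = ((map_poly iota h).[a], (map_poly iota h).[b])].
have D0F : field_graph D0 by apply: extend_graph pa pb.
(* The union of the empty chain is empty and is no field graph; taking the union of [A] with [D0]
   removes this exception. *)
have [|A [AF A_max]] := @Zorn_bigcup _ (fun A => field_graph (A `|` D0)).
  move=> C CF Ctot.
  have dir x y : (\bigcup_(X in C) X `|` D0) x -> (\bigcup_(X in C) X `|` D0) y ->
      exists X, [/\ field_graph (X `|` D0),
        X `|` D0 `<=` \bigcup_(X in C) X `|` D0, (X `|` D0) x & (X `|` D0) y].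
    have sub X : C X -> X `|` D0 `<=` \bigcup_(X in C) X `|` D0.
      by move=> CX z [Xz|]; [left; exists X|right].
    move=> [[X CX Xx]|D0x] [[Y CY Yy]|D0y].
    + case: (Ctot _ _ CX CY) => [XY|YX].
        by exists Y; split; [exact: CF|exact: sub|left; exact: XY|left].
      by exists X; split; [exact: CF|exact: sub|left|left; exact: YX].
    + by exists X; split; [exact: CF|exact: sub|left|right].
    + by exists Y; split; [exact: CF|exact: sub|right|left].
    + exists set0; rewrite set0U; split=> //; exact: subsetUr.
  have [D1 DB Ddiv DZ] := D0F; split; first by right.
  - by move=> x y /dir/[apply] -[X [[_ XB _ _] sX Xx Xy]]; apply/sX/XB.
  - by move=> x y /dir/[apply] -[X [[_ _ Xdiv _] sX Xx Xy]]; apply/sX/Xdiv.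
  - by move=> c Dc; have [X [[_ _ _ XZ] _ Xc _]] := dir _ _ Dc Dc; apply: XZ.
pose B := A `|` D0; have [F2 [i1 [i2 B12]]] := graph_embeddings AF.
have FB x : B (iota x, iota x).
  by right; exists x%:P; rewrite !map_polyC !hornerC.
(* If [c] were outside the domain, sending it to a root of the transported minimal polynomial would
   extend the maximal graph. *)
have total c : exists d, B (c, d).
  apply: contrapT => nBc.
  have Falg2 : algebraicOver i1 c.
    have [q q0 qc] := Falg c.
    have exj x : exists y, i1 y = iota x.
      by have [y yx _] := (B12 _ _).1 (FB x); exists y.
    have [j ij] := choice exj.
    have j0 x : (j x == 0) = (x == 0).
      by rewrite -(fmorph_eq0 i1) ij fmorph_eq0.
    have qE : map_poly i1 (map_poly j q) = map_poly iota q.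
      have j00 : j 0 = 0 by apply/eqP; rewrite j0.
      by apply/polyP => n; rewrite !coef_map /= coef_map_id0 // ij.
    by exists (map_poly j q); rewrite ?qE // -(map_poly_eq0 i1) qE map_poly_eq0.
  have [q [qm q_irr qc]] := min_poly_exists Falg2.
  have [d qd] : exists d, root (map_poly i2 q) d.
    by apply: closed_rootP; rewrite size_map_poly; case: q_irr => + _; case: size => [|[]].
  have D'F := extend_graph q_irr qc qd.
  set D' := (X in field_graph X) in D'F.
  have BD' : B `<=` D'.
    move=> [x y] /B12[z <- <-]; exists z%:P.
    by rewrite !map_polyC !hornerC.
  have D'c : D' (c, d) by exists 'X; rewrite !map_polyX !hornerX.
  apply: (A_max D').
    split=> [x Ax|D'A]; first by apply: BD'; left.
    by apply: nBc; exists d; left; apply: D'A.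
  suff -> : D' `|` D0 = D' by [].
  by apply/setUidPl => x D0x; apply: BD'; right.
have [f Bf] := choice total; have := AF => -[D1 DB Ddiv DZ].
have fun_f x y z : B (x, y) -> B (x, z) -> y = z := field_graph_functional AF.
have fB : zmod_morphism f.
  by move=> x y; apply: (fun_f (x - y)) => //; apply: (DB _ _ (Bf x) (Bf y)).
have fV x : f (x^-1) = (f x)^-1.
  apply: (fun_f (x^-1)) => //.
  by have := Ddiv _ _ D1 (Bf x); rewrite /= !div1r.
have fM : monoid_morphism f.
  split=> [|x y]; first exact: (fun_f 1).
  rewrite -{1}[y]invrK -[f y]invrK -fV; apply: (fun_f (x / y^-1)) => //.
  exact: (Ddiv _ _ (Bf x) (Bf y^-1)).
pose mfB := GRing.isZmodMorphism.Build E E f fB.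
pose mfM := GRing.isMonoidMorphism.Build E E f fM.
pose s : {rmorphism E -> E} := HB.pack f mfB mfM.
exists s; split=> [x|]; first by apply: (fun_f (iota x)) => //=.
by apply: (fun_f a) => //; right; exists 'X; rewrite !map_polyX !hornerX.
Qed.

End ExtendEmbedding.

(** * Henselian fields *)

Section Conjugates.
Variables (E : closedFieldType) (G : oagType) (v : valuation E G).

Definition conj_valuation (s : {rmorphism E -> E}) : valuation E G.
Proof.
exists (v \o s) => /= [x|x y|x y]; first by rewrite valuation_eqN fmorph_eq0.
  by rewrite rmorphM valuationM.
by rewrite rmorphD valuationD.
Defined.

(** Composition with [s] gives another extension of the valuation of [S], so uniqueness applies. *)
Lemma henselian_conj S (s : {rmorphism E -> E}) : henselian v S ->
  (forall a, S a -> s a = a) -> forall a, v (s a) = v a.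
Proof.
by move=> Sh sS; apply: (Sh (conj_valuation s)) => a Sa /=; rewrite sS.
Qed.

Lemma henselian_sub S L : S `<=` L -> henselian v S -> henselian v L.
Proof. by move=> SL Sh u uL; apply: Sh => a /SL; apply: uL. Qed.

Section Base.
Variables (F : fieldType) (iota : {rmorphism F -> E}).
Hypothesis Falg : forall z, algebraicOver iota z.
Local Notation "p ^i" := (map_poly iota p) (at level 2, format "p ^i").

Lemma poly_over_range (p : {poly E}) :
  (forall i, range iota p`_i) -> exists q, q^i = p.
Proof.
move=> Sp; have ex i : exists a, iota a = p`_i by have [a] := Sp i; exists a.
have [f fp] := choice ex; exists (\poly_(i < size p) f i).
apply/polyP => i; rewrite coef_map coef_poly; case: ltnP => ip; first exact: fp.
by rewrite raddf0 nth_default.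
Qed.

Lemma conj_root (p : {poly F}) (s : {rmorphism E -> E}) x :
  (forall a, s (iota a) = iota a) -> root p^i x -> root p^i (s x).
Proof.
move=> sF px; have <- : map_poly s p^i = p^i.
  by apply/polyP => i; rewrite !coef_map /= sF.
by rewrite fmorph_root.
Qed.

Lemma monic_splits (p : {poly F}) : p \is monic ->
  exists rs : seq E, p^i = \prod_(x <- rs) ('X - x%:P).
Proof.
move=> pm; have [rs def_p] := closed_field_poly_normal p^i.
by exists rs; rewrite def_p (monicP (monic_map iota pm)) scale1r.
Qed.

Lemma henselian_root_value (p : {poly F}) x y : henselian v (range iota) ->
  irreducible_poly p -> root p^i x -> root p^i y -> v x = v y.
Proof.
move=> Sh p_irr px py; have [s [sF <-]] := extend_embedding Falg p_irr px py.
by rewrite (henselian_conj Sh) // => _ [a _ <-].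
Qed.

(* A monic polynomial whose roots all have value [g] has a Newton polygon with
   one segment, so [g] is also the value of its roots for other valuations. *)
Lemma root_value_unique (p : {poly F}) (g t : G) (R : idomainType)
    (u : valuation R G) (C y : nat -> R) :
  p \is monic -> (1 < size p)%N -> (forall x, root p^i x -> v x = Some g) ->
  (forall i, u (C i) = v (iota p`_i)) -> (forall i, u (y i) = Some (t *+ i)) ->
  \sum_(i < size p) C i * y i = 0 -> t = g.
Proof.
move=> pm p1 vp uC uy sum0; have [rs def_p] := monic_splits pm.
have size_p : size p = (size rs).+1.
  by rewrite -(size_map_poly iota) def_p size_prod_XsubC.
have vrs x : x \in rs -> v x = Some g.
  by move=> x_rs; apply: vp; rewrite def_p root_prod_XsubC.
have pE i : iota p`_i = (\prod_(x <- rs) ('X - x%:P))`_i by rewrite -def_p coef_map.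
rewrite size_p in sum0 p1.
apply: (@newton_slope _ _ u _ (fun i => C i) (fun i => y i) t g) sum0 => //.
- by move=> i; rewrite uC pE prodXsubC_coef_ge // -ltnS.
- have := monicP pm; rewrite /lead_coef size_p /= => lp.
  by rewrite uC lp rmorph1 valuation1.
- by rewrite uC pE (prodXsubC_coef0 vrs).
Qed.

End Base.

(* A form of Hensel's lemma that passes to intersections of fields. *)
Definition largest_root_closed (S : set E) : Prop :=
  forall (rs : seq E) (r : E),
    (forall i, S (\prod_(x <- r :: rs) ('X - x%:P))`_i) ->
    (forall x, x \in rs -> vlt (v x) (v r)) -> S r.

Lemma coprimep_prod_XsubC (p : {poly E}) (rs : seq E) :
  (forall x, x \in rs -> ~~ root p x) -> coprimep p (\prod_(x <- rs) ('X - x%:P)).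
Proof.
elim: rs => [|x rs IH] prs; first by rewrite big_nil coprimep1.
rewrite big_cons coprimepMr coprimep_XsubC prs ?mem_head //=.
by apply: IH => y y_rs; rewrite prs // mem_behead.
Qed.

Section Base.
Variables (F : fieldType) (iota : {rmorphism F -> E}).
Hypothesis Falg : forall z, algebraicOver iota z.
Local Notation "p ^i" := (map_poly iota p) (at level 2, format "p ^i").

(** Conjugates have equal values, so the minimal polynomial of [r] has no root among [rs]. It
    divides the whole product, hence it divides ['X - r%:P]. *)
Lemma henselian_largest_root : henselian v (range iota) ->
  largest_root_closed (range iota).
Proof.
move=> Sh rs r /poly_over_range[P def_P] rs_lt.
have [q [qm q_irr qr]] := min_poly_exists (Falg r).
have qP : q %| P.
  by rewrite -(irreducible_root_dvd _ q_irr qr) def_P root_prod_XsubC mem_head.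
have q_cop : coprimep q^i (\prod_(x <- rs) ('X - x%:P)).
  apply: coprimep_prod_XsubC => x x_rs; apply/negP => qx.
  by have := rs_lt x x_rs; rewrite (henselian_root_value Falg Sh q_irr qx qr) vltxx.
have : q^i %| 'X - r%:P.
  rewrite -(Gauss_dvdpl _ q_cop).
  have -> : ('X - r%:P) * \prod_(x <- rs) ('X - x%:P) = P^i.
    by rewrite def_P big_cons.
  by rewrite dvdp_map.
move=> q_dvd; have q_eq : q^i = 'X - r%:P.
  apply/eqP; rewrite -eqp_monic ?monic_map ?monicXsubC //.
  rewrite -dvdp_size_eqp // size_XsubC eqn_leq.
  have := dvdp_leq _ q_dvd; rewrite size_XsubC => -> //=; last first.
    by rewrite polyXsubC_eq0.
  by rewrite size_map_poly; case: q_irr.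
exists (- q`_0) => //; rewrite rmorphN -coef_map q_eq.
by rewrite coefB coefX coefC sub0r opprK.
Qed.

(** If [d] is nonzero in [E], the second highest coefficient [- d * c] yields [c] itself. Otherwise
    the characteristic p divides [d], the polynomial is the (d / p)-th power of X - c^p evaluated at
    X^p, and induction applies to c^p. *)
Lemma pchar_power_in_base c d : (0 < d)%N ->
  (forall i, range iota (('X - c%:P) ^+ d)`_i) ->
  exists n, [pchar E].-nat n /\ range iota (c ^+ n).
Proof.
elim: d {-2}d (leqnn d) c => [|m IH] d d_m c d0 Sd; first by case: d d_m d0 {Sd}.
have Sf := range_subfield iota.
have [d_char|d_char] := eqVneq (d%:R : E) 0; last first.
  exists 1%N; split=> //; rewrite expr1.
  have := Sd d.-1; have -> : (('X - c%:P) ^+ d)`_d.-1 = - (c * d%:R).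
    have -> : ('X - c%:P) ^+ d = \prod_(x <- nseq d c) ('X - x%:P).
      by rewrite big_nseq iter_mulr_1.
    have := @coefPn_prod_XsubC _ (nseq d c); rewrite size_nseq => -> //.
      by rewrite big_nseq iter_addr_0 mulr_natr.
    by rewrite -lt0n.
  move=> Sc; have Sdn : range iota d%:R by exists d%:R; rewrite ?rmorph_nat.
  have := subfield_div Sf (subfieldN Sf Sc) Sdn.
  by rewrite opprK mulfK.
have [p p_char p_d] : exists2 p, p \in [pchar E] & (p %| d)%N.
  have [p p_char] := natf0_pchar d0 (introT eqP d_char).
  by exists p; rewrite // (dvdn_pcharf p_char) d_char.
have p_prime := pcharf_prime p_char.
have [|||n [n_nat Sn]] := IH (d %/ p)%N _ (c ^+ p).
- by have := ltn_Pdiv (prime_gt1 p_prime) d0; lia.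
- by rewrite divn_gt0 ?prime_gt0 // dvdn_leq.
- move=> i; have := Sd (i * p)%N; congr (range iota _).
  have -> : ('X - c%:P) ^+ d = (('X - (c ^+ p)%:P) ^+ (d %/ p)) \Po 'X^p.
    rewrite rmorphXn /= comp_polyB comp_polyX comp_polyC rmorphXn /=.
    have p_nat : [pchar {poly E}].-nat p.
      by rewrite (eq_pnat _ (@pchar_poly E)) pnatE.
    by rewrite -exprNn_pchar // -exprDn_pchar // -exprM mulnC divnK.
  by rewrite coef_comp_poly_Xn ?prime_gt0 // dvdn_mull // mulnK ?prime_gt0.
exists (p * n)%N; rewrite exprM; split=> //.
by rewrite pnatM n_nat andbT pnatE.
Qed.

End Base.
End Conjugates.

(** * From the root condition back to uniqueness of the valuation *)

Section LargestRootHenselian.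
Variables (E : closedFieldType) (G : oagType) (v : valuation E G).

Lemma valuation_prod_ge (I : eqType) (s : seq I) (f : I -> E) (g : G) :
  (forall i, i \in s -> vle (Some g) (v (f i))) ->
  vle (Some (g *+ size s)) (v (\prod_(i <- s) f i)).
Proof.
elim: s => [|i s IH] gf; first by rewrite big_nil valuation1 vle_refl.
rewrite big_cons /= mulrS valuationM.
apply: (vle_add (c := Some (g *+ size s)) (gf i (mem_head _ _))); apply: IH => j js.
by apply: gf; rewrite mem_behead.
Qed.

Lemma valuation_prod_le (I : eqType) (s : seq I) (f : I -> E) (g : G) :
  (forall i, i \in s -> vle (v (f i)) (Some g)) ->
  vle (v (\prod_(i <- s) f i)) (Some (g *+ size s)).
Proof.
elim: s => [|i s IH] gf; first by rewrite big_nil valuation1 vle_refl.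
rewrite big_cons /= mulrS valuationM.
apply: (vle_add (d := Some (g *+ size s)) (gf i (mem_head _ _))); apply: IH => j js.
by apply: gf; rewrite mem_behead.
Qed.

Lemma valuation_prod_lt (I : eqType) (s : seq I) (f : I -> E) (g : G) :
  (0 < size s)%N -> (forall i, i \in s -> vlt (v (f i)) (Some g)) ->
  vlt (v (\prod_(i <- s) f i)) (Some (g *+ size s)).
Proof.
case: s => // i s _ gf; rewrite big_cons /= mulrS valuationM.
have le : vle (v (\prod_(j <- s) f j)) (Some (g *+ size s)).
  by apply: valuation_prod_le => j js; apply/vltW/gf; rewrite mem_behead.
apply: (vlt_add (b := Some g) (d := Some (g *+ size s)) _ (gf i (mem_head _ _)) le).
by case: (v (\prod_(j <- s) _)) le.
Qed.

(** After cancellation of the common factors, equally many remain on both sides: those from [T] have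
    value below [g], those from [A] at least [g]. *)
Lemma valuation_prod_exchange (I : finType) (f : I -> E) (g : G) (A T : {set I}) :
  (forall i, f i != 0) -> (forall i, (i \in A) = vle (Some g) (v (f i))) ->
  #|T| = #|A| -> T != A ->
  vlt (v (\prod_(i in T) f i)) (v (\prod_(i in A) f i)).
Proof.
move=> f0 gA cardT TA; rewrite (big_setID A) /= [X in vlt _ (v X)](big_setID T) /=.
rewrite finset.setIC; apply: valuationM_lt; first by apply/prodf_neq0.
have cardD : #|T :\: A| = #|A :\: T| by rewrite !cardsD cardT finset.setIC.
have cardD0 : (0 < #|T :\: A|)%N.
  rewrite lt0n cards_eq0 finset.setD_eq0; apply: contra TA => sTA.
  by rewrite eqEcard sTA cardT leqnn.
rewrite -big_enum -[X in vlt _ (v X)]big_enum /=.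
apply: (@vlt_le_trans _ (Some (g *+ #|T :\: A|))).
  rewrite cardE; apply: valuation_prod_lt; first by rewrite -cardE.
  by move=> i; rewrite mem_enum inE gA => /andP[].
rewrite cardD cardE; apply: valuation_prod_ge => i.
by rewrite mem_enum inE -gA => /andP[].
Qed.

Section FrobeniusPower.
Variables (n : nat) (n_char : [pchar E].-nat n).

Definition frobenius_power (x : E) : E := x ^+ n.

Lemma frobenius_power_zmod : zmod_morphism frobenius_power.
Proof.
by move=> x y; rewrite /frobenius_power exprDn_pchar ?exprNn_pchar.
Qed.

Lemma frobenius_power_monoid : monoid_morphism frobenius_power.
Proof. by split=> [|x y]; rewrite /frobenius_power ?expr1n ?exprMn. Qed.

HB.instance Definition _ :=
  GRing.isZmodMorphism.Build E E frobenius_power frobenius_power_zmod.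
HB.instance Definition _ :=
  GRing.isMonoidMorphism.Build E E frobenius_power frobenius_power_monoid.

Lemma frobenius_prod_XsubC (I : Type) (s : seq I) (f : I -> E) i :
  (\prod_(x <- s) ('X - ((f x) ^+ n)%:P))`_i =
  (\prod_(x <- s) ('X - (f x)%:P))`_i ^+ n.
Proof.
rewrite -[RHS]/(frobenius_power _) -coef_map /= rmorph_prod /=.
by under [in RHS]eq_bigr do rewrite rmorphB /= map_polyX map_polyC /=.
Qed.

End FrobeniusPower.

Section Base.
Variables (F : fieldType) (iota : {rmorphism F -> E}).
Hypothesis Falg : forall z, algebraicOver iota z.
Local Notation "p ^i" := (map_poly iota p) (at level 2, format "p ^i").

(** All roots of the minimal polynomial are images of [c], so it is a power of X - c. *)
Lemma fixed_pchar_power c :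
  (forall s : {rmorphism E -> E}, (forall a, s (iota a) = iota a) -> s c = c) ->
  exists n, [pchar E].-nat n /\ range iota (c ^+ n).
Proof.
move=> c_fix; have [q [qm q_irr qc]] := min_poly_exists (Falg c).
have [rs def_q] := monic_splits iota qm.
have rs_c x : x \in rs -> x = c.
  move=> x_rs; have qx : root q^i x by rewrite def_q root_prod_XsubC.
  by have [s [sF <-]] := extend_embedding Falg q_irr qc qx; apply: c_fix.
have def_q' : q^i = ('X - c%:P) ^+ size rs.
  rewrite def_q (eq_big_seq (fun=> 'X - c%:P)) => [|x /rs_c-> //].
  by rewrite big_const_seq count_predT iter_mulr_1.
apply: (@pchar_power_in_base _ _ iota c (size rs)).
  by case: (rs) def_q qc => // ->; rewrite big_nil (negbTE (root1 _)).
by move=> i; rewrite -def_q' coef_map; exists q`_i.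
Qed.

(** Let [A] consist of the conjugates of [a] with value at least [g], the value of [a]. Its product
    [m A] has larger value than the product over any other set of as many conjugates. These products
    are the roots of [Psi], whose coefficients are fixed by all conjugations, so a power of [m A]
    lies in the base field. If [s a] had smaller value than [a], then [s] would carry [A] to another
    set and lower the value of the product, although it fixes that power. *)
Lemma largest_root_conj_ge (s : {rmorphism E -> E}) a :
  largest_root_closed v (range iota) -> (forall x, s (iota x) = iota x) ->
  vle (v a) (v (s a)).
Proof.
move=> Hcl sF; have [->|a0] := eqVneq a 0; first by rewrite rmorph0 vle_refl.
have [g va] := valuation_Some v a0.
have [q [qm q_irr qa]] := min_poly_exists (Falg a).
have [rs0 def_q] := monic_splits iota qm.
(* Without repetitions [f] is injective, and conjugations become permutations of the indices. *)
pose rs := undup rs0; have rs_q x : (x \in rs) = root q^i x.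
  by rewrite mem_undup def_q root_prod_XsubC.
pose f (i : 'I_(size rs)) := rs`_i.
have f_inj : injective f.
  by move=> i j /eqP; rewrite nth_uniq ?undup_uniq // => /eqP/val_inj.
have f_rs i : f i \in rs by apply: mem_nth.
have f_onto x : x \in rs -> exists i, f i = x.
  move=> x_rs; rewrite -index_mem in x_rs; exists (Ordinal x_rs).
  by rewrite /f /= nth_index // -index_mem.
have f0 i : f i != 0.
  have := f_rs i; rewrite rs_q; apply: contraTneq => ->; apply/negP => q0.
  have : root (map_poly iota 'X) a.
    rewrite (irreducible_root_dvd _ q_irr qa) -(irreducible_root_dvd _ q_irr q0).
    by rewrite map_polyX rootX.
  by rewrite map_polyX rootX (negbTE a0).
pose A : {set 'I_(size rs)} := finset (fun i => vle (Some g) (v (f i))).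
have gA i : (i \in A) = vle (Some g) (v (f i)) by rewrite inE.
pose m (T : {set 'I_(size rs)}) := \prod_(i in T) f i.
pose Psi := \prod_(T : {set 'I_(size rs)} | #|T| == #|A|) ('X - (m T)%:P).
have permP (t : {rmorphism E -> E}) : (forall x, t (iota x) = iota x) ->
    exists2 pi : 'I_(size rs) -> 'I_(size rs), injective pi &
      forall i, t (f i) = f (pi i).
  move=> tF; have ex i : exists j, t (f i) = f j.
    have [|j <-] := f_onto (t (f i)); last by exists j.
    by rewrite rs_q conj_root // -rs_q.
  have [pi fpi] := choice ex; exists pi => // i j pij.
  by apply/f_inj/(fmorph_inj t); rewrite !fpi pij.
have m_conj (t : {rmorphism E -> E}) pi T : injective pi ->
    (forall i, t (f i) = f (pi i)) -> t (m T) = m (pi @: T).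
  move=> pi_inj fpi; rewrite rmorph_prod /m big_imset /=; last first.
    by move=> i j _ _; apply: pi_inj.
  by apply: eq_bigr => i _; rewrite fpi.
have Psi_fix (t : {rmorphism E -> E}) : (forall x, t (iota x) = iota x) ->
    map_poly t Psi = Psi.
  move=> tF; have [pi pi_inj fpi] := permP t tF.
  rewrite rmorph_prod /= [RHS](reindex_inj (imset_inj pi_inj)) /=.
  apply: eq_big => [T|T _]; first by rewrite card_imset.
  by rewrite rmorphB /= map_polyX map_polyC /= (m_conj _ pi).
have [n0 n0_char n0_S] : exists2 n0 : nat -> nat,
    forall i, [pchar E].-nat (n0 i) & forall i, range iota (Psi`_i ^+ n0 i).
  have ex i : exists n, [pchar E].-nat n /\ range iota (Psi`_i ^+ n).
    by apply: fixed_pchar_power => t tF; rewrite -coef_map Psi_fix.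
  have [n0 n0P] := choice ex; exists n0 => i; by have [] := n0P i.
(* Each coefficient of [Psi] needs its own exponent; the product of these exponents serves for all
   of them and still gives a power of Frobenius. *)
pose n := (\prod_(i < size Psi) n0 i)%N.
have n_char : [pchar E].-nat n.
  by apply: (big_ind (fun k => [pchar E].-nat k)) => // x y; rewrite pnatM => -> ->.
have n_gt0 : (0 < n)%N by case/andP: n_char.
have Sf := range_subfield iota.
have n_S i : range iota (Psi`_i ^+ n).
  have [i_Psi|i_Psi] := ltnP i (size Psi); last first.
    by rewrite nth_default // expr0n -[n]prednK //; apply: (subfield0 Sf).
  rewrite /n (bigD1 (Ordinal i_Psi)) //= exprM.
  by apply: (subfieldX Sf).
pose Ts := [seq T : {set 'I_(size rs)} <- index_enum {set 'I_(size rs)} |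
  (#|T| == #|A|) && (T != A)].
have mA_S : range iota (m A ^+ n).
  apply: (Hcl [seq m T ^+ n | T <- Ts]) => [i|x].
    rewrite -[m A ^+ n :: _]/([seq m T ^+ n | T <- A :: Ts]) big_map.
    rewrite (frobenius_prod_XsubC n_char).
    suff -> : \prod_(T <- A :: Ts) ('X - (m T)%:P) = Psi by [].
    by rewrite big_cons big_filter /= [RHS](bigD1 A).
  move=> /mapP[T]; rewrite mem_filter => /andP[/andP[/eqP cardT TA] _] ->.
  have := valuation_prod_exchange f0 gA cardT TA; rewrite -!/(m _).
  have [[gT vT] [gA' vA]] : (exists g, v (m T) = Some g) /\ (exists g, v (m A) = Some g).
    by split; apply: valuation_Some; apply/prodf_neq0.
  by rewrite (valuationX n vT) (valuationX n vA) vT vA => /oag_ltMn; apply.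
rewrite vleNvlt va; apply/negP => sa_lt.
have [pi pi_inj fpi] := permP s sF.
have [j fj] : exists j, f j = a by apply: f_onto; rewrite rs_q.
have piA : pi @: A != A.
  apply: contraTneq sa_lt => piA; rewrite -vleNvlt -fj fpi -gA -piA imset_f //.
  by rewrite gA fj va vle_refl.
have := valuation_prod_exchange f0 gA (card_imset _ pi_inj) piA; rewrite -!/(m _).
have := sF _; move: mA_S => [x _ mAx] /(_ x); rewrite mAx rmorphXn /=.
rewrite (m_conj _ pi) // => /(congr1 v).
have [[gT vT] [gA' vA]] : (exists g, v (m (pi @: A)) = Some g) /\ (exists g, v (m A) = Some g).
  by split; apply: valuation_Some; apply/prodf_neq0.
rewrite (valuationX n vT) (valuationX n vA) vT vA => -[e] /oag_ltMn -/(_ n n_gt0).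
by rewrite e vltxx.
Qed.

(** The inequality for conjugates, used in both directions, shows that all conjugates of [a] have
    the same value under [v]. The Newton polygon then forces this value on [u a]. *)
Lemma largest_root_henselian :
  largest_root_closed v (range iota) -> henselian v (range iota).
Proof.
move=> Hcl u uv a; have [->|a0] := eqVneq a 0; first by rewrite !valuation0.
have [q [qm q_irr qa]] := min_poly_exists (Falg a).
have [g va] := valuation_Some v a0; have [t ua] := valuation_Some u a0.
rewrite va ua; congr Some.
apply: (@root_value_unique _ _ v _ iota q g t _ u (fun i => iota q`_i) (fun i => a ^+ i)).
- by [].
- by case: q_irr.
- move=> x qx; rewrite -va; apply: vle_anti.
    have [s [sF <-]] := extend_embedding Falg q_irr qx qa.
    exact: largest_root_conj_ge.
  have [s [sF <-]] := extend_embedding Falg q_irr qa qx.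
  exact: largest_root_conj_ge.
- by move=> i; apply: uv; exists q`_i.
- by move=> i; apply: valuationX.
- apply: etrans (eqP qa); rewrite horner_coef size_map_poly.
  by apply: eq_bigr => i _; rewrite coef_map.
Qed.

End Base.

End LargestRootHenselian.

(** * The Henselization is immediate *)

Section Immediate.
Variables (E : closedFieldType) (G : oagType) (v : valuation E G).

(** Equality of value groups and of residue fields in a single condition: every initial form of [L]
    comes from [S]. *)
Definition immediate (S L : set E) : Prop :=
  forall a, L a -> a != 0 -> exists2 b, S b & vsim v a b.

Lemma immediate_refl S : immediate S S.
Proof. by move=> a Sa a0; exists a => //; apply: vsim_refl. Qed.

Lemma immediate_trans S L M : immediate S L -> immediate L M -> immediate S M.
Proof.
move=> SL LM a Ma a0; have [b Lb ab] := LM a Ma a0.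
have [c Sc bc] := SL b Lb (vsim_neq0r ab).
by exists c => //; apply: vsim_trans bc.
Qed.

Section Base.
Variables (F : fieldType) (iota : {rmorphism F -> E}).
Hypothesis Falg : forall z, algebraicOver iota z.
Local Notation "p ^i" := (map_poly iota p) (at level 2, format "p ^i").
Local Notation S := (range iota).

(* Kaplansky's argument: among the elements that have the same distances to
   [S] as [r], one of minimal degree generates an immediate extension. *)
Lemma immediate_extension r : ~ S r ->
  (forall b, S b -> exists2 b', S b' & vlt (v (r - b)) (v (r - b'))) ->
  exists2 z, ~ S z & immediate S (adjoin S z).
Proof.
move=> nSr r_inc; pose limit z := forall b, S b -> v (z - b) = v (r - b).
pose P n := `[< exists p : {poly F},
  [/\ p != 0, size p = n & exists2 z, limit z & root p^i z] >].
have exP : exists n, P n.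
  have [p p0 pr] := Falg r; exists (size p); apply/asboolP.
  by exists p; split=> //; exists r.
case: (ex_minnP exP) => n /asboolP[p [p0 size_p [z z_lim pz]]] n_min.
have [q [qm q_irr qz]] := min_poly_exists (Falg z).
have size_q : (size q <= n)%N.
  by rewrite -size_p dvdp_leq // -(irreducible_root_dvd p q_irr qz).
have nSz : ~ S z.
  move=> Sz; have := z_lim z Sz; rewrite subrr valuation0.
  by move/esym/eqP; rewrite valuation_eqN subr_eq0 => /eqP rz; apply: nSr; rewrite rz.
have z_inc b : S b -> exists2 b', S b' & vlt (v (z - b)) (v (z - b')).
  by move=> Sb; have [b' Sb' lt] := r_inc b Sb; exists b'; rewrite ?z_lim.
(* Finitely many elements that are not limits can be beaten at once: one [b] in the base field is
   closer to [z] than all of them. *)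
have close (cs : seq E) : (forall c, c \in cs -> ~ limit c) ->
    exists2 b, S b & forall c, c \in cs -> vlt (v (z - c)) (v (z - b)).
  elim: cs => [|c cs IH] ncs.
    by exists 0 => //; apply: (subfield0 (range_subfield iota)).
  have [|b Sb b_cs] := IH; first by move=> d dcs; apply: ncs; rewrite mem_behead.
  (* Where the distances from [c] and from [z] differ, z - c cannot have larger value than z - b0,
     and [b1] is closer still. *)
  have [b0 Sb0 cb0] : exists2 b0, S b0 & v (c - b0) <> v (r - b0).
    apply: contrapT => nex; apply: (ncs c (mem_head _ _)) => b0 Sb0.
    by apply: contrapT => ne; apply: nex; exists b0.
  have [b1 Sb1 b01] := z_inc b0 Sb0.
  have c_b1 : vlt (v (z - c)) (v (z - b1)).
    apply: vle_lt_trans b01; rewrite vleNvlt; apply/negP => lt.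
    apply: cb0; rewrite -(z_lim _ Sb0) -(subrKA z) addrC valuationDl //.
    by rewrite [v (c - z)]valuationBC.
  have [le|le] := orP (vle_total (v (z - b)) (v (z - b1))).
    exists b1 => // d; rewrite inE => /orP[/eqP->//|/b_cs d_b].
    exact: vlt_le_trans le.
  exists b => // d; rewrite inE => /orP[/eqP->|/b_cs//].
  exact: vlt_le_trans le.
(* By minimality of [n], no root of [h] is a limit. So [b] can replace [z] in every linear factor of
   [h] without changing its initial form. *)
exists z => // x /(adjoin_polyP _ q_irr qz)[h size_h ->] hz0.
have h0 : h != 0 by apply: contraNneq hz0 => ->; rewrite rmorph0 horner0.
have [cs def_h] := closed_field_poly_normal h^i.
have [|b Sb b_cs] := close cs.
  move=> c c_cs c_lim; have /negP[] : ~~ P (size h).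
    by apply/negP => /n_min; rewrite leqNgt (leq_trans size_h).
  apply/asboolP; exists h; split=> //; exists c => //.
  rewrite def_h rootZ ?root_prod_XsubC // lead_coef_eq0.
  by rewrite map_poly_eq0.
exists h^i.[b].
  have [b' _ <-] := Sb; exists h.[b'] => //.
  by rewrite horner_map.
have lc0 : lead_coef h^i != 0 by rewrite lead_coef_eq0 map_poly_eq0.
rewrite def_h !hornerZ !horner_prod; apply: vsimMl => //.
elim: cs b_cs {def_h} => [|c cs IH] b_cs.
  by rewrite !big_nil vsim_refl ?oner_neq0.
rewrite !big_cons; apply: vsimM; last first.
  by apply: IH => d dcs; apply: b_cs; rewrite mem_behead.
by rewrite !hornerE /vsim opprB addrA subrK; apply: b_cs; rewrite mem_head.
Qed.

(** The coefficient of X divided by the constant one is minus the sum of the inverses of the roots,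
    and each r / x has positive value. *)
Lemma prod_XsubC_coef01 (rs : seq E) r : r != 0 ->
  (forall x, x \in rs -> vlt (v x) (v r)) ->
  vlt (v (\prod_(x <- rs) ('X - x%:P))`_0)
      (v (r * (\prod_(x <- rs) ('X - x%:P))`_1)).
Proof.
move=> r0; elim: rs => [|x rs IH] rs_lt.
  by rewrite big_nil !coef1 mulr0 valuation0 valuation1.
have x_lt := rs_lt x (mem_head _ _).
have {}IH := IH (fun y y_rs => rs_lt y (mem_behead (s := x :: rs) y_rs)).
have x0 : x != 0 by rewrite -(valuation_neqN v) (vlt_neqN x_lt).
rewrite big_cons !mulrBl !coefB !coefXM !coefCM /= sub0r valuationN.
rewrite mulrBr; apply: valuationB_gt.
  by rewrite mulrC [r * _]mulrC; apply: valuationM_lt; rewrite // -(valuation_neqN v) (vlt_neqN IH).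
by rewrite mulrCA; apply: valuationM_lt.
Qed.

(** One Newton step from 0. If P = (X - r) Q, the step leads to r Q_0 / (Q_0 - r Q_1), in whose
    denominator Q_0 dominates. *)
Lemma largest_root_approx (rs : seq E) r : r != 0 ->
  (forall i, S (\prod_(x <- r :: rs) ('X - x%:P))`_i) ->
  (forall x, x \in rs -> vlt (v x) (v r)) -> exists2 c, S c & vsim v r c.
Proof.
move=> r0 SP rs_lt; set P := \prod_(x <- _) _ in SP.
have Sf := range_subfield iota.
exists (- (P`_0 / P`_1)).
  by apply: (subfieldN Sf); apply: (subfield_div Sf).
have lt01 := prod_XsubC_coef01 r0 rs_lt.
rewrite /P big_cons !mulrBl !coefB !coefXM !coefCM /= sub0r.
set Q := \prod_(x <- _) _ in lt01 *.
have sQ : vsim v (Q`_0 - r * Q`_1) (Q`_0) by apply/vsim_sym/vsimB.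
have P1 := vsim_neq0 sQ.
apply: (@vsimMIl _ _ _ (Q`_0 - r * Q`_1)).
rewrite mulNr opprK [X in vsim _ _ X]mulrC divfK // [X in vsim _ _ X]mulrC.
exact: vsimMr.
Qed.

End Base.

Lemma algebraicOver_sub (F F' : fieldType) (i : {rmorphism F -> E})
    (i' : {rmorphism F' -> E}) z :
  range i `<=` range i' -> algebraicOver i z -> algebraicOver i' z.
Proof.
move=> sii' [p p0 pz]; have [j|q def_q] := @poly_over_range _ _ i' (map_poly i p).
  by rewrite coef_map; apply: sii'; exists p`_j.
exists q; last by rewrite def_q.
by rewrite -(map_poly_eq0 i') def_q map_poly_eq0.
Qed.

Lemma maximal_immediate S : is_subfield S ->
  exists L, [/\ is_subfield L, S `<=` L, immediate S L &
    forall M, is_subfield M -> L `<=` M -> immediate S M -> M `<=` L].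
Proof.
move=> Sf; pose good A := is_subfield (A `|` S) /\ immediate S (A `|` S).
have [|A [[Af Aimm] A_max]] := @Zorn_bigcup _ good.
  move=> C CF Ctot; pose U := \bigcup_(X in C) X `|` S.
  have dir x y : U x -> U y ->
      exists X, [/\ good X, X `|` S `<=` U, (X `|` S) x & (X `|` S) y].
    have sub X : C X -> X `|` S `<=` U.
      by move=> CX z [Xz|]; [left; exists X|right].
    move=> [[X CX Xx]|Sx] [[Y CY Yy]|Sy].
    + case: (Ctot _ _ CX CY) => [XY|YX].
        by exists Y; split; [exact: CF|exact: sub|left; exact: XY|left].
      by exists X; split; [exact: CF|exact: sub|left|left; exact: YX].
    + by exists X; split; [exact: CF|exact: sub|left|right].
    + by exists Y; split; [exact: CF|exact: sub|right|left].
    + exists set0; rewrite /good set0U; split=> //; last exact: subsetUr.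
      by split=> //; apply: immediate_refl.
  split.
    split; first by right; apply: subfield1.
      by move=> x y /dir/[apply] -[X [[Xf _] sX Xx Xy]]; exact/sX/(subfieldB Xf).
    by move=> x y /dir/[apply] -[X [[Xf _] sX Xx Xy]]; exact/sX/(subfield_div Xf).
  by move=> x Ux; have [X [[_ Ximm] _ Xx _]] := dir _ _ Ux Ux; apply: Ximm.
exists (A `|` S); split; [exact: Af|exact: subsetUr|exact: Aimm|].
move=> M Mf AM Mimm x Mx; apply: contrapT => nx.
apply: (A_max M).
  split=> [y Ay|MA]; first by apply: AM; left.
  by apply: nx; left; apply: MA.
suff MS : M `|` S = M by rewrite /good MS.
by apply/setUidPl => y Sy; apply: AM; right.
Qed.

Section Base.
Variables (F : fieldType) (iota : {rmorphism F -> E}).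
Hypothesis Falg : forall z, algebraicOver iota z.
Local Notation S := (range iota).

Lemma subfield_algebraic L : is_subfield L -> S `<=` L ->
  exists (F' : fieldType) (i' : {rmorphism F' -> E}),
    range i' = L /\ forall z, algebraicOver i' z.
Proof.
move=> /subfield_as_type[F' [i' def_L]] SL; exists F', i'; split=> // z.
by apply: (@algebraicOver_sub _ _ iota); rewrite ?def_L.
Qed.

(** If a largest root [r] were missing from [L], each [b] in [L] could be improved as an
    approximation of [r]: by a Newton step for [r], or, once [b] is closer to [r] than 0 is, by a
    Newton step for r - b. Then [immediate_extension] would contradict maximality. *)
Lemma maximal_immediate_henselian L : is_subfield L -> S `<=` L ->
  immediate S L ->
  (forall M, is_subfield M -> L `<=` M -> immediate S M -> M `<=` L) ->
  henselian v L.
Proof.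
move=> Lf SL Limm L_max.
have [F' [i' [def_L F'alg]]] := subfield_algebraic Lf SL.
rewrite -def_L; apply: largest_root_henselian => // rs r; rewrite def_L => LP rs_lt.
apply: contrapT => nLr; rewrite -def_L in LP nLr Limm Lf L_max SL.
have r0 : r != 0.
  by apply/eqP => r0; apply: nLr; rewrite r0; apply: subfield0.
have [b Lb|z nLz zimm] := immediate_extension F'alg nLr; last first.
  apply: nLz; apply: (L_max (adjoin (range i') z)).
  - exact: adjoin_subfield.
  - exact: sub_adjoin.
  - exact: immediate_trans zimm.
  - exact: mem_adjoin.
have [vrb|] := boolP (vle (v (r - b)) (v r)).
  have [c Lc rc] := largest_root_approx r0 LP rs_lt.
  by exists c => //; apply: vle_lt_trans rc.
rewrite -/(vlt _ _) => vrb; have rb0 : r - b != 0.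
  by apply/eqP => /subr0_eq rb; apply: nLr; rewrite rb.
(* Translation by [b] keeps r - b the largest root: x - b has the value of [x], which is below that
   of [r] and so below that of r - b. *)
have [||c Lc rbc] := @largest_root_approx _ i' [seq x - b | x <- rs] _ rb0.
- move=> i; rewrite -[r - b :: _]/[seq x - b | x <- r :: rs] big_map.
  have [P def_P] := poly_over_range LP; have [b' _ def_b] := Lb.
  have -> : \prod_(x <- r :: rs) ('X - (x - b)%:P) =
      map_poly i' (P \Po ('X + b'%:P)).
    rewrite map_comp_poly def_P rmorphD /= map_polyX map_polyC /= def_b.
    rewrite rmorph_prod /=; apply: eq_bigr => x _.
    by rewrite comp_polyB comp_polyX comp_polyC polyCB opprB addrA.
  by rewrite coef_map; exists (P \Po ('X + b'%:P))`_i.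
- move=> _ /mapP[x x_rs ->]; have x_r := rs_lt x x_rs.
  have -> : x - b = x - r + (r - b) by rewrite addrA subrK.
  have vxr : v (x - r) = v x by rewrite valuationDl // valuationN.
  have x_rb : vlt (v (x - r)) (v (r - b)) by rewrite vxr; apply: vlt_trans vrb.
  by rewrite (valuationDl x_rb).
exists (b + c); first exact: subfieldD.
by rewrite opprD addrA.
Qed.

(** The least Henselian field lies in a maximal immediate extension, because the latter is
    Henselian. *)
Lemma henselization_immediate : immediate S (henselization v S).
Proof.
have [L [Lf SL Limm L_max]] := maximal_immediate (range_subfield iota).
move=> a Ha; apply: (Limm a); apply: Ha; [exact: Lf|exact: SL|].
exact: maximal_immediate_henselian Lf SL Limm L_max.
Qed.

Lemma henselization_subfield T : is_subfield (henselization v T).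
Proof.
split=> [L [] //|a b Ha Hb L Lf TL Lh|a b Ha Hb L Lf TL Lh].
  by apply: (subfieldB Lf); [apply: Ha|apply: Hb].
by apply: (subfield_div Lf); [apply: Ha|apply: Hb].
Qed.

(** The largest root lies in each of the Henselian fields that are intersected. *)
Lemma henselization_henselian : henselian v (henselization v S).
Proof.
have Hf := henselization_subfield S.
have [F' [i' [def_H F'alg]]] := subfield_algebraic Hf (@sub_henselization _ _ v S).
rewrite -def_H; apply: largest_root_henselian => // rs r; rewrite def_H => HP rs_lt.
move=> L Lf SL Lh; have [F2 [i2 [def_L F2alg]]] := subfield_algebraic Lf SL.
rewrite -def_L in Lh *; apply: (henselian_largest_root F2alg Lh) rs_lt => i.
by rewrite def_L; apply: HP => //; rewrite -def_L.
Qed.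

(** A field that contains a Henselian field is Henselian, so the right-hand side is one of the
    fields intersected on the left. *)
Lemma henselization_adjoin t :
  henselization v (adjoin S t) = adjoin (henselization v S) t.
Proof.
apply/seteqP; split=> [a Ha|].
  apply: Ha; first exact: adjoin_subfield.
    apply: adjoin_min; first exact: adjoin_subfield.
      by apply: subset_trans (@sub_henselization _ _ v S) _; apply: sub_adjoin.
    exact: mem_adjoin.
  exact: henselian_sub (@sub_adjoin _ _ t) henselization_henselian.
apply: adjoin_min; first exact: henselization_subfield.
  move=> a Ha L Lf AL Lh; apply: Ha => //.
  exact: subset_trans (@sub_adjoin _ S t) AL.
exact: (@sub_henselization _ _ v _ _ (@mem_adjoin _ S t)).
Qed.

End Base.
End Immediate.

(** * Key polynomials *)

Section KeyPolynomials.
Variables (F : fieldType) (G : oagType) (W : valuation {poly F} G).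
Implicit Types a b c f g h q r : {poly F}.

Lemma w_dividesP f g : w_divides W f g <-> exists h, vsim W g (f * h).
Proof.
by split=> -[h]; [move=> [fh _]|move=> fh]; exists h => //; split; rewrite // (vsim_val fh).
Qed.

Lemma w_divides_sim f g h : vsim W g h -> w_divides W f g -> w_divides W f h.
Proof.
move=> gh /w_dividesP[k gk]; apply/w_dividesP; exists k.
exact: vsim_trans (vsim_sym gh) gk.
Qed.

Lemma w_divides_mulr f g k : k != 0 -> w_divides W f g -> w_divides W f (g * k).
Proof.
move=> k0 /w_dividesP[h gh]; apply/w_dividesP; exists (h * k).
by rewrite mulrA; apply: vsimMr.
Qed.

Lemma w_divides_trans g f h : w_divides W f g -> w_divides W g h -> w_divides W f h.
Proof.
move=> /w_dividesP[k gk] /w_dividesP[l hl]; apply/w_dividesP; exists (k * l).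
apply: (vsim_trans hl); rewrite mulrA; apply: vsimMr => //.
by apply: contraTneq (vsim_neq0r hl) => ->; rewrite mulr0 eqxx.
Qed.

Lemma w_divides_mull f g : g != 0 -> f != 0 -> w_divides W f (f * g).
Proof. by move=> g0 f0; apply/w_dividesP; exists g; rewrite vsim_refl ?mulf_neq0. Qed.

Lemma w_divides_neq0 f g : w_divides W f g -> f != 0 /\ g != 0.
Proof.
move=> /w_dividesP[h gh]; split; last exact: vsim_neq0 gh.
by apply: contraTneq (vsim_neq0r gh) => ->; rewrite mul0r eqxx.
Qed.

Definition w_unit f : Prop := w_divides W f 1.

Lemma w_divides_unit f g : w_divides W f g -> w_unit g -> w_unit f.
Proof. exact: w_divides_trans. Qed.

Lemma w_unitM f g : w_unit f -> w_unit g -> w_unit (f * g).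
Proof.
move=> /w_dividesP[f' ff'] /w_dividesP[g' gg']; apply/w_dividesP; exists (f' * g').
by rewrite mulrACA -[1]mulr1; apply: vsimM.
Qed.

(* Together with the ultrametric inequality, this says that [W (q * f + r)] is
   the minimum of [W (q * f)] and [W r]. *)
Definition expands f : Prop :=
  forall q r, r != 0 -> (size r < size f)%N -> vle (W (q * f + r)) (W r).

(** Cancellation between [q * f] and [r] would mean that [r] is equivalent to [- q * f]. *)
Lemma expandsP f :
  (forall r, r != 0 -> (size r < size f)%N -> ~ w_divides W f r) -> expands f.
Proof.
move=> ndvd q r r0 size_r; rewrite vleNvlt; apply/negP => lt.
apply: (ndvd r r0 size_r); apply/w_dividesP; exists (- q).
by rewrite /vsim mulrN opprK addrC mulrC.
Qed.

Lemma expands_ndvd f r : expands f -> r != 0 -> (size r < size f)%N ->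
  ~ w_divides W f r.
Proof.
move=> fe r0 size_r /w_dividesP[h]; rewrite /vsim => rh.
by have := fe (- h) r r0 size_r; rewrite mulNr addrC mulrC vleNvlt rh.
Qed.

Lemma key_expands f : key_polynomial W f -> expands f.
Proof.
move=> [_ _ f_min]; apply: expandsP => r r0 size_r /(f_min r r0).
by rewrite leqNgt size_r.
Qed.

Lemma expands_lel f q r : expands f -> (size r < size f)%N ->
  vle (W (q * f + r)) (W (q * f)).
Proof.
move=> fe size_r; have [->|r0] := eqVneq r 0; first by rewrite addr0 vle_refl.
rewrite vleNvlt; apply/negP => lt.
have := fe q r r0 size_r; rewrite vleNvlt => /negP[].
rewrite -[W r](_ : W (q * f) = _) //.
have /vsim_val : vsim W (q * f) (- r) by rewrite /vsim opprK.
by rewrite valuationN.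
Qed.

Lemma expands_ler f q r : expands f -> (size r < size f)%N ->
  vle (W (q * f + r)) (W r).
Proof.
move=> fe size_r; have [->|r0] := eqVneq r 0; first by rewrite valuation0 vleN.
exact: fe.
Qed.

(** Both terms of the division have at least the value of [h]; if the remainder had more, [h] would
    be equivalent to a multiple of [f]. *)
Lemma expands_rem f h : f != 0 -> expands f -> h != 0 -> ~ w_divides W f h ->
  W (h %% f) = W h /\ vle (W h) (W (h %/ f * f)).
Proof.
move=> f0 fe h0 nfh; have size_r : (size (h %% f)%R < size f)%N by rewrite ltn_modp.
have le_q := expands_lel (h %/ f) fe size_r.
have le_r := expands_ler (h %/ f) fe size_r.
rewrite -divp_eq in le_q le_r; split=> //.
have [//|lt] := vle_eqVlt le_r; case: nfh; apply/w_dividesP; exists (h %/ f).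
by rewrite /vsim {2}(divp_eq h f) mulrC addrC addKr.
Qed.

Lemma expands_sum f n (d : nat -> {poly F}) j : expands f ->
  (forall i, (size (d i) < size f)%N) -> (j < n)%N ->
  vle (W (\sum_(i < n) d i * f ^+ i)) (W (d j * f ^+ j)).
Proof.
move=> fe; elim: n d j => [//|n IH] d j size_d jn.
have -> : \sum_(i < n.+1) d i * f ^+ i =
    (\sum_(i < n) d i.+1 * f ^+ i) * f + d 0%N.
  rewrite big_ord_recl /= expr0 mulr1 addrC mulr_suml; congr (_ + _).
  by apply: eq_bigr => i _; rewrite exprSr mulrA.
case: j jn => [_|j jn]; first by rewrite expr0 mulr1 expands_ler.
apply: vle_trans (expands_lel _ fe (size_d 0%N)) _.
rewrite exprSr mulrA !valuationM vaddC [X in vle _ X]vaddC; apply: vle_add2l.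
by rewrite -valuationM; apply: (IH (fun i => d i.+1)).
Qed.

Lemma expansion f n h : (1 < size f)%N -> (size h <= n * (size f).-1)%N ->
  exists d : nat -> {poly F}, [/\ forall i, (size (d i) < size f)%N,
    forall i, (n <= i)%N -> d i = 0 & h = \sum_(i < n) d i * f ^+ i].
Proof.
move=> f1; have f0 : f != 0 by rewrite -size_poly_gt0; lia.
elim: n h => [|n IH] h size_h.
  exists (fun=> 0); split=> // [i|]; first by rewrite size_poly0; lia.
  by rewrite big_ord0; apply/eqP; rewrite -size_poly_leq0.
have [|d [size_d d0 def_q]] := IH (h %/ f); first by rewrite size_divp // leq_subLR -mulSn.
exists (fun i => if i is i'.+1 then d i' else h %% f); split.
- by case=> //; rewrite ltn_modp.
- by case=> // i; apply: d0.
rewrite big_ord_recl expr0 mulr1 {1}(divp_eq h f) {1}def_q addrC mulr_suml.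
by congr (_ + _); apply: eq_bigr => i _; rewrite exprSr mulrA.
Qed.

End KeyPolynomials.

(** * Polynomials of minimal degree whose initial form is not a unit *)

Section MinimalNonunit.
Variables (F : fieldType) (G : oagType) (W : valuation {poly F} G).
Implicit Types a b c f g h q r : {poly F}.

Lemma minimal_nonunit_exists f : f != 0 -> ~ w_unit W f ->
  exists phi, [/\ phi \is monic, ~ w_unit W phi &
    forall a, a != 0 -> (size a < size phi)%N -> w_unit W a].
Proof.
move=> f0 nf; pose P n := `[< exists a, [/\ a != 0, size a = n & ~ w_unit W a] >].
have exP : exists n, P n by exists (size f); apply/asboolP; exists f.
case: (ex_minnP exP) => _ /asboolP[a [a0 <- na]] n_min.
have la0 : (lead_coef a)^-1 != 0 by rewrite invr_eq0 lead_coef_eq0.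
exists ((lead_coef a)^-1 *: a); split.
- by rewrite monicE lead_coefZ mulVf // lead_coef_eq0.
- move=> ua; apply: na; apply: w_divides_unit ua.
  by rewrite -mul_polyC mulrC; apply: w_divides_mull; rewrite ?polyC_eq0.
- move=> b b0; rewrite size_scale // => size_b; apply: contrapT => nb.
  by move: size_b; rewrite ltnNge => /negP[]; apply: n_min; apply/asboolP; exists b.
Qed.

Variable phi : {poly F}.
Hypotheses (phi_monic : phi \is monic) (phi_nonunit : ~ w_unit W phi).
Hypothesis phi_min : forall a, a != 0 -> (size a < size phi)%N -> w_unit W a.
Let phi0 := monic_neq0 phi_monic.

Lemma nonunit_size : (1 < size phi)%N.
Proof.
rewrite ltnNge; apply/negP => /size1_polyC def_phi; apply: phi_nonunit.
have := monicP phi_monic; rewrite def_phi lead_coefC => ->.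
by apply/w_dividesP; exists 1; rewrite mulr1 vsim_refl ?oner_neq0.
Qed.

Lemma nonunit_expands : expands W phi.
Proof.
apply: expandsP => r r0 /(phi_min r0) ur /w_divides_unit => /(_ ur).
exact: phi_nonunit.
Qed.

Let phi_exp := nonunit_expands.

Lemma unit_rem h : h != 0 -> w_unit W h ->
  W (h %% phi) = W h /\ vle (W h) (W (h %/ phi * phi)).
Proof.
move=> h0 uh; apply: expands_rem => // /w_divides_unit/(_ uh).
exact: phi_nonunit.
Qed.

Lemma mul_rem a b : a != 0 -> b != 0 ->
  (size a < size phi)%N -> (size b < size phi)%N ->
  W ((a * b) %% phi) = W (a * b) /\ vle (W (a * b)) (W ((a * b) %/ phi * phi)).
Proof.
move=> a0 b0 size_a size_b; apply: unit_rem; first exact: mulf_neq0.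
by apply: w_unitM; apply: phi_min.
Qed.

Lemma mul_div_le a b : (size a < size phi)%N -> (size b < size phi)%N ->
  vle (W (a * b)) (W ((a * b) %/ phi * phi)).
Proof.
move=> size_a size_b.
have [->|a0] := eqVneq a 0; first by rewrite mul0r div0p mul0r vle_refl.
have [->|b0] := eqVneq b 0; first by rewrite mulr0 div0p mul0r vle_refl.
by have [] := mul_rem a0 b0 size_a size_b.
Qed.

Lemma mul_mod_le a b : (size a < size phi)%N -> (size b < size phi)%N ->
  vle (W (a * b)) (W ((a * b) %% phi)).
Proof.
move=> size_a size_b.
have [->|a0] := eqVneq a 0; first by rewrite mul0r mod0p vle_refl.
have [->|b0] := eqVneq b 0; first by rewrite mulr0 mod0p vle_refl.
by have [-> _] := mul_rem a0 b0 size_a size_b; apply: vle_refl.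
Qed.

(** A common factor would split [phi] into factors of smaller degree, which are units. *)
Lemma coprimep_nonunit q : q != 0 -> (size q < size phi)%N -> coprimep q phi.
Proof.
move=> q0 size_q; rewrite /coprimep; apply: contraT => gcd1.
have [e def_phi] := dvdpP _ _ (dvdp_gcdr q phi).
set d := gcdp q phi in def_phi gcd1.
have d0 : d != 0 by rewrite gcdp_eq0 negb_and q0.
have size_d : (size d < size phi)%N.
  by apply: leq_ltn_trans size_q; apply: dvdp_leq (dvdp_gcdl _ _).
have e0 : e != 0 by apply: contraNneq phi0 => e0; rewrite def_phi e0 mul0r.
have size_e : (size e < size phi)%N.
  have := size_poly_gt0 d; rewrite d0 def_phi size_mul //; move: gcd1.
  by case: (size d) => [|[|k]] // _ _; rewrite !addnS ltnS leq_addr.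
case: phi_nonunit; rewrite def_phi.
by apply: w_unitM; apply: phi_min.
Qed.

Lemma mul_rem_surj q r : q != 0 -> (size q < size phi)%N ->
  (size r < size phi)%N ->
  exists2 c : {poly F}, (size c < size phi)%N & (q * c) %% phi = r.
Proof.
move=> q0 size_q size_r.
have /Bezout_eq1_coprimepP[[u w] /= uw] := coprimep_nonunit q0 size_q.
exists ((u * r) %% phi); first by rewrite ltn_modp.
rewrite modp_mul mulrCA mulrA -[in LHS](addrK (w * phi) (u * q)) uw.
by rewrite mulrBl mul1r mulrAC modpD modpN modp_mull subr0 modp_small.
Qed.

Lemma size_mul_div a b : a != 0 -> b != 0 ->
  (size b < size phi)%N -> (size ((a * b) %/ phi)%R < size a)%N.
Proof.
move=> a0 b0 size_b; rewrite size_divp // size_mul //.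
have : (0 < size a)%N by rewrite size_poly_gt0.
have : (0 < size b)%N by rewrite size_poly_gt0.
by move: size_b; move: (size a) (size b) (size phi) => x y z; lia.
Qed.

(* If [q'] were equivalent to [-q], then [-q'] would have the same property and
   smaller degree. *)
Lemma quotient_no_cancel q c : q != 0 ->
  (size q < size phi)%N -> (size c < size phi)%N -> vle (W phi) (W c) ->
  vle (W (q + (q * c) %/ phi)) (W q).
Proof.
move=> + + size_c phi_c.
have [->|c0] := eqVneq c 0; first by rewrite mulr0 div0p addr0 vle_refl.
elim: (size q) {-2}q (leqnn (size q)) => [|n IH] {}q size_qn q0 size_q.
  by move: size_qn; rewrite leqn0 size_poly_eq0 (negbTE q0).
rewrite vleNvlt; apply/negP => lt; pose q' := (q * c) %/ phi.
have sim_q : vsim W q (- q') by rewrite /vsim opprK.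
have Wq' : W q' = W q by rewrite -(vsim_val sim_q) valuationN.
have q'0 : - q' != 0 := vsim_neq0r sim_q.
have size_q' : (size (- q')%R < size q)%N by rewrite size_polyN size_mul_div.
(* Additivity of division shows that [- q'] plus its own quotient is [- D], and [D] has at least the
   value of q + q'. *)
pose D := ((q + q') * c) %/ phi.
have div_q' : (- q' * c) %/ phi = q' - D.
  by rewrite /D mulrDl divpD opprD addNKr mulNr divpN.
have := IH (- q'); rewrite div_q' addKr valuationN vleNvlt => /(_ _ q'0 _)/negP[].
- exact: leq_trans size_q' size_qn.
- exact: ltn_trans size_q.
rewrite valuationN Wq'.
have phiN : W phi != None by rewrite valuation_neqN.
have size_qq' : (size (q + q')%R < size phi)%N.
  apply: leq_ltn_trans (size_polyD _ _) _; rewrite gtn_max size_q /=.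
  by rewrite -size_polyN (ltn_trans size_q').
have D_ge : vle (vadd (W (q + q')) (W phi)) (vadd (W D) (W phi)).
  rewrite -(valuationM _ D); apply: vle_trans (mul_div_le size_qq' size_c).
  by rewrite valuationM; apply: vle_add2l.
apply: vlt_le_trans lt _; rewrite vleNvlt; apply/negP => Dlt.
move: D_ge; rewrite vleNvlt => /negP[].
by rewrite vaddC [X in vlt _ X]vaddC; apply: vlt_add2l.
Qed.

(** Suppose (phi + c) h is equivalent to 1, and let [T] be the last index at which the phi-expansion
    of [h] attains its value. In the expansion of 1 - (phi + c) h, the term of index T + 1 has value
    at most that of phi * h, which is the value of 1. This contradicts the equivalence. *)
Lemma nonunit_shift c : (size c < size phi)%N -> vle (W phi) (W c) ->
  ~ w_unit W (phi + c).
Proof.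
move=> size_c phi_c /w_dividesP[h psi_h].
have phi1 := nonunit_size; have phiN : W phi != None by rewrite valuation_neqN.
have Wpsi : W (phi + c) = W phi.
  apply: vle_anti; last by apply: valuationD_ge; rewrite ?vle_refl.
  by have := expands_lel 1 phi_exp size_c; rewrite mul1r.
have h0 : h != 0 by apply: contraTneq (vsim_neq0r psi_h) => ->; rewrite mulr0 eqxx.
have [|d [size_d d0 def_h]] := @expansion _ phi (size h) h phi1.
  by rewrite leq_pmulr // -subn1 subn_gt0.
set n := size h in d0 def_h.
have h_le i : (i < n)%N -> vle (W h) (W (d i * phi ^+ i)).
  by move=> i_n; rewrite def_h; apply: expands_sum.
have [T [T_n hT T_max]] : exists T, [/\ (T < n)%N, W (d T * phi ^+ T) = W h &
    forall i, (T < i)%N -> vlt (W h) (W (d i * phi ^+ i))].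
  pose P i := (i < n)%N && vle (W (d i * phi ^+ i)) (W h).
  have exP : exists i, P i.
    apply: contrapT => nP; have := vltxx (W h); rewrite {2}def_h.
    rewrite valuation_sum_gt ?valuation_neqN // => i _; rewrite /vlt; apply/negP.
    by move=> le; apply: nP; exists i; rewrite /P ltn_ord.
  have ubP i : P i -> (i <= n)%N by move=> /andP[/ltnW].
  case: (ex_maxnP exP ubP) => T /andP[T_n TW] T_max; exists T; split=> //.
    by apply: vle_anti => //; apply: h_le.
  move=> i Ti; have [n_i|i_n] := leqP n i.
    by rewrite d0 // mul0r valuation0 vltxN valuation_neqN.
  rewrite /vlt; apply/negP => le; have := T_max i; rewrite /P i_n le => /(_ isT).
  by rewrite leqNgt Ti.
(* Multiplying digit i by [c] leaves the remainder at index i and carries the quotient to index i +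
   1, where it meets digit i itself, moved up by the factor [phi]. *)
pose q i := (d i * c) %/ phi; pose r i := (d i * c) %% phi.
pose A k := if k is k'.+1 then d k' + q k' else 0.
pose e k := (k == 0%N)%:R - A k - r k.
have def_e : 1 - (phi + c) * h = \sum_(k < n.+1) e k * phi ^+ k.
  under eq_bigr do rewrite /e !mulrBl; rewrite !big_split /= !sumrN.
  have -> : \sum_(k < n.+1) (k == 0%N :> nat)%:R * phi ^+ k = 1.
    rewrite big_ord_recl expr0 mulr1 big1 ?addr0 // => k _.
    by rewrite mul0r.
  have -> : \sum_(k < n.+1) r k * phi ^+ k = \sum_(k < n) r k * phi ^+ k.
    by rewrite big_ord_recr /= {2}/r d0 // mul0r mod0p mul0r addr0.
  rewrite big_ord_recl /= mul0r add0r -addrA -opprD; congr (1 - _).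
  rewrite {1}def_h mulr_sumr -big_split /=; apply: eq_bigr => i _.
  transitivity (d i * phi * phi ^+ i + d i * c * phi ^+ i); first by ring.
  by rewrite (divp_eq (d i * c) phi) -/(q i) -/(r i) /bump /= add1n exprS; ring.
have size_q i : (size (q i) < size phi)%N.
  rewrite /q; have [->|di0] := eqVneq (d i) 0.
    by rewrite mul0r div0p size_poly0 ltnW.
  have [->|c0] := eqVneq c 0; first by rewrite mulr0 div0p size_poly0 ltnW.
  exact: ltn_trans (size_mul_div di0 c0 size_c) (size_d i).
have size_e k : (size (e k) < size phi)%N.
  have size_D f g : (size f < size phi)%N -> (size g < size phi)%N ->
      (size (f + g)%R < size phi)%N.
    by move=> sf sg; apply: leq_ltn_trans (size_polyD _ _) _; rewrite gtn_max sf.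
  apply: (size_D _ _); last by rewrite size_polyN ltn_modp.
  apply: (size_D _ _); last first.
    rewrite size_polyN /A; case: k => [|k]; last exact: (size_D _ _).
    by rewrite size_poly0 ltnW.
  by case: (k == 0%N); rewrite ?size_poly1 ?size_poly0 // ltnW.
have := psi_h; rewrite /vsim def_e => /vlt_le_trans /(_ (expands_sum phi_exp size_e _)).
move=> /(_ T.+1 T_n); rewrite /e sub0r -opprD mulNr valuationN mulrDl.
have dT0 : d T != 0.
  by apply: contraTneq h0 => dT; rewrite -(valuation_neqN W) -hT dT mul0r valuation0.
(* The carry cannot cancel digit [T], by [quotient_no_cancel]; the remainder from digit T + 1 is too
   small to matter, by the choice of [T]. *)
have AT_le : vle (W (A T.+1 * phi ^+ T.+1)) (vadd (W h) (W phi)).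
  rewrite -hT exprSr mulrA -valuationM ![W (_ * phi)]valuationM.
  rewrite vaddC [X in vle _ X]vaddC; apply: vle_add2l.
  rewrite !valuationM vaddC [X in vle _ X]vaddC; apply: vle_add2l.
  exact: quotient_no_cancel.
have rT_gt : vlt (vadd (W h) (W phi)) (W (r T.+1 * phi ^+ T.+1)).
  apply: (@vlt_le_trans _ (W (d T.+1 * c * phi ^+ T.+1))).
    rewrite mulrAC valuationM; apply: vlt_add => //.
    exact: T_max.
  rewrite !(valuationM _ _ (phi ^+ _)) vaddC [X in vle _ X]vaddC.
  by apply: vle_add2l; apply: mul_mod_le.
rewrite valuationDl; last exact: vle_lt_trans rT_gt.
move=> /vlt_le_trans/(_ AT_le); rewrite (_ : vadd _ _ = W 1) ?vltxx //.
by rewrite -(vsim_val psi_h) valuationM Wpsi vaddC.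
Qed.

(* An improper product [a * b = q * phi + r] would be equivalent to
   [q * (phi + c)] for some [c], whereas [phi + c] is not a unit. *)
Lemma mul_proper a b : a != 0 -> b != 0 ->
  (size a < size phi)%N -> (size b < size phi)%N ->
  vlt (W (a * b)) (W ((a * b) %/ phi * phi)).
Proof.
elim: (size a) {-2}a (leqnn (size a)) b => [|n IH] {}a size_an b a0 b0 size_a size_b.
  by move: size_an; rewrite leqn0 size_poly_eq0 (negbTE a0).
have [Wr] := mul_rem a0 b0 size_a size_b.
move=> /vle_eqVlt[|//] Wq; exfalso; have ab0 := mulf_neq0 a0 b0.
pose q := (a * b) %/ phi; pose r := (a * b) %% phi.
have q0 : q != 0.
  apply: contraNneq ab0 => q0; rewrite -(valuation_eqN W) Wq -/q q0 mul0r.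
  by rewrite valuation0.
have r0 : r != 0 by rewrite -(valuation_neqN W) Wr valuation_neqN.
have size_q : (size q < size a)%N by apply: size_mul_div.
have size_r : (size r < size phi)%N by rewrite ltn_modp.
have size_q' := ltn_trans size_q size_a.
have [c size_c qc] := mul_rem_surj q0 size_q' size_r.
have c0 : c != 0 by apply: contraNneq r0 => c0; rewrite -qc c0 mulr0 mod0p.
have qc_lt := IH q (leq_trans size_q size_an) c q0 c0 size_q' size_c.
have qc_r : vsim W (q * c) r.
  by rewrite /vsim -qc {2}(divp_eq (q * c) phi) addrK.
have Wc : W c = W phi.
  apply: (vaddI (c := W q)); first by rewrite valuation_neqN.
  by rewrite -!valuationM -(vsim_val qc_r) Wr Wq.
apply: (@nonunit_shift c); rewrite ?Wc ?vle_refl //.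
apply: (@w_divides_unit _ _ _ _ (a * b)); last by apply: w_unitM; apply: phi_min.
apply/w_dividesP; exists q; rewrite /vsim {2}(divp_eq (a * b) phi) -/q -/r.
have -> : q * phi + r - (phi + c) * q = r - q * c by ring.
by rewrite -Wr; apply: vsim_sym qc_r.
Qed.

Lemma reduced_inverse c : c != 0 -> (size c < size phi)%N ->
  exists b : {poly F}, [/\ b != 0, (size b < size phi)%N & (c * b) %% phi = 1].
Proof.
move=> c0 size_c; have [|b size_b cb] := mul_rem_surj c0 size_c (r := 1).
  by rewrite size_poly1 nonunit_size.
exists b; split=> //; apply: contra_eqN cb => /eqP->; rewrite mulr0 mod0p.
by rewrite eq_sym oner_eq0.
Qed.

(** Multiplied by an inverse modulo [phi] of its leading digit, and with all digits reduced modulo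
    [phi], the polynomial [g] becomes an equivalent [gs] with leading digit 1. As [g] divides [gs],
    its degree is at most n * m, where n is the quotient of deg g by m. *)
Lemma key_degree g : key_polynomial W g -> (1 < size g)%N ->
  exists s, (size g).-1 = (s * (size phi).-1)%N.
Proof.
move=> [_ _ g_min] g1; have phi1 := nonunit_size.
have m0 : (0 < (size phi).-1)%N by rewrite -subn1 subn_gt0.
set m := (size phi).-1 in m0 *; have size_phi : size phi = m.+1 by rewrite prednK // ltnW.
set D := (size g).-1; have size_g : size g = D.+1 by rewrite prednK // ltnW.
have g0 : g != 0 by rewrite -size_poly_gt0 size_g.
pose n := (D %/ m)%N; exists n.
have size_phiX i : size (phi ^+ i) = (i * m).+1.
  by rewrite -[LHS]prednK ?size_exp ?size_phi 1?mulnC // size_poly_gt0 expf_neq0.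
have phin0 : phi ^+ n != 0 by rewrite expf_neq0.
pose c := g %/ phi ^+ n; pose g1' := g %% phi ^+ n.
have size_c : size c = (D %% m).+1.
  rewrite size_divp // size_g size_phiX /= subSn ?leq_trunc_div //.
  by rewrite {1}(divn_eq D m) addKn.
have size_cphi : (size c < size phi)%N by rewrite size_c size_phi ltnS ltn_pmod.
have c0 : c != 0 by rewrite -size_poly_gt0 size_c.
have [|d [size_d d0 def_g1]] := @expansion _ phi n g1' phi1.
  by rewrite -ltnS -size_phiX ltn_modp.
have [b [b0 size_b cb]] := reduced_inverse c0 size_cphi.
pose d' i := if i == n then c else d i.
have size_d' i : (size (d' i) < size phi)%N by rewrite /d'; case: eqP.
have def_g : g = \sum_(i < n.+1) d' i * phi ^+ i.
  rewrite big_ord_recr /= /d' eqxx {1}(divp_eq g (phi ^+ n)) -/c -/g1' addrC.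
  rewrite {1}def_g1; congr (_ + _); apply: eq_bigr => i _.
  by rewrite ltn_eqF.
pose gs := \sum_(i < n.+1) (d' i * b) %% phi * phi ^+ i.
(* In each digit, reduction discards a multiple of [phi] of strictly larger value, by
   [mul_proper]. *)
have sim_g : vsim W (g * b) gs.
  rewrite /vsim def_g mulr_suml -sumrB; apply: valuation_sum_gt.
    by rewrite -mulr_suml -def_g valuation_neqN mulf_neq0.
  move=> i _; rewrite mulrAC -mulrBl.
  rewrite -mulr_suml -def_g.
  have -> : d' i * b - (d' i * b) %% phi = (d' i * b) %/ phi * phi.
    by rewrite {1}(divp_eq (d' i * b) phi) addrK.
  have [->|di0] := eqVneq (d' i) 0.
    by rewrite mul0r div0p !mul0r valuation0 vltxN valuation_neqN mulf_neq0.
  apply: (@vle_lt_trans _ (W (d' i * b * phi ^+ i))).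
    rewrite mulrAC !(valuationM _ _ b) vaddC [X in vle _ X]vaddC.
    by apply: vle_add2l; rewrite {1}def_g; apply: expands_sum.
  rewrite ![_ * phi ^+ i]mulrC; apply: valuationM_lt; first exact: expf_neq0.
  exact: mul_proper.
have size_gs : (size gs <= (n * m).+1)%N.
  rewrite /gs big_ord_recr /= {2}/d' eqxx cb mul1r.
  apply: leq_trans (size_polyD _ _) _; rewrite geq_max size_phiX leqnn andbT.
  apply: leq_trans (size_sum _ _ _) _; apply/bigmax_leqP => i _.
  apply: leq_trans (size_polyMleq _ _) _; rewrite size_phiX addnS /=.
  have size_r : (size ((d' i * b) %% phi)%R <= m)%N.
    by rewrite -ltnS -size_phi ltn_modp.
  apply: leq_trans (leq_add size_r (leqnn _)) _.
  rewrite -mulSn; apply: leq_trans (leqnSn _).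
  by rewrite leq_mul2r ltn_ord orbT.
have : w_divides W g gs by apply/w_dividesP; exists b; apply: vsim_sym.
move=> /(g_min _ (vsim_neq0r sim_g)); rewrite size_g => /leq_trans/(_ size_gs).
by rewrite ltnS => Dn; apply/eqP; rewrite eqn_leq Dn leq_trunc_div.
Qed.

End MinimalNonunit.

(** * Graded bases *)

Section GradedBasis.
Variables (F : fieldType) (G : oagType) (W : valuation {poly F} G).
Implicit Types a b c f g h q r : {poly F}.

Definition graded_independent (I : finType) (e : I -> {poly F}) : Prop :=
  (forall i, e i != 0) /\
  (forall (c : I -> F) j, vle (W (\sum_i c i *: e i)) (W (c j *: e j))).

(* The initial forms of [e] are a basis, over the graded ring of [F], of the
   graded module of the polynomials of degree less than [n]. *)
Definition graded_basis n (I : finType) (e : I -> {poly F}) : Prop :=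
  [/\ graded_independent e, forall i, (size (e i) <= n)%N &
    forall a, a != 0 -> (size a <= n)%N ->
      exists c : I -> F, vsim W a (\sum_i c i *: e i)].

(** More than [n] polynomials satisfy a linear relation, whose sum has infinite value. *)
Lemma graded_independent_card n (I : finType) (e : I -> {poly F}) :
  graded_independent e -> (forall i, (size (e i) <= n)%N) -> (#|I| <= n)%N.
Proof.
move=> [e0 e_ind] size_e; rewrite leqNgt; apply/negP => n_I.
pose A := \matrix_(i < #|I|) (poly_rV (e (enum_val i)) : 'rV[F]_n).
have [u u0 uA] : exists2 u : 'rV_#|I|, u != 0 & u *m A = 0.
  have kerA : kermx A != 0.
    rewrite -mxrank_eq0 mxrank_ker subn_eq0 -ltnNge.
    exact: leq_ltn_trans (rank_leq_col A) n_I.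
  have [i ki] : exists i, row i (kermx A) != 0.
    by apply/existsP; apply: contraNT kerA => /existsPn H; apply/eqP/row_matrixP => i;
      rewrite row0; apply/eqP; rewrite -[_ == _]negbK H.
  by exists (row i (kermx A)); rewrite // -row_mul mulmx_ker row0.
have [j uj] : exists j, u 0 j != 0 by apply/rV0Pn.
have sum0 : \sum_i u 0 (enum_rank i) *: e i = 0.
  apply: (@etrans _ _ (rVpoly (u *m A))); last by rewrite uA linear0.
  rewrite mulmx_sum_row linear_sum /= (reindex_onto enum_val enum_rank) /=; last first.
    by move=> i _; rewrite enum_rankK.
  apply: eq_big => [i|i _]; first by rewrite enum_valK eqxx.
  by rewrite linearZ /= rowK poly_rV_K // enum_valK.
have := e_ind (fun i => u 0 (enum_rank i)) (enum_val j).
rewrite /= sum0 valuation0 enum_valK vleNvlt vltxN valuation_neqN.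
by rewrite scaler_eq0 negb_or uj e0.
Qed.

Lemma valuationZ (x : F) a : W (x *: a) = vadd (W x%:P) (W a).
Proof. by rewrite -mul_polyC valuationM. Qed.

Lemma graded_independent_option (I : finType) (e : I -> {poly F}) a :
  graded_independent e -> a != 0 ->
  (forall c : I -> F, ~ vsim W a (\sum_i c i *: e i)) ->
  graded_independent (fun o : option I => if o is Some i then e i else a).
Proof.
move=> [e0 e_ind] a0 a_new; split=> [[i|]//|c].
pose s := \sum_i c (Some i) *: e i; set t := \sum_o _.
have def_t : t = c None *: a + s.
  rewrite /t (bigD1 None) //=; congr (_ + _).
  rewrite (reindex_omap Some id) /=; last by case.
  by apply: eq_bigl => i; rewrite eqxx.
have t_a : vle (W t) (W (c None *: a)).
  rewrite def_t; have [->|c0] := eqVneq (c None) 0.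
    by rewrite scale0r valuation0 vleN.
  rewrite vleNvlt; apply/negP => lt.
  apply: (a_new (fun i => - (c None)^-1 * c (Some i))).
  have -> : \sum_i (- (c None)^-1 * c (Some i)) *: e i = - (c None)^-1 *: s.
    by rewrite scaler_sumr; apply: eq_bigr => i _; rewrite scalerA.
  apply: (@vsimMIl _ _ _ (c None)%:P).
  rewrite !mul_polyC scalerA mulrN mulfV // scaleN1r /vsim opprK.
  exact: lt.
have t_s : vle (W t) (W s).
  rewrite vleNvlt; apply/negP => lt; move: t_a; rewrite vleNvlt => /negP[].
  rewrite -[c None *: a](addrK s) -def_t addrC valuationDl valuationN //.
case=> [i|//]; apply: (vle_trans t_s).
exact: (e_ind (fun i => c (Some i))).
Qed.

(** An independent family of maximal size spans, since a polynomial that it fails to approximate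
    could be added to it. *)
Lemma graded_basis_exists n :
  exists (I : finType) (e : I -> {poly F}), graded_basis n e.
Proof.
pose P N := `[< exists (I : finType) (e : I -> {poly F}), [/\ #|I| = N,
  graded_independent e & forall i, (size (e i) <= n)%N] >].
have exP : exists N, P N.
  exists 0%N; apply/asboolP; exists void, (fun=> 0).
  by split; [exact: card_void | split=> [[]|c []] | case].
have ubP N : P N -> (N <= n)%N.
  by move=> /asboolP[I [e [<- e_ind size_e]]]; apply: graded_independent_card size_e.
case: (ex_maxnP exP ubP) => N /asboolP[I [e [card_I e_ind size_e]]] N_max.
exists I, e; split=> // a a0 size_a; apply: contrapT => na.
have := N_max N.+1; rewrite ltnn => /(_ _)/notF[].
apply/asboolP; exists (option I), (fun o => if o is Some i then e i else a).
split; [by rewrite card_option card_I | | by case].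
by apply: graded_independent_option => // c ac; apply: na; exists c.
Qed.

Lemma graded_basis_add f k (I J : finType) (e : I -> {poly F}) (e' : J -> {poly F}) :
  (0 < size f)%N -> expands W f -> graded_basis (size f).-1 e -> graded_basis k e' ->
  graded_basis ((size f).-1 + k)
    (fun x : I + J => match x with inl i => e i | inr j => e' j * f end).
Proof.
move=> f_gt0 fe [[e0 e_ind] size_e e_span] [[e0' e_ind'] size_e' e_span'].
have f0 : f != 0 by rewrite -size_poly_gt0.
have split_sum (c : I + J -> F) : \sum_x c x *: match x with inl i => e i | inr j => e' j * f end
    = (\sum_j c (inr j) *: e' j) * f + \sum_i c (inl i) *: e i.
  rewrite big_sumType addrC mulr_suml; congr (_ + _).
  by apply: eq_bigr => j _; rewrite scalerAl.
have size_sum_e (c : I -> F) : (size (\sum_i c i *: e i)%R < size f)%N.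
  rewrite -[size f]prednK // ltnS; apply: leq_trans (size_sum _ _ _) _.
  by apply/bigmax_leqP => i _; apply: leq_trans (size_scale_leq _ _) (size_e i).
split.
- split=> [[i|j]|c [i|j]]; rewrite ?mulf_neq0 ?split_sum //.
    apply: vle_trans (expands_ler _ fe (size_sum_e _)) _.
    exact: (e_ind (fun i => c (inl i))).
  apply: vle_trans (expands_lel _ fe (size_sum_e _)) _.
  rewrite scalerAl !(valuationM _ _ f) vaddC [X in vle _ X]vaddC; apply: vle_add2l.
  exact: (e_ind' (fun i => c (inr i))).
- case=> [i|j]; first by apply: leq_trans (size_e i) (leq_addr _ _).
  rewrite size_mul //; have := size_e' j; move: f_gt0.
  by move: (size (e' j)) (size f) => x y; lia.
- move=> a a0 size_a; pose q := a %/ f; pose r := a %% f.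
  have size_r : (size r < size f)%N by rewrite ltn_modp.
  have size_q : (size q <= k)%N by rewrite size_divp // leq_subLR.
  (* Neither term of the division has value below [W a], so approximating quotient and remainder
     separately leaves errors of value above [W a]. *)
  have [cq q_lt] : exists c : J -> F, vlt (W a) (W ((q - \sum_j c j *: e' j) * f)).
    have a_q : vle (W a) (W (q * f)) by rewrite {1}(divp_eq a f) expands_lel.
    have [->|q0] := eqVneq q 0.
      exists (fun=> 0); rewrite big1 => [|j _]; last by rewrite scale0r.
      by rewrite subrr mul0r valuation0 vltxN valuation_neqN.
    have [c qc] := e_span' q q0 size_q; exists c.
    by apply: vle_lt_trans a_q _; rewrite ![_ * f]mulrC valuationM_lt.
  have [cr r_lt] : exists c : I -> F, vlt (W a) (W (r - \sum_i c i *: e i)).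
    have a_r : vle (W a) (W r) by rewrite {1}(divp_eq a f) expands_ler.
    have [->|r0] := eqVneq r 0.
      exists (fun=> 0); rewrite big1 => [|j _]; last by rewrite scale0r.
      by rewrite subrr valuation0 vltxN valuation_neqN.
    have [|c rc] := e_span r r0; first by rewrite -ltnS prednK.
    by exists c; apply: vle_lt_trans a_r _.
  exists (fun x => match x with inl i => cr i | inr j => cq j end).
  rewrite split_sum /vsim {2}(divp_eq a f) opprD addrACA -mulrBl.
  exact: valuationD_gt.
Qed.

Lemma graded_basis_mul f s (I : finType) (e : I -> {poly F}) :
  (0 < size f)%N -> expands W f -> graded_basis (size f).-1 e ->
  exists (J : finType) (e' : J -> {poly F}),
    #|J| = (s * #|I|)%N /\ graded_basis (s * (size f).-1) e'.
Proof.
move=> f_gt0 fe fb; elim: s => [|s [J [e' [card_J e'b]]]].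
  exists void, (fun=> 0); split; first by rewrite card_void.
  split=> [|[]|a a0]; first by split=> [[]|c []].
  by rewrite leqn0 size_poly_eq0 (negbTE a0).
exists (I + J)%type, (fun x => match x with inl i => e i | inr j => e' j * f end).
split; first by rewrite card_sum card_J.
exact: graded_basis_add.
Qed.

Lemma key_nonunit g : key_polynomial W g -> (1 < size g)%N -> ~ w_unit W g.
Proof.
move=> [_ _ g_min] g1 /(g_min _ (oner_neq0 _)).
by rewrite size_poly1 leqNgt g1.
Qed.

(** Here [m] is the degree of the minimal nonunit and [N] the size of a graded basis below it, so
    both are chosen before [g]. *)
Lemma key_graded_basis f : key_polynomial W f -> (1 < size f)%N ->
  exists m N, [/\ (0 < m)%N, (0 < N)%N & forall g, key_polynomial W g -> (1 < size g)%N ->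
    exists s (I : finType) (e : I -> {poly F}),
      [/\ (size g).-1 = (s * m)%N, #|I| = (s * N)%N & graded_basis (size g).-1 e]].
Proof.
move=> fk f1; have f0 : f != 0 by rewrite -size_poly_gt0 ltnW.
have [phi [phi_m phi_n phi_min]] := minimal_nonunit_exists f0 (key_nonunit fk f1).
have phi1 := nonunit_size phi_m phi_n.
have [I [e eb]] := graded_basis_exists (size phi).-1.
have m0 : (0 < (size phi).-1)%N by rewrite -subn1 subn_gt0.
exists (size phi).-1, #|I|; split=> //.
  rewrite lt0n; apply/eqP => /card0_eq I0; case: eb => _ _ e_span.
  have [|c] := e_span 1 (oner_neq0 _); first by rewrite size_poly1.
  rewrite big1 => [|i]; last by have := I0 i.
  by move=> /vsim_neq0r/eqP.
move=> g gk g1; have [s size_g] := key_degree phi_m phi_n phi_min gk g1.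
have [J [e' [card_J e'b]]] :=
  graded_basis_mul s (ltnW phi1) (nonunit_expands phi_n phi_min) eb.
by exists s, J, e'; rewrite size_g.
Qed.

End GradedBasis.

(** * Ramification index and residue degree *)

Section Dimension.
Variables (E : fieldType) (S : set E).
Hypothesis Sf : is_subfield S.

Lemma lin_basis_le A n n' (b : 'I_n -> E) (b' : 'I_n' -> E) :
  is_lin_basis A S b -> is_lin_basis A S b' -> (n <= n')%N.
Proof.
move=> [bA b_span b_ind] [b'A b'_span b'_ind].
have ex i : exists c : 'I_n' -> E, (forall j, S (c j)) /\ b i = \sum_j c j * b' j.
  by have [c cS bi] := b'_span _ (bA i); exists c.
have ex' j : exists c : 'I_n -> E, (forall i, S (c i)) /\ b' j = \sum_i c i * b i.
  by have [c cS bj] := b_span _ (b'A j); exists c.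
have [C CP] := choice ex; have [C' C'P] := choice ex'.
pose M : 'M_(n, n') := \matrix_(i, j) C i j; pose M' : 'M_(n', n) := \matrix_(j, i) C' j i.
apply: (@mulmx1_min _ _ _ M M'); apply/matrixP => i k; rewrite !mxE.
apply/eqP; rewrite -subr_eq0; apply/eqP; move: k.
apply: (b_ind (fun k => \sum_j M i j * M' j k - (i == k)%:R)) => [k|].
  apply: (subfieldB Sf).
    apply: (subfield_sum Sf) => j _; rewrite !mxE; apply: (subfieldM Sf).
      by case: (CP i).
    by case: (C'P j).
  by case: (i == k); [apply: subfield1 | apply: subfield0].
under eq_bigr do rewrite mulrBl; rewrite sumrB.
have -> : \sum_k (i == k)%:R * b k = b i.
  rewrite (bigD1 i) //= eqxx mul1r big1 ?addr0 // => k.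
  by rewrite eq_sym => /negbTE->; rewrite mul0r.
apply/eqP; rewrite subr_eq0; apply/eqP; rewrite [RHS](CP i).2.
under eq_bigr do rewrite mulr_suml; rewrite exchange_big /=.
apply: eq_bigr => j _; rewrite (C'P j).2 mulr_sumr.
by apply: eq_bigr => k _; rewrite !mxE mulrA.
Qed.

(** [ext_degree] selects some size of a basis, so it is determined only because all bases have equal
    size. *)
Lemma ext_degreeE A n (b : 'I_n -> E) : is_lin_basis A S b -> ext_degree A S = n.
Proof.
move=> bb; apply: xget_unique; first by exists b.
by move=> n' [b' bb']; apply/eqP; rewrite eqn_leq !(lin_basis_le bb bb', lin_basis_le bb' bb).
Qed.

End Dimension.

Lemma subgroup_indexE (G : zmodType) (A B : set G) n (r : 'I_n -> G) :
  B 0 -> (forall a b, B a -> B b -> B (a - b)) -> (forall i, A (r i)) ->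
  (forall a, A a -> exists! i, B (a - r i)) -> subgroup_index A B = n.
Proof.
move=> B0 BB; have le m m' (s : 'I_m -> G) (s' : 'I_m' -> G) : (forall i, A (s i)) ->
    (forall a, A a -> exists! i, B (a - s i)) -> (forall i, A (s' i)) ->
    (forall a, A a -> exists! i, B (a - s' i)) -> (m <= m')%N.
  move=> As s_uniq As' s'_uniq.
  have ex i : exists j, B (s i - s' j) by have [j []] := s'_uniq _ (As i); exists j.
  have [f fP] := choice ex; rewrite -[m]card_ord -[m']card_ord.
  apply: (@leq_card _ _ f) => i j fij; have [k [_ k_uniq]] := s_uniq _ (As i).
  rewrite -(k_uniq i) ?subrr // -(k_uniq j) //.
  have := BB _ _ (fP i) (fP j); rewrite fij.
  by rewrite opprB addrA subrK.
move=> Ar r_uniq; apply: xget_unique; first by exists r.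
by move=> m [s [As s_uniq]]; apply/eqP; rewrite eqn_leq !(le _ _ r s, le _ _ s r).
Qed.

Section Residues.
Variables (E : fieldType) (G : oagType) (v : valuation E G).
Implicit Types x y : E.

Lemma residue_val x (x0 : x \in vring_pred v) : residue v x = \pi_(residue_field v)%qT (VRing x0).
Proof. by rewrite /residue; congr (\pi_(_)%qT _); apply: val_inj; rewrite insubdK. Qed.

Lemma residueD x y : vle (Some 0) (v x) -> vle (Some 0) (v y) ->
  residue v (x + y) = residue v x + residue v y.
Proof.
move=> x0 y0; have xy0 : vle (Some 0) (v (x + y)) by apply: valuationD_ge.
rewrite (residue_val x0) (residue_val y0) (residue_val xy0) -rmorphD.
by congr (\pi_(_)%qT _); apply: val_inj.
Qed.

Lemma residueM x y : vle (Some 0) (v x) -> vle (Some 0) (v y) ->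
  residue v (x * y) = residue v x * residue v y.
Proof.
move=> x0 y0; have xy0 : vle (Some 0) (v (x * y)) by rewrite valuationM vadd_ge0.
rewrite (residue_val x0) (residue_val y0) (residue_val xy0) -rmorphM.
by congr (\pi_(_)%qT _); apply: val_inj.
Qed.

Lemma residue_eq0P x : vle (Some 0) (v x) -> residue v x = 0 <-> vlt (Some 0) (v x).
Proof.
move=> x0; rewrite (residue_val x0).
split=> [/eqP|x_gt0]; last apply/eqP; by rewrite residue_eq0.
Qed.

Lemma residue0 : residue v 0 = 0.
Proof. by apply/residue_eq0P; rewrite valuation0. Qed.

Lemma residue1 : residue v 1 = 1.
Proof.
have x1 : (1 : E) \in vring_pred v by rewrite unfold_in valuation1 vle_refl.
by rewrite (residue_val x1) -[RHS](rmorph1 (\pi_(residue_field v)%qT)); congr (\pi_(_)%qT _); apply: val_inj.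
Qed.

Lemma residueN x : vle (Some 0) (v x) -> residue v (- x) = - residue v x.
Proof.
move=> x0; apply/eqP; rewrite -addr_eq0 -residueD ?valuationN //.
by rewrite addNr residue0.
Qed.

Lemma residueB x y : vle (Some 0) (v x) -> vle (Some 0) (v y) ->
  residue v (x - y) = residue v x - residue v y.
Proof. by move=> x0 y0; rewrite residueD ?valuationN // residueN. Qed.

Lemma residue_sum (I : Type) (s : seq I) (P : pred I) (f : I -> E) :
  (forall i, P i -> vle (Some 0) (v (f i))) ->
  residue v (\sum_(i <- s | P i) f i) = \sum_(i <- s | P i) residue v (f i).
Proof.
move=> f0; elim: s => [|i s IH]; first by rewrite !big_nil residue0.
rewrite !big_cons; case: ifP => // Pi; rewrite residueD ?IH ?f0 //.
exact: valuation_sum_ge.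
Qed.

Lemma residueV x : v x = Some 0 -> residue v x^-1 = (residue v x)^-1.
Proof.
move=> vx; have x0 : x != 0 by rewrite -(valuation_neqN v) vx.
have vVx : v x^-1 = Some 0.
  have := valuationM v x x^-1; rewrite mulfV // valuation1 vx.
  by rewrite vadd0 => <-.
have rx0 : residue v x != 0.
  by apply/eqP => /residue_eq0P; rewrite vx vle_refl vltxx => /(_ isT).
apply: (mulfI rx0); rewrite mulfV // -residueM ?vx ?vVx ?vle_refl //.
by rewrite mulfV // residue1.
Qed.

Lemma residue_subfield_subfield S : is_subfield S -> is_subfield (residue_subfield v S).
Proof.
move=> Sf; split.
- exists 1; last exact: residue1.
  by split; [exact: subfield1 | rewrite valuation1 vle_refl].
- move=> _ _ [x [Sx x0] <-] [y [Sy y0] <-]; exists (x - y); last by rewrite residueB.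
  by split; [exact: subfieldB | exact: valuationB_ge].
- move=> _ _ [x [Sx x0] <-] [y [Sy y0] <-].
  have [/esym vy|y_gt0] := vle_eqVlt y0; last first.
    exists 0; first by split; [exact: subfield0 | rewrite valuation0 vleN].
    by rewrite (residue_eq0P y0).2 // invr0 mulr0 residue0.
  have vVy : v y^-1 = Some 0.
    have ynz : y != 0 by rewrite -(valuation_neqN v) vy.
    have := valuationM v y y^-1; rewrite mulfV // valuation1 vy.
    by rewrite vadd0 => <-.
  exists (x / y); last by rewrite residueM ?vVy ?vle_refl // residueV.
  by split; [exact: subfield_div | rewrite valuationM vVy vaddr0].
Qed.

End Residues.

(** * The product of ramification index and residue degree as the size of a graded basis *)

Section GradedDegree.
Variables (E : fieldType) (G : oagType) (v : valuation E G).
Variables (S L : set E).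
Hypotheses (Sf : is_subfield S) (Lf : is_subfield L) (SL : S `<=` L).
Variables (I : finType) (e : I -> E).
Hypotheses (e_L : forall i, L (e i)) (e_neq0 : forall i, e i != 0).
Hypothesis e_ind : forall c : I -> E, (forall i, S (c i)) ->
  forall j, vle (v (\sum_i c i * e i)) (v (c j * e j)).
Hypothesis e_span : forall a, L a -> a != 0 ->
  exists c : I -> E, (forall i, S (c i)) /\ vsim v a (\sum_i c i * e i).

Local Notation VS := (value_group v S).

Lemma value_group0 : VS 0.
Proof. by exists 1; [exact: subfield1 | rewrite valuation1]. Qed.

Lemma valuationV x g : v x = Some g -> v x^-1 = Some (- g).
Proof.
move=> vx; have x0 : x != 0 by rewrite -(valuation_neqN v) vx.
have [h vVx] := valuation_Some v (invr_neq0 x0).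
have := valuationM v x x^-1; rewrite mulfV // valuation1 vx vVx /= => -[gh].
by congr Some; apply/eqP; rewrite -addr_eq0 addrC -gh.
Qed.

Lemma value_groupB g h : VS g -> VS h -> VS (g - h).
Proof.
move=> [x Sx vx] [y Sy vy]; exists (x / y); first exact: subfield_div.
by rewrite valuationM vx (valuationV vy).
Qed.

Lemma value_groupD g h : VS g -> VS h -> VS (g + h).
Proof.
move=> Vg Vh; rewrite -[h]opprK -[- h]sub0r; apply: value_groupB => //.
by apply: value_groupB => //; apply: value_group0.
Qed.

Let gamma_ex i : exists g, v (e i) = Some g := valuation_Some v (e_neq0 i).
Let gamma i := projT1 (cid (gamma_ex i)).
Let v_e i : v (e i) = Some (gamma i). Proof. exact: projT2 (cid (gamma_ex i)). Qed.

Let same_class i j := `[< VS (gamma i - gamma j) >].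

Let same_class_sym i j : same_class i j -> same_class j i.
Proof.
move=> /asboolP ij; apply/asboolP.
by have := value_groupB value_group0 ij; rewrite sub0r opprB.
Qed.

Let same_class_trans j i k : same_class i j -> same_class j k -> same_class i k.
Proof.
move=> /asboolP ij /same_class_sym/asboolP kj; apply/asboolP.
by have := value_groupB ij kj; rewrite opprB addrA subrK.
Qed.

(** A canonical representative: equivalent indices define the same predicate, on which [pick] makes
    the same choice. *)
Let class i := odflt i [pick j | same_class i j].

Let classP i : same_class i (class i).
Proof.
rewrite /class; case: pickP => //= _; apply/asboolP.
by rewrite subrr; apply: value_group0.
Qed.

Let class_eq i j : (class i == class j) = same_class i j.
Proof.
apply/eqP/idP => [ij|ij].
  by apply: same_class_trans (classP i) _; rewrite ij; apply/same_class_sym/classP.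
rewrite /class (eq_pick (Q := same_class j)) => [|k].
  by case: pickP => // /(_ i); rewrite same_class_sym.
by apply/idP/idP; apply: same_class_trans => //; apply: same_class_sym.
Qed.

Let reps : {set I} := finset (fun i => class i == i).
Let class_of t : {set I} := finset (fun i => class i == t).

(** The value of an element of [L] is attained by some term [c j * e j] of its approximation, so it
    is congruent to the value of a basis element. *)
Lemma graded_index : subgroup_index (value_group v L) VS = #|reps|.
Proof.
apply: (@subgroup_indexE _ _ _ _ (fun k : 'I_#|reps| => gamma (enum_val k))).
- exact: value_group0.
- exact: value_groupB.
- by move=> k; exists (e (enum_val k)).
move=> ga [a La va].
have a0 : a != 0 by rewrite -(valuation_neqN v) va.
have [c [cS ac]] := e_span La a0.
have [j vj] : exists j, v (c j * e j) = v a.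
  apply: contrapT => nj; have := vltxx (v a); rewrite -{2}(vsim_val ac).
  rewrite valuation_sum_gt ?va // => j _; rewrite -va.
  have := e_ind cS j; rewrite (vsim_val ac) => /vle_eqVlt[aj|//].
  by case: nj; exists j.
have cj0 : c j != 0.
  by apply: contraTneq a0 => cj0; rewrite -(valuation_neqN v) -vj cj0 mul0r valuation0.
have [d vc] := valuation_Some v cj0.
move: vj; rewrite valuationM vc v_e va /= => -[<-].
have rj : class j \in reps by rewrite inE class_eq; apply/same_class_sym/classP.
exists (enum_rank_in rj (class j)); split.
  rewrite enum_rankK_in // -addrA; apply: value_groupD; first by exists (c j).
  exact/asboolP/classP.
move=> k Vk; apply: enum_val_inj; rewrite enum_rankK_in //.
have := enum_valP k; rewrite inE => /eqP <-; apply/esym/eqP; rewrite eq_sym class_eq.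
apply/asboolP; have Vd : VS d by exists (c j).
have := value_groupB Vk Vd.
by rewrite addrAC [d + _]addrC addrK.
Qed.

Lemma graded_residue_degree t : t \in reps ->
  ext_degree (residue_subfield v L) (residue_subfield v S) = #|class_of t|.
Proof.
move=> t_rep; have t_in : t \in class_of t by move: t_rep; rewrite !inE.
(* Factors from [S] bring the members of the class to the value of [e t]; the residues of
   [d i * e i / e t] will be the basis. Outside the class, 0 is a default. *)
have ex_d i : exists d, i \in class_of t -> S d /\ v (d * e i) = v (e t).
  case: (boolP (i \in class_of t)) => [|_]; last by exists 0.
  rewrite inE => /eqP it; have /asboolP[d Sd vd] : same_class t i.
    by rewrite -class_eq it; move: t_rep; rewrite inE => /eqP->.
  by exists d => _; split=> //; rewrite valuationM vd !v_e /= subrK.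
have [d dP] := choice ex_d.
have et0 : e t != 0 := e_neq0 t.
have vVe : v (e t)^-1 = Some (- gamma t) := valuationV (v_e t).
pose x i := d i * e i / e t.
have vx i : i \in class_of t -> v (x i) = Some 0.
  by move=> /dP[_ vd]; rewrite /x valuationM vd vVe v_e /= subrr.
have d0 i : i \in class_of t -> d i != 0.
  move=> it; apply: contra_eqN (vx i it) => /eqP di0.
  by rewrite /x di0 !mul0r valuation0.
pose n := #|class_of t|; pose ev : 'I_n -> I := enum_val.
have ev_in k : ev k \in class_of t by apply: enum_valP.
have Rf := residue_subfield_subfield v Sf.
apply: (@ext_degreeE _ _ Rf _ _ (fun k : 'I_n => residue v (x (ev k)))); split.
- move=> k; exists (x (ev k)) => //; split; last by rewrite vx ?vle_refl.
  apply: (subfield_div Lf) => //; apply: (subfieldM Lf) => //.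
  by apply: SL; case: (dP _ (ev_in k)).
- move=> _ [a [La a_ge0] <-]; have [/esym va|a_gt0] := vle_eqVlt a_ge0; last first.
    exists (fun=> 0); first by move=> _; apply: (subfield0 Rf).
    by rewrite (residue_eq0P a_ge0).2 // big1 // => k _; rewrite mul0r.
  have a0 : a != 0 by rewrite -(valuation_neqN v) va.
  have vaet : v (a * e t) = v (e t) by rewrite valuationM va vadd0.
  have [c [cS ac]] := e_span (subfieldM Lf La (e_L t)) (mulf_neq0 a0 et0).
  have c_ge i : vle (v (e t)) (v (c i * e i)).
    by rewrite -vaet -(vsim_val ac); apply: e_ind.
  (* A term from another class cannot have the value of [e t], so it contributes nothing to the
     residue. *)
  have c_gt i : i \notin class_of t -> vlt (v (e t)) (v (c i * e i)).
    move=> nit; have [eq|//] := vle_eqVlt (c_ge i).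
    case/negP: nit; rewrite inE.
    have -> : t = class t by move: t_rep; rewrite inE => /eqP.
    rewrite class_eq; apply/asboolP.
    have ci0 : c i != 0.
      by apply: contra_eqN eq => /eqP->; rewrite mul0r valuation0 v_e.
    have [g vc] := valuation_Some v ci0; have Vg : VS g by exists (c i).
    move: eq; rewrite valuationM vc !v_e /= => -[->].
    have := value_groupB value_group0 Vg; congr (VS _).
    by rewrite sub0r opprD addrCA subrr addr0.
  pose y i := c i / d i.
  have y_ge0 i : i \in class_of t -> vle (Some 0) (v (y i)).
    move=> it; rewrite vleNvlt; apply/negP => lt; have := c_ge i.
    rewrite vleNvlt -[v (e t)](proj2 (dP i it)) => /negP[].
    rewrite -[c i](divfK (d0 i it)) -/(y i) -mulrA valuationM.
    rewrite -[X in vlt _ X]vadd0; apply: vlt_add => //; last exact: vle_refl.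
    by rewrite (dP i it).2 v_e.
  exists (fun k => residue v (y (ev k))).
    move=> k; exists (y (ev k)) => //; split; last exact: y_ge0.
    by apply: (subfield_div Sf) => //; case: (dP _ (ev_in k)).
  have yx_ge0 i : i \in class_of t -> vle (Some 0) (v (y i * x i)).
    by move=> it; rewrite valuationM vx // vaddr0 y_ge0.
  have -> : \sum_k residue v (y (ev k)) * residue v (x (ev k)) =
      residue v (\sum_(i in class_of t) y i * x i).
    rewrite residue_sum // [RHS]big_enum_val /=; apply: eq_bigr => k _.
    by rewrite residueM ?y_ge0 ?vx ?vle_refl.
  apply/eqP; rewrite -subr_eq0 -residueB //; last first.
    by apply: valuation_sum_ge.
  apply/eqP/residue_eq0P.
    by apply: valuationB_ge => //; apply: valuation_sum_ge.
  suff : vlt (v (e t)) (v ((a - \sum_(i in class_of t) y i * x i) * e t)).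
    rewrite valuationM => lt; rewrite /vlt; apply/negP => le.
    move: lt; rewrite /vlt => /negP[]; rewrite -[X in vle _ X]vadd0.
    by apply: vle_add => //; apply: vle_refl.
  have -> : (a - \sum_(i in class_of t) y i * x i) * e t =
      (a * e t - \sum_i c i * e i) + \sum_(i | i \notin class_of t) c i * e i.
    rewrite [\sum_i _](bigID (mem (class_of t))) /= opprD addrA subrK mulrBl.
    congr (_ - _); rewrite mulr_suml; apply: eq_bigr => i it.
    by rewrite /x /y mulrA divfK // mulrA divfK // d0.
  apply: valuationD_gt; first by rewrite -{1}vaet.
  by apply: valuation_sum_gt => //; rewrite v_e.
- move=> c c_res sum0 k.
  have ex_s k' : exists s, [/\ S s, vle (Some 0) (v s) & residue v s = c k'].
    by have [s [Ss s0] rs] := c_res k'; exists s.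
  have [s sP] := choice ex_s.
  have [Ssk sk0 <-] := sP k; apply/(residue_eq0P sk0).
  (* A relation between residues lifts to a combination of value above that of [e t]. By [e_ind]
     each of its terms has such a value, so every lifted coefficient has positive value. *)
  pose c' i := if i \in class_of t then s (enum_rank_in t_in i) * d i else 0.
  have c'S i : S (c' i).
    rewrite /c'; case: ifP => [it|_]; last exact: (subfield0 Sf).
    by apply: (subfieldM Sf); [case: (sP (enum_rank_in t_in i)) | case: (dP i it)].
  have c'E k' : c' (ev k') = s k' * d (ev k').
    by rewrite /c' ev_in enum_valK_in.
  have sum_c' : \sum_i c' i * e i = (\sum_k s k * x (ev k)) * e t.
    rewrite (bigID (mem (class_of t))) /= [X in _ + X]big1 ?addr0; last first.
      by move=> i /negbTE nit; rewrite /c' nit mul0r.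
    rewrite [LHS]big_enum_val mulr_suml /=; apply: eq_bigr => k' _.
    by rewrite -/(ev k') c'E /x !mulrA divfK.
  have sx_ge0 k' : vle (Some 0) (v (s k' * x (ev k'))).
    by rewrite valuationM vx // vaddr0; case: (sP k').
  have sum_gt : vlt (Some 0) (v (\sum_k s k * x (ev k))).
    apply/residue_eq0P; first exact: valuation_sum_ge.
    rewrite residue_sum // -[RHS]sum0; apply: eq_bigr => k' _.
    by have [_ s0 <-] := sP k'; rewrite residueM // vx // vle_refl.
  have := e_ind c'S (ev k); rewrite sum_c' c'E valuationM -mulrA valuationM (dP _ (ev_in k)).2.
  move=> le; rewrite /vlt; apply/negP => sk_le.
  have := vlt_add (c := v (e t)) (d := v (e t)) _ (vle_lt_trans sk_le sum_gt) (vle_refl _).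
  by rewrite /vlt le v_e => /(_ isT).
Qed.

(** The basis is partitioned by the classes of its values: the number of classes is the ramification
    index, and each class has as many members as the residue degree. *)
Lemma graded_degree :
  (subgroup_index (value_group v L) (value_group v S) *
   ext_degree (residue_subfield v L) (residue_subfield v S))%N = #|I|.
Proof.
rewrite graded_index -[RHS]sum1_card (partition_big class (mem reps)) /=; last first.
  by move=> i _; rewrite inE class_eq; apply/same_class_sym/classP.
rewrite (eq_bigr (fun=> ext_degree (residue_subfield v L) (residue_subfield v S))).
  by rewrite sum_nat_const.
move=> t t_rep; rewrite (graded_residue_degree t_rep) -sum1_card.
by apply: eq_bigl => i; rewrite inE.
Qed.

End GradedDegree.

(** * Roots of key polynomials *)

Section KeyRoots.
Variables (E : closedFieldType) (G : oagType) (v : valuation E G).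
Variables (F : fieldType) (iota : {rmorphism F -> E}).
Hypothesis Falg : forall z, algebraicOver iota z.
Variable W : valuation {poly F} G.
Hypothesis W_ext : forall c, W c%:P = v (iota c).
Local Notation "p ^i" := (map_poly iota p) (at level 2, format "p ^i").

Lemma key_irreducible (R : fieldType) (U : valuation {poly R} G) (f : {poly R}) :
  key_polynomial U f -> (1 < size f)%N -> irreducible_poly f.
Proof.
move=> [_ f_prime f_min] f1; split=> // q size_q /dvdpP[k def_f].
have f0 : f != 0 by rewrite -size_poly_gt0 ltnW.
have [k0 q0] : k != 0 /\ q != 0 by apply/andP; rewrite -negb_or -mulf_eq0 -def_f.
have size_f : size f = (size k + size q).-1 by rewrite def_f size_mul.
have : (0 < size k)%N by rewrite size_poly_gt0.
have : (0 < size q)%N by rewrite size_poly_gt0.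
have f_kq : w_divides U f (k * q).
  by rewrite -def_f -[X in w_divides _ _ X]mulr1; apply: w_divides_mull; rewrite ?oner_neq0.
rewrite -dvdp_size_eqp; last by rewrite def_f dvdp_mull.
case: (f_prime _ _ f_kq) => [/(f_min _ k0)|/(f_min _ q0)]; rewrite size_f;
  move: size_q; move: (size k) (size q) => x y; lia.
Qed.

(* Satisfied by the polynomials that are irreducible over the Henselization. *)
Definition isometric_conjugates (f : {poly F}) : Prop :=
  forall x y, root f^i x -> root f^i y -> exists s : {rmorphism E -> E},
    [/\ forall a, s (iota a) = iota a, forall a, v (s a) = v a & s x = y].

Lemma isometric_conjugates_irreducible (F' : fieldType) (j : {rmorphism F' -> E})
    (emb : {rmorphism F -> F'}) (f : {poly F}) :
  (forall a, j (emb a) = iota a) -> henselian v (range j) ->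
  irreducible_poly (map_poly emb f) -> isometric_conjugates f.
Proof.
move=> jE Hh f_irr x y.
have <- : map_poly j (map_poly emb f) = f^i.
  by apply/polyP => k; rewrite !coef_map /= jE.
have F'alg z : algebraicOver j z.
  apply: (@algebraicOver_sub _ _ _ iota) => // _ [a _ <-].
  by exists (emb a); rewrite ?jE.
move=> fx fy; have [s [sF' sx]] := extend_embedding F'alg f_irr fx fy.
exists s; split=> // a; first by rewrite -jE sF'.
by apply: (henselian_conj Hh) => _ [b _ <-].
Qed.

(** Let p be the minimal polynomial of the value of [a] at [t]. All roots of p have the same value,
    so its Newton polygon is one segment. As [f] divides p(a), the element [a] modulo [f] satisfies
    the same relation for [W], and the slope of the segment forces [W a]. *)
Lemma key_root_value (f a : {poly F}) t : key_polynomial W f -> (1 < size f)%N ->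
  isometric_conjugates f -> root f^i t -> (size a < size f)%N ->
  v a^i.[t] = W a.
Proof.
move=> fk f1 f_conj ft size_a; have f_irr := key_irreducible fk f1.
have [->|a0] := eqVneq a 0; first by rewrite rmorph0 horner0 !valuation0.
have f0 : f != 0 by rewrite -size_poly_gt0 ltnW.
have ndvd (h : {poly F}) : h != 0 -> (size h < size f)%N -> ~ w_divides W f h.
  by move=> h0 size_h; apply: expands_ndvd => //; apply: key_expands.
have at0 : a^i.[t] != 0.
  rewrite -rootE (irreducible_root_dvd a f_irr ft); apply/negP => /dvdp_leq.
  by rewrite a0 leqNgt size_a => /(_ isT).
have [g vg] := valuation_Some v at0; have [s Ws] := valuation_Some W a0.
rewrite vg Ws; congr Some; apply/esym.
have [p [pm p_irr pt]] := min_poly_exists (Falg a^i.[t]).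
(* Since [f] is prime for [W], it divides no power of [a], and reducing such a power modulo [f]
   preserves its value. *)
have Wmod k : W ((a ^+ k) %% f) = Some (s *+ k).
  suff [] : W ((a ^+ k) %% f) = Some (s *+ k) /\ ~ w_divides W f (a ^+ k) by [].
  elim: k => [|k [IHw IHd]].
    rewrite expr0 modp_small ?size_poly1 // valuation1; split=> //.
    by apply: ndvd; rewrite ?oner_neq0 ?size_poly1.
  have nd : ~ w_divides W f (a ^+ k.+1).
    by rewrite exprS; case: fk => _ f_prime _ /f_prime[/(ndvd _ a0 size_a)|/IHd].
  split=> //; have ak0 : a ^+ k.+1 != 0 by rewrite expf_neq0.
  have [-> _] := expands_rem f0 (key_expands fk) ak0 nd.
  exact: valuationX.
apply: (@root_value_unique _ _ v _ iota p g s _ W (fun k => (p`_k)%:P)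
  (fun k => (a ^+ k) %% f)) => //.
- by case: p_irr.
- move=> x px; rewrite -vg; have [r [rF rx]] := extend_embedding Falg p_irr pt px.
  have [|r' [r'F r'v r'x]] := f_conj t (r t) ft; first exact: conj_root.
  have conj_a (q : {rmorphism E -> E}) : (forall b, q (iota b) = iota b) ->
      q a^i.[t] = a^i.[q t].
    move=> qF; rewrite -horner_map; congr _.[_].
    by apply/polyP => k; rewrite !coef_map /= qF.
  by rewrite -rx conj_a // -r'x -conj_a // r'v.
- apply: (@etrans _ _ ((p \Po a) %% f)); last first.
    apply/eqP; rewrite -/(dvdp f _) -(irreducible_root_dvd _ f_irr ft).
    by rewrite map_comp_poly rootE horner_comp.
  rewrite comp_polyE (big_morph (fun q => q %% f) (id1 := 0) (op1 := +%R)) ?mod0p //.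
    by apply: eq_bigr => k _; rewrite modpZl mul_polyC.
  by move=> x y; rewrite modpD.
Qed.

Lemma adjoin_degree (p : {poly F}) t : irreducible_poly p -> root p^i t ->
  ext_degree (adjoin (range iota) t) (range iota) = (size p).-1.
Proof.
move=> p_irr pt; have p0 : p != 0 := irredp_neq0 p_irr.
have size_p : size p = (size p).-1.+1 by rewrite prednK // size_poly_gt0.
apply: (@ext_degreeE _ _ (range_subfield iota) _ _
  (fun k : 'I_(size p).-1 => t ^+ k)); split.
- by move=> k; apply: (subfieldX (adjoin_subfield _ _)); apply: mem_adjoin.
- move=> _ /(adjoin_polyP _ p_irr pt)[h size_h ->].
  exists (fun k => iota h`_k) => [k|]; first by exists h`_k.
  rewrite (@horner_coef_wide _ (size p).-1) ?size_map_poly; last first.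
    by rewrite -ltnS -size_p.
  by apply: eq_bigr => k _; rewrite coef_map.
- move=> c cS sum0; have ex k : exists a, iota a = c k by have [a] := cS k; exists a.
  have [d dP] := choice ex; pose h := \poly_(k < (size p).-1) (if insub k is Some k' then d k' else 0).
  have hE (k : 'I_(size p).-1) : h`_k = d k by rewrite coef_poly ltn_ord valK.
  have size_h : (size h <= (size p).-1)%N by apply: size_poly.
  have /eqP : h^i.[t] = 0.
    rewrite (@horner_coef_wide _ (size p).-1) ?size_map_poly // -[RHS]sum0.
    by apply: eq_bigr => k _; rewrite coef_map /= hE dP.
  rewrite -/(root _ _) (irreducible_root_dvd _ p_irr pt) => ph.
  have h0 : h = 0.
    apply/eqP; apply: contraTT ph => h0; apply/negP => /dvdp_leq.
    by rewrite h0 leqNgt size_p ltnS size_h => /(_ isT).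
  by move=> k; rewrite -dP -hE h0 coef0 rmorph0.
Qed.

Lemma key_graded_degree (f : {poly F}) t (I : finType) (e : I -> {poly F}) :
  key_polynomial W f -> (1 < size f)%N -> isometric_conjugates f ->
  root f^i t -> graded_basis W (size f).-1 e ->
  (subgroup_index (value_group v (adjoin (range iota) t)) (value_group v (range iota)) *
   ext_degree (residue_subfield v (adjoin (range iota) t))
     (residue_subfield v (range iota)))%N = #|I|.
Proof.
move=> fk f1 f_conj ft [[e0 e_ind] size_e e_span].
have f_irr := key_irreducible fk f1.
have size_f : size f = (size f).-1.+1 by rewrite prednK // ltnW.
have val (a : {poly F}) : (size a <= (size f).-1)%N -> v a^i.[t] = W a.
  by move=> size_a; apply: (key_root_value fk f1 f_conj ft); rewrite size_f ltnS.
have size_sum (c : I -> F) : (size (\sum_k c k *: e k)%R <= (size f).-1)%N.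
  apply: leq_trans (size_sum _ _ _) _; apply/bigmax_leqP => k _.
  by apply: leq_trans (size_scale_leq _ _) (size_e k).
have eval_sum (c : I -> F) :
    (\sum_k c k *: e k)^i.[t] = \sum_k iota (c k) * (e k)^i.[t].
  rewrite rmorph_sum /= horner_sum; apply: eq_bigr => k _.
  by rewrite map_polyZ hornerZ.
apply: (@graded_degree _ _ v _ _ (range_subfield iota) (adjoin_subfield _ _)
  (@sub_adjoin _ _ t) _ (fun k => (e k)^i.[t])).
- by move=> k; apply/(adjoin_polyP _ f_irr ft); exists (e k); rewrite // size_f ltnS.
- by move=> k; rewrite -(valuation_neqN v) val // valuation_neqN.
- move=> c cS k; have ex j : exists a, iota a = c j by have [a] := cS j; exists a.
  have [d dP] := choice ex.
  have -> : \sum_j c j * (e j)^i.[t] = (\sum_j d j *: e j)^i.[t].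
    by rewrite eval_sum; apply: eq_bigr => j _; rewrite dP.
  have -> : c k * (e k)^i.[t] = (d k *: e k)^i.[t].
    by rewrite map_polyZ hornerZ /= dP.
  rewrite !val ?size_sum //; last exact: leq_trans (size_scale_leq _ _) (size_e k).
- move=> _ /(adjoin_polyP _ f_irr ft)[a size_a ->] at0.
  have a0 : a != 0 by apply: contraNneq at0 => ->; rewrite rmorph0 horner0.
  rewrite size_f ltnS in size_a.
  have [c ac] := e_span a a0 size_a.
  exists (fun k => iota (c k)); split; first by move=> k; exists (c k).
  rewrite -eval_sum /vsim -hornerN -hornerD -rmorphN -rmorphD /= !val //.
  apply: leq_trans (size_polyD _ _) _.
  by rewrite size_polyN geq_max size_a size_sum.
Qed.

End KeyRoots.

Section ImmediateInvariants.
Variables (E : closedFieldType) (G : oagType) (v : valuation E G) (S L : set E).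
Hypotheses (SL : S `<=` L) (SL_imm : immediate v S L).

Lemma immediate_value_group : value_group v L = value_group v S.
Proof.
apply/seteqP; split=> [g [a La va]|g [a Sa va]]; last by exists a => //; apply: SL.
have a0 : a != 0 by rewrite -(valuation_neqN v) va.
by have [b Sb ab] := SL_imm La a0; exists b; rewrite // (vsim_val ab).
Qed.

Lemma immediate_residue_subfield : S 0 -> residue_subfield v L = residue_subfield v S.
Proof.
move=> S0; apply/seteqP; split=> _ [a [La a_ge0] <-]; last first.
  by exists a => //; split=> //; apply: SL.
have [va|a_gt0] := vle_eqVlt a_ge0; last first.
  by exists 0; [split; rewrite ?valuation0 ?vleN | rewrite residue0 (residue_eq0P a_ge0).2].
have a0 : a != 0 by rewrite -(valuation_neqN v) -va.
have [b Sb ab] := SL_imm La a0.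
have b_ge0 : vle (Some 0) (v b) by rewrite (vsim_val ab).
exists b => //; apply/eqP; rewrite eq_sym -subr_eq0 -residueB //.
by apply/eqP/residue_eq0P; [apply: valuationB_ge | rewrite va].
Qed.

End ImmediateInvariants.

(** * Key polynomials over the Henselization *)

Section RestrictValuation.
Variables (K : fieldType) (G : oagType) (w : valuation {fraction {poly K}} G).

(** The underlying function is [restrict_poly w] itself, so hypotheses on key polynomials transfer
    by conversion. *)
Definition poly_valuation : valuation {poly K} G.
Proof.
exists (restrict_poly w) => [p|p q|p q]; rewrite /restrict_poly.
- by rewrite valuation_eqN tofrac_eq0.
- by rewrite tofracM valuationM.
- by rewrite tofracD valuationD.
Defined.

End RestrictValuation.

Section HenselianLift.
Variables (K : fieldType) (E : closedFieldType) (iota : {rmorphism K -> E}).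
Hypothesis Kalg : forall z, algebraicOver iota z.
Variables (G : oagType) (v : valuation E G).
Local Notation S := (range iota).
Local Notation H := (henselization v S).
Local Notation Kh := (henselization_type v S).
Local Notation embed := (henselization_embed iota v).
Local Notation "p ^h" := (map_poly embed p) (at level 2, format "p ^h").
Variables (W : valuation {poly K} G) (wh : valuation {poly Kh} G).
Hypothesis whE : forall p, wh p^h = W p.
Hypothesis wh_ext : forall c : Kh, wh c%:P = v (val c).

Definition hval : {rmorphism Kh -> E} := \val.

Lemma range_hval : range hval = H.
Proof.
apply/seteqP; split=> [_ [x _ <-]|x Hx].
  exact: set_mem (henselization_valP x).
by exists (Henselization (mem_set Hx)).
Qed.

Lemma hval_embed a : hval (embed a) = iota a. Proof. by []. Qed.

Lemma Kh_alg z : algebraicOver hval z.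
Proof.
by apply: (@algebraicOver_sub _ _ _ iota) => //; rewrite range_hval; apply: sub_henselization.
Qed.

Lemma henselian_hval : henselian v (range hval).
Proof. by rewrite range_hval; apply: henselization_henselian. Qed.

Lemma W_ext c : W c%:P = v (iota c).
Proof. by rewrite -whE map_polyC wh_ext. Qed.

(** The second clause fixes the approximant of 0, which has no initial form, so that approximation
    can be done termwise in sums. *)
Lemma Kh_approx (c : Kh) : exists a : K,
  (c != 0 -> vsim v (val c) (iota a)) /\ (c = 0 -> a = 0).
Proof.
have [->|c0] := eqVneq c 0; first by exists 0; split.
have Hc : H (val c) by have := henselization_valP c => /set_mem.
have [|_ [a _ <-] ca] := henselization_immediate Kalg Hc.
  by rewrite -(inj_eq val_inj) in c0.
by exists a; split=> // /eqP; rewrite (negbTE c0).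
Qed.

Lemma whZ (c : Kh) p : wh (c *: p) = vadd (v (val c)) (wh p).
Proof. by rewrite valuationZ wh_ext. Qed.

Section Lift.
Variable f : {poly K}.
Hypotheses (f_key : key_polynomial W f) (fh_key : key_polynomial wh f^h).
Hypotheses (f_size : (1 < size f)%N).
Let fh_size : (1 < size f^h)%N. Proof. by rewrite size_map_poly. Qed.
Let fh_irr : irreducible_poly f^h. Proof. exact: key_irreducible fh_key fh_size. Qed.

Lemma root_exists : exists t, root (map_poly iota f) t.
Proof.
by apply: closed_rootP; rewrite size_map_poly; move: f_size; case: size => [|[]].
Qed.

Lemma map_hval_embed (p : {poly K}) : map_poly hval p^h = map_poly iota p.
Proof. by rewrite -map_poly_comp. Qed.

Lemma irreducible_conjugates (q : {poly Kh}) : irreducible_poly q ->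
  @isometric_conjugates _ _ v _ hval q.
Proof.
move=> q_irr x y qx qy; have [s [sF sx]] := extend_embedding Kh_alg q_irr qx qy.
exists s; split=> //; apply: (henselian_conj henselian_hval) => _ [b _ <-].
exact: sF.
Qed.

(** Below deg f, values can be read at a root [t]. There [h] takes a value in K^h(t), the
    Henselization of K(t), and immediacy provides a polynomial over [K] with an equivalent value. *)
Lemma approx_reduced (h : {poly Kh}) : h != 0 -> (size h < size f)%N ->
  exists2 k : {poly K}, (size k < size f)%N & vsim wh h k^h.
Proof.
move=> h0 size_h; have [t ft] := root_exists.
have ft' : root (map_poly hval f^h) t by rewrite map_hval_embed.
have fh_conj := irreducible_conjugates fh_irr.
have val_h (p : {poly Kh}) : (size p < size f)%N -> v (map_poly hval p).[t] = wh p.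
  by move=> size_p; apply: (key_root_value Kh_alg wh_ext fh_key) => //;
    rewrite size_map_poly.
have ht0 : (map_poly hval h).[t] != 0 by rewrite -(valuation_neqN v) val_h ?valuation_neqN.
have Sadj := adjoin_subfield S t.
have [F' [i' [def_A F'alg]]] := subfield_algebraic Kalg Sadj (@sub_adjoin _ S t).
have Hht : henselization v (adjoin S t) (map_poly hval h).[t].
  rewrite (henselization_adjoin v Kalg) -range_hval.
  by apply/(adjoin_polyP _ fh_irr ft'); exists h; rewrite // size_map_poly.
rewrite -def_A in Hht; have [b] := henselization_immediate F'alg Hht ht0.
have f_irr := key_irreducible f_key f_size.
rewrite def_A => /(adjoin_polyP _ f_irr ft)[k size_k ->] hk; exists k => //.
rewrite /vsim -!val_h //; first by rewrite rmorphB /= hornerD hornerN map_hval_embed.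
apply: leq_ltn_trans (size_polyD _ _) _.
by rewrite size_polyN size_map_poly gtn_max size_h.
Qed.

(** Digits of the expansion in powers of [f] are approximated one by one; since values are minima
    over the digits, the errors stay above the value of [h]. *)
Lemma approx (h : {poly Kh}) : h != 0 -> exists k : {poly K}, vsim wh h k^h.
Proof.
move=> h0; have [|d [size_d d0 def_h]] := @expansion _ f^h (size h) h fh_size.
  by rewrite leq_pmulr // -subn1 subn_gt0.
have ex_k i : exists k : {poly K}, (d i != 0 -> vsim wh (d i) k^h) /\ (d i = 0 -> k = 0).
  have [->|di0] := eqVneq (d i) 0; first by exists 0; split.
  have [|k _ dk] := approx_reduced di0; first by rewrite -(size_map_poly embed).
  by exists k; split=> // /eqP; rewrite (negbTE di0).
have [k kP] := choice ex_k; exists (\sum_(i < size h) k i * f ^+ i).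
rewrite /vsim {2}def_h rmorph_sum /= -sumrB.
apply: valuation_sum_gt; first by rewrite valuation_neqN.
move=> i _; rewrite rmorphM rmorphXn /= -mulrBl.
have [di0|di0] := eqVneq (d i) 0.
  by rewrite di0 (kP i).2 // rmorph0 subr0 mul0r valuation0 vltxN valuation_neqN.
apply: (@vle_lt_trans _ (wh (d i * f^h ^+ i))).
  by rewrite {1}def_h; apply: expands_sum => //; apply: key_expands.
rewrite ![_ * f^h ^+ i]mulrC; apply: valuationM_lt; last exact: (kP i).1.
by rewrite expf_neq0 // -size_poly_gt0 ltnW.
Qed.

Lemma vsim_embed (k l : {poly K}) : vsim wh k^h l^h <-> vsim W k l.
Proof. by rewrite /vsim -rmorphB /= !whE. Qed.

(** A cofactor over K^h may be replaced by its approximant over [K]. *)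
Lemma w_divides_embed (k l : {poly K}) : w_divides wh k^h l^h <-> w_divides W k l.
Proof.
split=> /w_dividesP[h]; last first.
  by move=> lkh; apply/w_dividesP; exists h^h; rewrite -rmorphM vsim_embed.
move=> lkh; have := vsim_neq0r lkh; rewrite mulf_eq0 negb_or => /andP[k0 h0].
have [h' hh'] := approx h0; apply/w_dividesP; exists h'.
by rewrite -vsim_embed rmorphM /=; apply: (vsim_trans lkh); apply: vsimMl.
Qed.

Variable g : {poly K}.
Hypotheses (g_key : key_polynomial W g) (g_size : (1 < size g)%N).
Let g0 : g != 0. Proof. by rewrite -size_poly_gt0 ltnW. Qed.
Let gh0 : g^h != 0. Proof. by rewrite map_poly_eq0. Qed.

Lemma embed_prime (a b : {poly Kh}) : w_divides wh g^h (a * b) ->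
  w_divides wh g^h a \/ w_divides wh g^h b.
Proof.
move=> gab; have [_] := w_divides_neq0 gab; rewrite mulf_eq0 negb_or => /andP[a0 b0].
have [a' aa'] := approx a0; have [b' bb'] := approx b0.
have : w_divides W g (a' * b').
  by rewrite -w_divides_embed rmorphM /=; apply: w_divides_sim gab; apply: vsimM.
case: g_key => _ g_prime _ /g_prime[ga|gb]; [left|right].
  by apply: w_divides_sim (vsim_sym aa') _; rewrite w_divides_embed.
by apply: w_divides_sim (vsim_sym bb') _; rewrite w_divides_embed.
Qed.

(* Over the henselization, [g] is equivalent, up to a unit, to a key polynomial
   that could a priori have smaller degree. *)
Lemma associate_key : exists q : {poly Kh},
  [/\ key_polynomial wh q, (1 < size q)%N, w_divides wh g^h q, w_divides wh q g^h &
     forall a, w_divides wh g^h a -> (size q <= size a)%N].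
Proof.
pose P n := `[< exists q : {poly Kh}, w_divides wh g^h q /\ size q = n >].
have gg : w_divides wh g^h g^h.
  by rewrite -[X in w_divides _ _ X]mulr1; apply: w_divides_mull; rewrite ?oner_neq0.
have exP : exists n, P n by exists (size g^h); apply/asboolP; exists g^h.
case: (ex_minnP exP) => _ /asboolP[q1 [gq1 <-]] n_min.
have [_ q10] := w_divides_neq0 gq1.
have lq0 : (lead_coef q1)^-1 != 0 by rewrite invr_eq0 lead_coef_eq0.
pose q := (lead_coef q1)^-1 *: q1.
have q_monic : q \is monic by rewrite monicE lead_coefZ mulVf // lead_coef_eq0.
have q0 := monic_neq0 q_monic.
have gq : w_divides wh g^h q.
  by rewrite /q -mul_polyC mulrC; apply: w_divides_mulr; rewrite ?polyC_eq0.
have q_min a : w_divides wh g^h a -> (size q <= size a)%N.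
  by move=> ga; rewrite size_scale // n_min //; apply/asboolP; exists a.
have q_exp : expands wh q.
  apply: expandsP => r r0 size_r qr.
  by have := q_min r (w_divides_trans gq qr); rewrite leqNgt size_r.
(* Otherwise the remainder of [g] modulo [q] keeps the value of [g]. Writing q ~ g u, it is
   equivalent to g (1 - k u), hence a multiple of [g] in the graded ring of smaller degree than
   [q]. *)
have qg : w_divides wh q g^h.
  apply: contrapT => nqg.
  have [Wr Wq] := expands_rem q0 q_exp gh0 nqg.
  set k := g^h %/ q in Wq; set r := g^h %% q in Wr.
  have /w_dividesP[u qu] := gq.
  have : w_divides wh g^h r.
    apply/w_dividesP; exists (1 - k * u); rewrite /vsim Wr.
    have -> : r - g^h * (1 - k * u) = - (k * (q - g^h * u)).
      have -> : r = g^h - k * q by rewrite [X in X - _](divp_eq g^h q) addrC addKr.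
      by ring.
    rewrite valuationN; have [->|k0] := eqVneq k 0.
      by rewrite mul0r valuation0 vltxN valuation_neqN.
    by apply: vle_lt_trans Wq _; apply: valuationM_lt.
  by move=> /q_min; rewrite leqNgt ltn_modp q0.
exists q; split=> //.
- split=> // [a b qab|a a0 /(w_divides_trans gq)/q_min //].
  by case: (embed_prime (w_divides_trans gq qab)) => [ga|gb]; [left; exact: w_divides_trans ga | right; exact: w_divides_trans gb].
- rewrite ltnNge; apply/negP => /size1_polyC; move: (q`_0) => c def_q.
  have c0 : c != 0 by apply: contraNneq q0 => c0; rewrite def_q c0.
  apply: (key_nonunit g_key g_size); rewrite /w_unit -w_divides_embed rmorph1.
  apply: (w_divides_trans gq); apply/w_dividesP; exists c^-1%:P.
  by rewrite def_q -polyCM mulfV // vsim_refl ?oner_neq0.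
Qed.

(** Below deg g nothing nonzero is divisible by [g] for [W], hence nor by [q] for [wh], so reduction
    modulo [q] keeps values. The reduced family spans because a defective approximation would be a
    multiple of [g] of degree below deg q. *)
Lemma associate_graded_basis (q : {poly Kh}) (I : finType) (e : I -> {poly K}) :
  key_polynomial wh q -> w_divides wh g^h q -> w_divides wh q g^h ->
  (forall a, w_divides wh g^h a -> (size q <= size a)%N) ->
  graded_basis W (size g).-1 e ->
  graded_basis wh (size q).-1 (fun i => (e i)^h %% q).
Proof.
move=> q_key gq qg q_min [[e0 e_ind] size_e e_span].
have [_ q0] := w_divides_neq0 gq; have q_exp := key_expands q_key.
have size_q : size q = (size q).-1.+1 by rewrite prednK // size_poly_gt0.
have size_g : size g = (size g).-1.+1 by rewrite prednK // ltnW.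
have ndvd_g (a : {poly K}) : a != 0 -> (size a <= (size g).-1)%N -> ~ w_divides W g a.
  by move=> a0 size_a; apply: expands_ndvd (key_expands g_key) a0 _; rewrite size_g ltnS.
have q_embed (a : {poly K}) : ~ w_divides W g a -> ~ w_divides wh q a^h.
  by move=> nga qa; apply: nga; rewrite -w_divides_embed; apply: w_divides_trans gq qa.
have rem (a : {poly K}) : a != 0 -> (size a <= (size g).-1)%N ->
    wh (a^h %% q) = W a /\ vle (W a) (wh (a^h %/ q * q)).
  move=> a0 size_a; rewrite -whE; apply: expands_rem => //.
    by rewrite map_poly_eq0.
  by apply/q_embed/ndvd_g.
have size_sum (c : I -> K) : (size (\sum_k c k *: e k)%R <= (size g).-1)%N.
  apply: leq_trans (size_sum _ _ _) _; apply/bigmax_leqP => k _.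
  by apply: leq_trans (size_scale_leq _ _) (size_e k).
have mod_sum (c : I -> Kh) :
    \sum_i c i *: ((e i)^h %% q) = (\sum_i c i *: (e i)^h) %% q.
  rewrite [RHS](big_morph (fun p => p %% q) (id1 := 0) (op1 := +%R)) ?mod0p //.
    by apply: eq_bigr => i _; rewrite modpZl.
  by move=> x y; rewrite modpD.
have size_r i : (size ((e i)^h %% q)%R <= (size q).-1)%N.
  by rewrite -ltnS -size_q ltn_modp.
split=> //.
- split=> [i|c j].
    by rewrite -(valuation_neqN wh) (rem _ (e0 i) (size_e i)).1 valuation_neqN.
  (* Coefficients in K^h are replaced by elements of [K] with the same initial forms, so that
     independence over [K] applies. *)
  have [c' c'P] := choice (fun i => Kh_approx (c i)).
  have Wterm i : W (c' i *: e i) = wh (c i *: (e i)^h).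
    rewrite whZ whE valuationZ W_ext; have [ci0|ci0] := eqVneq (c i) 0.
      by rewrite (c'P i).2 // ci0 !rmorph0 valuation0.
    by rewrite (vsim_val ((c'P i).1 ci0)).
  have Wterm_r i : wh (c i *: ((e i)^h %% q)) = W (c' i *: e i).
    by rewrite Wterm !whZ whE (rem _ (e0 i) (size_e i)).1.
  rewrite Wterm_r mod_sum; pose a := \sum_i c' i *: e i.
  have a_le i : vle (W a) (W (c' i *: e i)) by apply: e_ind.
  have [a0|a0] := eqVneq a 0.
    have : vle None (W (c' j *: e j)) by rewrite -(valuation0 W) -a0; apply: a_le.
    by case: (W (c' j *: e j)) => // _; apply: vleN.
  have simB : vsim wh a^h (\sum_i c i *: (e i)^h).
    rewrite /vsim valuationBC whE /a rmorph_sum /= -sumrB.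
    apply: valuation_sum_gt; first by rewrite valuation_neqN.
    move=> i _; rewrite map_polyZ -scalerBl.
    have [ci0|ci0] := eqVneq (c i) 0.
      by rewrite ci0 (c'P i).2 // rmorph0 subr0 scale0r valuation0 vltxN valuation_neqN.
    apply: vle_lt_trans (a_le i) _; rewrite Wterm !whZ.
    rewrite vaddC [X in vlt _ X]vaddC; apply: vlt_add2l.
      by rewrite whE valuation_neqN.
    exact: (c'P i).1.
  have B0 := vsim_neq0r simB.
  have [|-> _] := expands_rem q0 q_exp B0; last by rewrite (vsim_val simB) whE.
  move=> qB; apply: (q_embed a); first exact: (ndvd_g a a0 (size_sum c')).
  exact: w_divides_sim (vsim_sym simB) qB.
- move=> rho rho0; rewrite -ltnS -size_q => size_rho.
  have nd_rho : ~ w_divides wh g^h rho by move=> /q_min; rewrite leqNgt size_rho.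
  (* Move [rho] down to [a] over [K], reduce modulo [g], expand in the given basis, and go back up
     modulo [q]. *)
  have [a rho_a] := approx rho0.
  have nga : ~ w_divides W g a.
    by rewrite -w_divides_embed => /(w_divides_sim (vsim_sym rho_a)).
  have a0 : a != 0 by have := vsim_neq0r rho_a; rewrite map_poly_eq0.
  have [Wa0 Wka] := expands_rem g0 (key_expands g_key) a0 nga.
  set k := a %/ g in Wka; set a1 := a %% g in Wa0.
  have a10 : a1 != 0 by rewrite -(valuation_neqN W) Wa0 valuation_neqN.
  have [|c a1c] := e_span a1 a10; first by rewrite -ltnS -size_g ltn_modp.
  set s := \sum_i c i *: e i in a1c.
  have Wrho : W a = wh rho by rewrite -whE (vsim_val rho_a).
  have [_ Wsq] := rem s (vsim_neq0r a1c) (size_sum c).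
  exists (fun i => embed (c i)); rewrite mod_sum.
  have -> : \sum_i embed (c i) *: (e i)^h = s^h.
    by rewrite /s rmorph_sum /=; apply: eq_bigr => i _; rewrite map_polyZ.
  rewrite /vsim /vlt; apply/negP => D_le.
  set D := rho - s^h %% q in D_le; set kq := s^h %/ q in Wsq.
  have /w_dividesP[u qu] := gq.
  (* Modulo terms of value above that of [rho], the error [D] is the sum of a multiple of [g] and of
     kq * q, and q ~ g u. *)
  have gD : w_divides wh g^h D.
    apply/w_dividesP; exists (k^h + kq * u).
    have Da : a^h = k^h * g^h + a1^h by rewrite {1}(divp_eq a g) rmorphD rmorphM.
    have Ds : s^h %% q = s^h - kq * q by rewrite [X in X - _](divp_eq s^h q) addrC addKr.
    have -> : vsim wh D (g^h * (k^h + kq * u)) =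
        vlt (wh D) (wh ((rho - a^h) + (a1 - s)^h + kq * (q - g^h * u))).
      rewrite /vsim; congr (vlt _ (wh _)); rewrite rmorphB /= /D Ds Da.
      by ring.
    apply: vle_lt_trans D_le _; apply: valuationD_gt.
      apply: valuationD_gt; first exact: rho_a.
      by rewrite whE -Wrho -Wa0.
    have [->|kq0] := eqVneq kq 0.
      by rewrite mul0r valuation0 vltxN valuation_neqN.
    rewrite -Wrho -Wa0 -(vsim_val a1c); apply: vle_lt_trans Wsq _.
    exact: valuationM_lt.
  have := q_min D gD; rewrite leqNgt => /negP[].
  apply: leq_ltn_trans (size_polyD _ _) _.
  by rewrite size_polyN gtn_max size_rho ltn_modp.
Qed.

(** The two claims share one statement because the degree comparison uses the same [m] and [N] that
    give both defects. *)
Theorem key_polynomial_embed : key_polynomial wh g^h /\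
  exists N M s s', [/\ (0 < s)%N, (0 < s')%N, (0 < N)%N & (0 < M)%N] /\
  [/\ (size f).-1 = (s * M)%N, (size g).-1 = (s' * M)%N,
    exists (I : finType) (e : I -> {poly K}), #|I| = (s * N)%N /\ graded_basis W (size f).-1 e &
    exists (I : finType) (e : I -> {poly K}), #|I| = (s' * N)%N /\ graded_basis W (size g).-1 e].
Proof.
have [m [N [m0 N0 basisK]]] := key_graded_basis f_key f_size.
have [m' [N' [m'0 N'0 basisH]]] := key_graded_basis fh_key fh_size.
have [s0 [I0 [e0 [size_f card_I0 e0b]]]] := basisK f f_key f_size.
have [s2 [I2 [e2 [size_g card_I2 e2b]]]] := basisK g g_key g_size.
have [s1 [I1 [e1 [size_fh card_I1 e1b]]]] := basisH f^h fh_key fh_size.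
have [q [q_key q_size gq qg q_min]] := associate_key.
have [s3 [I3 [e3 [size_q card_I3 e3b]]]] := basisH q q_key q_size.
have pos n s k : (1 < n)%N -> n.-1 = (s * k)%N -> (0 < s)%N.
  by case: s => //; case: n => [|[]].
have s0_gt0 := pos _ _ _ f_size size_f; have s2_gt0 := pos _ _ _ g_size size_g.
have s1_gt0 := pos _ _ _ fh_size size_fh.
have [t ft] := root_exists.
have ft' : root (map_poly hval f^h) t by rewrite map_hval_embed.
have f_conj : @isometric_conjugates _ _ v _ iota f.
  exact: (isometric_conjugates_irreducible Kalg hval_embed henselian_hval fh_irr).
have fh_conj := irreducible_conjugates fh_irr.
have card_f := key_graded_degree Kalg W_ext f_key f_size f_conj ft e0b.
have card_fh := key_graded_degree Kh_alg wh_ext fh_key fh_size fh_conj ft' e1b.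
(* K^h | K and K(t)^h | K(t) are immediate, so the ramification index and the residue degree at [t]
   are the same over K and over K^h. *)
have card_eq : #|I0| = #|I1|.
  rewrite -card_f -card_fh range_hval -(henselization_adjoin v Kalg).
  have [F' [i' [def_A F'alg]]] :=
    subfield_algebraic Kalg (adjoin_subfield S t) (@sub_adjoin _ S t).
  rewrite -def_A.
  have SH := @sub_henselization _ _ v S; have LH := @sub_henselization _ _ v (range i').
  rewrite (immediate_value_group SH (henselization_immediate Kalg)).
  rewrite (immediate_value_group LH (henselization_immediate F'alg)).
  rewrite (immediate_residue_subfield SH (henselization_immediate Kalg)).
    rewrite (immediate_residue_subfield LH (henselization_immediate F'alg)) //.
    exact: (subfield0 (range_subfield i')).
  exact: (subfield0 (range_subfield iota)).
have q_irr := key_irreducible q_key q_size.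
have [z qz] : exists z, root (map_poly hval q) z.
  by apply: closed_rootP; rewrite size_map_poly; move: q_size; case: size => [|[]].
have rb := associate_graded_basis q_key gq qg q_min e2b.
have q_conj := irreducible_conjugates q_irr.
have card_q := key_graded_degree Kh_alg wh_ext q_key q_size q_conj qz e3b.
have card_q' := key_graded_degree Kh_alg wh_ext q_key q_size q_conj qz rb.
have size_qg : size q = size g^h.
  rewrite !size_map_poly in size_fh *.
  have eq1 : (s2 * N = s3 * N')%N by rewrite -card_I2 -card_I3 -card_q -card_q'.
  have eq2 : (s0 * N = s1 * N')%N by rewrite -card_I0 -card_I1.
  have eq3 : (s0 * m = s1 * m')%N by rewrite -size_f -size_fh.
  (* By [eq2] and [eq3] the ratios m : N and m' : N' agree, and [eq1] equates the basis sizes for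
     [g] and [q]; so their degrees are equal. *)
  have eq4 : (s3 * m' = s2 * m)%N.
    apply/eqP; rewrite -(eqn_pmul2r (m := s1 * N)) ?muln_gt0 ?s1_gt0 //.
    have -> : (s3 * m' * (s1 * N) = s1 * m' * (s3 * N))%N by lia.
    have -> : (s2 * m * (s1 * N) = s2 * N * (s1 * m))%N by lia.
    rewrite -eq3 eq1; apply/eqP.
    have -> : (s0 * m * (s3 * N) = s0 * N * (s3 * m))%N by lia.
    by rewrite eq2; lia.
  by rewrite -(prednK (ltnW q_size)) -(prednK (ltnW g_size)) size_q size_g eq4.
split; last first.
  exists N, m, s0, s2; split=> //; split=> //; first by exists I0, e0.
  by exists I2, e2.
split; first by apply: monic_map; case: g_key.
- exact: embed_prime.
- by move=> a _ /q_min; rewrite size_qg.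
Qed.

End Lift.
End HenselianLift.

(** * The defect *)

Section Defect.
Variables (K : fieldType) (E : closedFieldType) (iota : {rmorphism K -> E}).
Hypothesis Kalg : forall z, algebraicOver iota z.
Variables (G : oagType) (v : valuation E G).
Local Notation embed := (henselization_embed iota v).
Variables (W : valuation {poly K} G).
Hypothesis W_ext : forall c, W c%:P = v (iota c).

(** Irreducibility over K^h serves twice: it makes conjugations isometric, and it gives K^h(t) the
    full degree over K^h. *)
Lemma key_defect (f : {poly K}) t (I : finType) (e : I -> {poly K}) :
  key_polynomial W f -> (1 < size f)%N -> irreducible_poly (map_poly embed f) ->
  root (map_poly iota f) t -> graded_basis W (size f).-1 e ->
  defect v (range iota) (adjoin (range iota) t) = (size f).-1%:R / #|I|%:R.
Proof.
move=> fk f1 fh_irr ft eb; have hE := hval_embed iota v.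
have f_conj : isometric_conjugates v iota f.
  exact: (isometric_conjugates_irreducible Kalg hE (henselian_hval Kalg (v := v)) fh_irr).
rewrite /defect (key_graded_degree Kalg W_ext fk f1 f_conj ft eb).
rewrite (henselization_adjoin v Kalg) -(range_hval iota v).
rewrite (adjoin_degree fh_irr) ?size_map_poly //.
by rewrite map_hval_embed.
Qed.

End Defect.

Theorem theorem4p12
  (K : fieldType) (Kbar : closedFieldType) (iota : {rmorphism K -> Kbar})
  (iota_alg : forall z : Kbar, algebraicOver iota z)
  (G : oagType) (v : valuation K G) (vbar : valuation Kbar G)
  (vbar_ext : forall a : K, vbar (iota a) = v a)
  (w : valuation {fraction {poly K}} G)
  (w_ext : forall a : K, w (ratfunC a) = v a)
  (w_vt : valuation_transcendental w)
  (wh : valuation {poly henselization_type vbar (range iota)} G)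
  (wh_ext : is_common_extension w wh)
  (f g : {poly K})
  (f_key : key_polynomial (restrict_poly w) f)
  (g_key : key_polynomial (restrict_poly w) g)
  (* f = f^h *)
  (f_hens : is_henselian_factor wh f
              (map_poly (henselization_embed iota vbar) f))
  (theta eta : Kbar)
  (theta_root : root (map_poly iota f) theta)
  (eta_root : root (map_poly iota g) eta) :
  defect vbar (range iota) (adjoin (range iota) theta) =
  defect vbar (range iota) (adjoin (range iota) eta).
Proof.
pose W := poly_valuation w; have [whE wh_const] := wh_ext.
(* The constant 1 satisfies the definition of a key polynomial; having a root excludes it. *)
have root_size (p : {poly K}) t : key_polynomial W p -> root (map_poly iota p) t -> (1 < size p)%N.
  move=> [pm _ _] pt; rewrite ltnNge; apply/negP => /size1_polyC def_p.
  move: pt (monic_neq0 pm); rewrite def_p map_polyC rootC polyC_eq0 /=.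
  by rewrite fmorph_eq0 => ->.
have f1 := root_size f theta f_key theta_root.
have g1 := root_size g eta g_key eta_root.
have [[_ fh_irr] _ fh_key _] := f_hens.
have [gh_key [N [M [s [s' [[s0 s'0 N0 M0] [size_f size_g
  [I [e [card_I eb]]] [I' [e' [card_I' e'b]]]]]]]]]] :=
  key_polynomial_embed (W := W) iota_alg whE wh_const f_key fh_key f1 g_key g1.
have W_const c : W c%:P = vbar (iota c) by rewrite vbar_ext -w_ext.
rewrite (key_defect iota_alg W_const f_key f1 fh_irr theta_root eb).
have gh_irr := key_irreducible gh_key (_ : 1 < size _)%N.
rewrite (key_defect iota_alg W_const g_key g1 _ eta_root e'b); last first.
  by apply: gh_irr; rewrite size_map_poly.
(* After cancellation of [s] and [s'], both quotients are M / N. *)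
rewrite size_f size_g card_I card_I' !natrM.
by rewrite !invfM !mulrA ![_ * M%:R / _]mulrAC !divff ?pnatr_eq0 ?gtn_eqF // !mul1r.
Qed.
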